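(* Let $\overline{\,\cdot\,}$ be a continuous antilinear involution of $V$ and $\Lambda$ a continuous Hermitian bilinear form on $V$. Assume $V\neq\{0\}$. There exists a non-zero continuous positive linear functional on $\big(\mathcal{S}^\bullet(V),\star_\Lambda,{}^*\big)$ if and only if there exists a symmetric and Hermitian bilinear form of Hilbert-Schmidt type $b$ on $V$ such that $\Lambda(\overline v,v)+b(\overline v,v)\ge0$ holds for all $v\in V$. In this case, the continuous positive linear functionals on $\big(\mathcal{S}^\bullet(V),\star_\Lambda,{}^*\big)$ are point-separating, i.e. their common kernel is $\{0\}$.
   Context: $V$ is a complex Hausdorff locally convex space whose topology is given by its continuous Hilbert seminorms: let $\mathcal{I}_V$ be the set of continuous positive Hermitian forms $\langle\cdot\,|\,\cdot\rangle_\alpha$ on $V$ (sesquilinear, antilinear in the first argument, Hermitian, positive semi-definite), put $\|v\|_\alpha:=\sqrt{\langle v|v\rangle_\alpha}$, and let $\mathcal{P}_V$ be the set of all these seminorms; it is assumed that $\mathcal{P}_V$ is cofinal in the set of all continuous seminorms on $V$. Let $\mathcal{T}^k_{\mathrm{alg}}(V)$ be the algebraic $k$-th tensor power ($\mathcal{T}^0_{\mathrm{alg}}(V)=\mathbb{C}$), $\mathcal{T}^\bullet_{\mathrm{alg}}(V)=\bigoplus_{k\ge 0}\mathcal{T}^k_{\mathrm{alg}}(V)$, and $\langle X\rangle_k$ the degree-$k$ component of $X$. Each $\langle\cdot|\cdot\rangle_\alpha\in\mathcal{I}_V$ is extended to a positive Hermitian form $\langle X|Y\rangle_\alpha^\bullet:=\sum_{k}\langle\langle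 X\rangle_k|\langle Y\rangle_k\rangle_\alpha^\bullet$ on $\mathcal{T}^\bullet_{\mathrm{alg}}(V)$, where $\langle x_1\otimes\cdots\otimes x_k|y_1\otimes\cdots\otimes y_k\rangle_\alpha^\bullet:=k!\prod_{m=1}^k\langle x_m|y_m\rangle_\alpha$; set $\|X\|_\alpha^\bullet:=\sqrt{\langle X|X\rangle_\alpha^\bullet}$. $\mathcal{T}^\bullet(V)$ is $\mathcal{T}^\bullet_{\mathrm{alg}}(V)$ with the locally convex topology defined by all seminorms $\|\cdot\|_\alpha^\bullet$, $\|\cdot\|_\alpha\in\mathcal{P}_V$. Let $\mathrm{Sym}^\bullet$ be the symmetrisation operator, $\mathrm{Sym}^\bullet(x_1\otimes\cdots\otimes x_k)=\frac1{k!}\sum_{\sigma\in\mathfrak{S}_k}x_{\sigma(1)}\otimes\cdots\otimes x_{\sigma(k)}$, and let $\mathcal{S}^\bullet(V)$ be its image (the symmetric tensors) with the subspace topology. For a continuous bilinear form $\Lambda$ on $V$, let $P_\Lambda$ be the linear endomorphism of $\mathcal{T}^\bullet(V)\otimes\mathcal{T}^\bullet(V)$ (outer tensor product) with $P_\Lambda\big((x_1\otimes\cdots\otimes x_k)\otimes(y_1\otimes\cdots\otimes y_\ell)\big)=k\ell\,\Lambda(x_k,y_1)\,(x_1\otimes\cdots\otimes x_{k-1})\otimes(y_2\otimes\cdots\otimes y_\ell)$ for $k,\ell\ge1$, and zero if $k=0$ or $\ell=0$ (the tensor sign between the two brackets is the outer one). With $\mu_\vee(X\otimes Y):=\mathrm{Sym}^\bullet(X\otimes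 Y)$ (product in the tensor algebra on the right), $X\star_\Lambda Y:=\sum_{t=0}^\infty\frac1{t!}\mu_\vee\big((P_\Lambda)^t(X\otimes Y)\big)$ for $X,Y\in\mathcal{S}^\bullet(V)$. The $^*$-involution is the antilinear map with $(x_1\otimes\cdots\otimes x_k)^*:=\overline{x_k}\otimes\cdots\otimes\overline{x_1}$ (complex conjugation on scalars), restricted to symmetric tensors. A bilinear form $\Lambda$ is Hermitian if $\Lambda(v,w)=\overline{\Lambda(\overline{w},\overline{v})}$ for all $v,w\in V$; in that case $\big(\mathcal{S}^\bullet(V),\star_\Lambda,{}^*\big)$ is a locally convex $^*$-algebra. A linear functional $\omega$ on it is positive if $\omega(X^*\star_\Lambda X)\ge0$ for all $X$. A bilinear form $b:V\times V\to\mathbb{C}$ is of Hilbert-Schmidt type if there is $\|\cdot\|_\alpha\in\mathcal{P}_V$ such that (i) $b(v,w)=0$ whenever $\|v\|_\alpha=0$ or $\|w\|_\alpha=0$; and (ii) $\sum_{i,j=1}^d|b(e_i,e_j)|^2\le1$ for every $d\in\mathbb{N}$ and every $\langle\cdot|\cdot\rangle_\alpha$-orthonormal tuple $e\in V^d$. *)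

(* Defs.v *)
From HB Require Import structures.
From mathcomp Require Import all_boot all_order all_fingroup all_algebra.
From mathcomp Require Import finmap complex ring.
From mathcomp Require Import all_classical all_reals all_analysis.
(* The notations of monalg clash with those of mathcomp-analysis. *)
From mathcomp.multinomials Require Import -(notations) monalg.

Set Implicit Arguments.
Unset Strict Implicit.
Unset Printing Implicit Defensive.

Import Order.TTheory GRing.Theory Num.Theory numFieldNormedType.Exports.
Local Open Scope classical_set_scope.
Local Open Scope quotient_scope.
Local Open Scope ring_scope.

Section MalgEval.
Context {C : comNzRingType} {I : choiceType} {W : lmodType C}.
Variables (nu : C -> C) (f : I -> W).

Definition malg_eval (g : malg I C) : W :=
  \sum_(i <- msupp g) nu (mcoeff i g) *: f i.

End MalgEval.

Section MalgEvalTheory.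
Context {C : comNzRingType} {I : choiceType} {W : lmodType C}.
Variables (nu : {rmorphism C -> C}) (f : I -> W).

Lemma malg_evalw (d : {fset I}) (g : malg I C) : (msupp g `<=` d)%fset ->
  malg_eval nu f g = \sum_(i <- d) nu (mcoeff i g) *: f i.
Proof.
move=> gd; rewrite /malg_eval; apply: big_fset_incl => // i _ ig.
by rewrite mcoeff_outdom // rmorph0 scale0r.
Qed.

Lemma malg_evalP a g h :
  malg_eval nu f (a *: g + h) = nu a *: malg_eval nu f g + malg_eval nu f h.
Proof.
pose d := (msupp g `|` msupp h)%fset.
have gd : (msupp g `<=` d)%fset by exact: fsubsetUl.
have hd : (msupp h `<=` d)%fset by exact: fsubsetUr.
have ghd : (msupp (a *: g + h) `<=` d)%fset.
  apply: fsubset_trans (msuppD_le _ _) _; apply: fsetSU; exact: msuppZ_le.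
rewrite (malg_evalw gd) (malg_evalw hd) (malg_evalw ghd) scaler_sumr.
rewrite -big_split; apply: eq_bigr => i _ /=.
by rewrite mcoeffD mcoeffZ rmorphD rmorphM scalerDl scalerA.
Qed.

Lemma malg_eval0 : malg_eval nu f 0 = 0.
Proof. by rewrite /malg_eval msupp0 big_seq_fset0. Qed.

Lemma malg_evalB g h :
  malg_eval nu f (g - h) = malg_eval nu f g - malg_eval nu f h.
Proof.
by rewrite [g - h]addrC -[- h]scaleN1r malg_evalP rmorphN1 scaleN1r addrC.
Qed.

Lemma malg_evalZ a g : malg_eval nu f (a *: g) = nu a *: malg_eval nu f g.
Proof. by rewrite -[a *: g]addr0 malg_evalP malg_eval0 addr0. Qed.

Lemma malg_evalU i : malg_eval nu f (mkmalgU i 1) = f i.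
Proof.
rewrite /malg_eval msuppU oner_eq0 big_seq_fset1 mcoeffUU rmorph1.
exact: scale1r.
Qed.

End MalgEvalTheory.

(* The module presented by the generators [I] and the relators [rel]: the free
   module [malg I C] modulo the submodule spanned by [rel]. *)
Section Presented.
Context {C : comNzRingType} {I : choiceType}.
Variable rel : set (malg I C).

Definition is_submod (M : set (malg I C)) : Prop :=
  M 0 /\ forall a x y, M x -> M y -> M (a *: x + y).

Definition relators : {pred malg I C} :=
  fun x => x \in smallest is_submod rel.

Lemma relatorsP x : reflect (smallest is_submod rel x) (x \in relators).
Proof. exact: asboolP. Qed.

Fact relators0 : 0 \in relators.
Proof. by apply/relatorsP => M [[M0 _] _]. Qed.

Fact relatorsD a x y :
  x \in relators -> y \in relators -> a *: x + y \in relators.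
Proof.
move=> /relatorsP xr /relatorsP yr; apply/relatorsP => M Mrel.
by have [[_ MD] _] := Mrel; apply: MD; [exact: xr|exact: yr].
Qed.

Lemma relators_rel x : rel x -> x \in relators.
Proof. by move=> xr; apply/relatorsP => M [_]; apply. Qed.

Fact relators_zmod_closed : zmod_closed relators.
Proof.
split; first exact: relators0.
by move=> x y xr yr; rewrite addrC -[- y]scaleN1r; exact: relatorsD.
Qed.
HB.instance Definition _ :=
  GRing.isZmodClosed.Build (malg I C) relators relators_zmod_closed.

Record presented := Presented { pquot : Quotient.quot relators }.

HB.instance Definition _ := [isNew for pquot].
HB.instance Definition _ := [Choice of presented by <:].

Definition padd (X Y : presented) := Presented (pquot X + pquot Y).
Definition popp (X : presented) := Presented (- pquot X).

Fact paddA : associative padd.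
Proof. by move=> X Y Z; rewrite /padd /= addrA. Qed.
Fact paddC : commutative padd.
Proof. by move=> X Y; rewrite /padd addrC. Qed.
Fact padd0 : left_id (Presented 0) padd.
Proof. by move=> [X]; rewrite /padd add0r. Qed.
Fact paddN : left_inverse (Presented 0) popp padd.
Proof. by move=> X; rewrite /padd /= addNr. Qed.

HB.instance Definition _ :=
  GRing.isZmodule.Build presented paddA paddC padd0 paddN.

Definition pcls (g : malg I C) : presented :=
  Presented (\pi_(Quotient.quot relators) g).
Definition prepr (X : presented) : malg I C := generic_quotient.repr (pquot X).

Lemma preprK X : pcls (prepr X) = X.
Proof. by case: X => X; rewrite /pcls reprK. Qed.

Lemma pclsP g h : reflect (pcls g = pcls h) (g - h \in relators).
Proof.
rewrite Quotient.idealrBE; apply: (iffP eqP) => [gh|[//]].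
by rewrite /pcls gh.
Qed.

Lemma pclsD g h : pcls (g + h) = pcls g + pcls h.
Proof. by congr Presented; exact: (raddfD (\pi_(Quotient.quot relators))). Qed.

Lemma pcls0 : pcls 0 = 0.
Proof. by congr Presented; exact: (raddf0 (\pi_(Quotient.quot relators))). Qed.

Lemma pcls_prepr g : prepr (pcls g) - g \in relators.
Proof. by apply/pclsP; rewrite preprK. Qed.

Definition pscale (a : C) (X : presented) : presented := pcls (a *: prepr X).

Lemma pclsZ a g : pcls (a *: g) = pscale a (pcls g).
Proof.
apply/esym/pclsP; rewrite -scalerBr -[_ *: _]addr0.
by apply: relatorsD (relators0); exact: pcls_prepr.
Qed.

Fact pscaleA a b X : pscale a (pscale b X) = pscale (a * b) X.
Proof. by rewrite -[X]preprK -!pclsZ scalerA. Qed.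
Fact pscale1 : left_id 1 pscale.
Proof. by move=> X; rewrite -[X]preprK -!pclsZ scale1r. Qed.
Fact pscaleDr : right_distributive pscale +%R.
Proof.
move=> a X Y; rewrite -[X]preprK -[Y]preprK -pclsD -!pclsZ -pclsD.
by rewrite scalerDr.
Qed.
Fact pscaleDl X : {morph pscale^~ X : a b / a + b}.
Proof. by move=> a b; rewrite -[X]preprK -!pclsZ -pclsD scalerDl. Qed.

HB.instance Definition _ := GRing.Zmodule_isLmodule.Build C presented
  pscaleA pscale1 pscaleDr pscaleDl.

Lemma pclsP_lin a g h : pcls (a *: g + h) = a *: pcls g + pcls h.
Proof. by rewrite pclsD pclsZ. Qed.

Definition pgen (i : I) : presented := pcls (mkmalgU i 1).

Lemma presented_gen X :
  X = \sum_(i <- msupp (prepr X)) mcoeff i (prepr X) *: pgen i.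
Proof.
rewrite -[LHS]preprK [in LHS](monalgE (prepr X)).
rewrite (big_morph pcls pclsD pcls0).
apply: eq_bigr => i _; rewrite -[RHS]pclsZ; congr pcls.
by apply/malgP => k; rewrite mcoeffZ !mcoeffU mulr_natr.
Qed.

(* The [nu]-semilinear extension of [f] from the generators to the whole
   module (linear for [nu = idfun], antilinear for [nu = Num.conj]). It is
   evaluated on a chosen representative, hence meaningful only when [f]
   annihilates the relators, see [pextP] and [pext_gen]. *)
Definition pext (W : lmodType C) (nu : C -> C) (f : I -> W) (X : presented) : W :=
  malg_eval nu f (prepr X).

Section PextTheory.
Context {W : lmodType C}.
Variables (nu : {rmorphism C -> C}) (f : I -> W).
Hypothesis f_rel : forall r, rel r -> malg_eval nu f r = 0.

Lemma pext_relators r : r \in relators -> malg_eval nu f r = 0.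
Proof.
move=> /relatorsP rr; apply: (rr [set g | malg_eval nu f g = 0]).
split; last exact: f_rel.
split; first exact: malg_eval0.
by move=> a x y /= x0 y0; rewrite malg_evalP x0 y0 scaler0 addr0.
Qed.

Lemma pextE g : pext nu f (pcls g) = malg_eval nu f g.
Proof.
by apply/eqP; rewrite -subr_eq0 -malg_evalB (pext_relators (pcls_prepr g)).
Qed.

Lemma pextP a X Y : pext nu f (a *: X + Y) = nu a *: pext nu f X + pext nu f Y.
Proof.
rewrite -[X]preprK -[Y]preprK -[a *: _]pclsZ -pclsD !pextE.
exact: malg_evalP.
Qed.

Lemma pext_gen i : pext nu f (pgen i) = f i.
Proof. by rewrite pextE malg_evalU. Qed.

End PextTheory.

End Presented.

Arguments pext {C I rel W} nu f X.

Section TensorAlgebra.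
Context {C : comNzRingType}.

(* The tensor algebra over [V], i.e. the direct sum of the algebraic tensor
   powers of [V]: the free module on all words over [V] (the words of length
   [k] generating degree [k]) modulo linearity in each letter. *)
Definition tensor_rel (V : lmodType C) : set (malg (seq V) C) :=
  [set r | exists u v a x y,
    r = mkmalgU (u ++ (a *: x + y) :: v) 1
        - (a *: mkmalgU (u ++ x :: v) 1 + mkmalgU (u ++ y :: v) 1)].

Definition tensor (V : lmodType C) : Type := presented (@tensor_rel V).
HB.instance Definition _ (V : lmodType C) := GRing.Lmodule.on (tensor V).

(* [tens [:: x1; ...; xk]] is the elementary tensor x1 (x) ... (x) xk. *)
Definition tens (V : lmodType C) (w : seq V) : tensor V := pgen _ w.

Definition otensor_rel (V W : lmodType C) : set (malg (V * W)%type C) :=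
  [set r | (exists a x y z,
      r = mkmalgU (a *: x + y, z) 1
          - (a *: mkmalgU (x, z) 1 + mkmalgU (y, z) 1))
    \/ (exists a x y z,
      r = mkmalgU (z, a *: x + y) 1
          - (a *: mkmalgU (z, x) 1 + mkmalgU (z, y) 1))].

Definition otensor (V W : lmodType C) : Type := presented (@otensor_rel V W).
HB.instance Definition _ (V W : lmodType C) := GRing.Lmodule.on (otensor V W).

Definition otens (V W : lmodType C) (x : V) (y : W) : otensor V W :=
  pgen _ (x, y).

Definition multilinear (V W : lmodType C) (nu : C -> C) (f : seq V -> W) :=
  forall u v a x y,
    f (u ++ (a *: x + y) :: v) = nu a *: f (u ++ x :: v) + f (u ++ y :: v).

Section Theory.
Variables (V W U : lmodType C) (nu : {rmorphism C -> C}).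

Lemma tens_multilinear : multilinear idfun (@tens V).
Proof.
move=> u v a x y; rewrite [RHS](esym (pclsP_lin _ _ _ _)).
by apply/pclsP/relators_rel; exists u, v, a, x, y.
Qed.

Lemma multilinear_rel (f : seq V -> U) : multilinear nu f ->
  forall r, tensor_rel r -> malg_eval nu f r = 0.
Proof.
move=> fl _ [u [v [a [x [y ->]]]]].
by rewrite malg_evalB malg_evalP !malg_evalU fl subrr.
Qed.

Lemma text_gen (f : seq V -> U) : multilinear nu f ->
  forall w, pext nu f (tens w) = f w.
Proof. by move=> fl w; apply: pext_gen; exact: multilinear_rel. Qed.

Lemma textP (f : seq V -> U) : multilinear nu f ->
  forall a (X Y : tensor V),
  pext nu f (a *: X + Y) = nu a *: pext nu f X + pext nu f Y.
Proof. by move=> fl a X Y; apply: pextP; exact: multilinear_rel. Qed.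

Lemma otensPl (a : C) (x y : V) (z : W) :
  otens (a *: x + y) z = a *: otens x z + otens y z.
Proof.
rewrite [RHS](esym (pclsP_lin _ _ _ _)).
by apply/pclsP/relators_rel; left; exists a, x, y, z.
Qed.

Lemma otensPr (a : C) (x y : W) (z : V) :
  otens z (a *: x + y) = a *: otens z x + otens z y.
Proof.
rewrite [RHS](esym (pclsP_lin _ _ _ _)).
by apply/pclsP/relators_rel; right; exists a, x, y, z.
Qed.

Section OText.
Variable f : V * W -> U.
Hypothesis fl : forall a x y z, f (a *: x + y, z) = a *: f (x, z) + f (y, z).
Hypothesis fr : forall a x y z, f (z, a *: x + y) = a *: f (z, x) + f (z, y).

Let f_rel r : otensor_rel r -> malg_eval idfun f r = 0.
Proof.
by move=> [|] [a [x [y [z ->]]]];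
  rewrite malg_evalB malg_evalP !malg_evalU (fl, fr) subrr.
Qed.

Lemma otext_gen x y : pext idfun f (otens x y) = f (x, y).
Proof. exact: pext_gen. Qed.

Lemma otextP a (X Y : otensor V W) :
  pext idfun f (a *: X + Y) = a *: pext idfun f X + pext idfun f Y.
Proof. exact: pextP. Qed.

End OText.
End Theory.
End TensorAlgebra.

Section BilinearExtension.
Context {C : comNzRingType} {V U : lmodType C}.

(* Extension of a function of two words to a function of two tensors,
   [nu1]-semilinear in the first and [nu2]-semilinear in the second one. *)
Definition text2 (nu1 nu2 : C -> C) (B : seq V -> seq V -> U) (X Y : tensor V) : U :=
  pext nu1 (fun x => pext nu2 (B x) Y) X.

Variables (nu1 nu2 : {rmorphism C -> C}) (B : seq V -> seq V -> U).
Hypothesis Bl : forall y, multilinear nu1 (B^~ y).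
Hypothesis Br : forall x, multilinear nu2 (B x).

Let Bext (Y : tensor V) : multilinear nu1 (fun x => pext nu2 (B x) Y).
Proof.
move=> u v a x y /=; rewrite /pext /malg_eval scaler_sumr -big_split /=.
by apply: eq_bigr => i _; rewrite Bl scalerDr !scalerA mulrC.
Qed.

Lemma text2_gen x y : text2 nu1 nu2 B (tens x) (tens y) = B x y.
Proof. by rewrite /text2 text_gen ?text_gen. Qed.

Lemma text2Pl a X Y Z :
  text2 nu1 nu2 B (a *: X + Y) Z =
  nu1 a *: text2 nu1 nu2 B X Z + text2 nu1 nu2 B Y Z.
Proof. exact: textP. Qed.

Lemma text2Pr a X Y Z :
  text2 nu1 nu2 B Z (a *: X + Y) =
  nu2 a *: text2 nu1 nu2 B Z X + text2 nu1 nu2 B Z Y.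
Proof.
rewrite /text2 /pext /malg_eval scaler_sumr -big_split; apply: eq_bigr => i _.
by rewrite /= -!/(malg_eval _ _ _) -!/(pext _ _ _) textP// scalerDr !scalerA mulrC.
Qed.

End BilinearExtension.

Section TensorOperations.
Context {C : numClosedFieldType} {V : lmodType C}.
Implicit Types (x y u v w : seq V) (X Y Z : tensor V).
Implicit Types (S T : otensor (tensor V) (tensor V)).

Definition tmul : tensor V -> tensor V -> tensor V :=
  text2 idfun idfun (fun x y => tens (x ++ y)).

Definition sym_word x : tensor V :=
  ((size x)`!%:R)^-1 *:
    \sum_(s : {perm 'I_(size x)}) tens [seq x`_(s i) | i <- enum 'I_(size x)].

Definition tsym (X : tensor V) : tensor V := pext idfun sym_word X.

Definition mu_vee (Z : otensor (tensor V) (tensor V)) : tensor V :=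
  pext idfun (fun XY => tsym (tmul XY.1 XY.2)) Z.

(* The coefficient vanishes when [x] or [y] is empty, so that the default values
   of [last] and [head] are irrelevant. *)
Definition contract_word (Lambda : V -> V -> C) x y
    : otensor (tensor V) (tensor V) :=
  ((size x * size y)%:R * Lambda (last 0 x) (head 0 y)) *:
    otens (tens (take (size x).-1 x)) (tens (behead y)).

Definition contract (Lambda : V -> V -> C) (Z : otensor (tensor V) (tensor V))
    : otensor (tensor V) (tensor V) :=
  pext idfun
    (fun XY => text2 idfun idfun (contract_word Lambda) XY.1 XY.2) Z.

(* [\sum_(t \in setT)] is the sum of a finitely supported family, see
   [star_finite_support]. *)
Definition star (Lambda : V -> V -> C) X Y : tensor V :=
  \sum_(t \in [set: nat])
    (t`!%:R)^-1 *: mu_vee (iter t (contract Lambda) (otens X Y)).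

Definition tadj (cj : V -> V) (X : tensor V) : tensor V :=
  pext Num.conj (fun w => tens (rev (map cj w))) X.

Definition ip_word (h : V -> V -> C) x y : C^o :=
  if size x == size y then (size x)`!%:R * \prod_(p <- zip x y) h p.1 p.2 else 0.

(* Antilinear in the first argument; components of different degrees are
   orthogonal. *)
Definition tip (h : V -> V -> C) X Y : C :=
  text2 Num.conj idfun (ip_word h) X Y.

Lemma cat_multilinearl y : multilinear idfun (fun x => tens (x ++ y)).
Proof. by move=> u v a p q /=; rewrite -!catA /= tens_multilinear. Qed.

Lemma cat_multilinearr x : multilinear idfun (fun y => tens (x ++ y)).
Proof. by move=> u v a p q /=; rewrite !catA tens_multilinear. Qed.

Lemma tmul_tens x y : tmul (tens x) (tens y) = tens (x ++ y).
Proof.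
by rewrite /tmul text2_gen //; [exact: cat_multilinearl|exact: cat_multilinearr].
Qed.

Lemma tmulPl a X Y Z : tmul (a *: X + Y) Z = a *: tmul X Z + tmul Y Z.
Proof. by apply: text2Pl; exact: cat_multilinearl. Qed.

Lemma tmulPr a X Y Z : tmul Z (a *: X + Y) = a *: tmul Z X + tmul Z Y.
Proof. by apply: text2Pr; exact: cat_multilinearr. Qed.

Lemma sym_wordE n x : size x = n ->
  sym_word x =
  (n`!%:R)^-1 *: \sum_(s : {perm 'I_n}) tens [seq x`_(s i) | i <- enum 'I_n].
Proof. by move=> <-. Qed.

Lemma sym_word_multilinear : multilinear idfun sym_word.
Proof.
move=> u v a p q; set n := (size u + size v).+1.
have sz z : size (u ++ z :: v) = n by rewrite size_cat /= addnS.
rewrite !(sym_wordE (sz _)) scalerA mulrC -scalerA -scalerDr.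
congr (_ *: _); rewrite scaler_sumr -big_split /=; apply: eq_bigr => s _.
have ltun : (size u < n)%N by rewrite ltnS leq_addr.
pose j := (s^-1)%g (Ordinal ltun).
have jn : j \in enum 'I_n by rewrite mem_enum.
have := enum_uniq 'I_n; case/splitPr: jn => e1 e2.
rewrite cat_uniq /= => /and3P[_ /norP[je1 _] /andP[je2 _]].
have sj : s j = size u :> nat by rewrite /j permKV.
have nthE z i : i != j -> (u ++ z :: v)`_(s i) = (u ++ 0 :: v)`_(s i).
  move=> ij; rewrite !nth_cat; case: ltngtP => // [ui|E].
    by case: (s i - size u)%N (subn_gt0 (size u) (s i)) => //; rewrite ui.
  case/eqP: ij; apply: (@perm_inj _ s); apply/val_inj.
  by rewrite /= sj.
have mapE z e : j \notin e ->
    [seq (u ++ z :: v)`_(s i) | i <- e] = [seq (u ++ 0 :: v)`_(s i) | i <- e].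
  move=> je; apply/eq_in_map => i ie; apply: nthE.
  by apply: contraNneq je => <-.
rewrite !map_cat /= !(mapE _ _ je1) !(mapE _ _ je2) sj.
by rewrite !nth_cat ltnn subnn /= tens_multilinear.
Qed.

Lemma tsym_tens x : tsym (tens x) = sym_word x.
Proof. exact/text_gen/sym_word_multilinear. Qed.

Lemma tsymP a X Y : tsym (a *: X + Y) = a *: tsym X + tsym Y.
Proof. exact/textP/sym_word_multilinear. Qed.

HB.instance Definition _ := GRing.isLinear.Build C (tensor V) (tensor V) *:%R tsym tsymP.

Lemma mu_vee_otens X Y : mu_vee (otens X Y) = tsym (tmul X Y).
Proof.
apply: otext_gen => /= a X1 X2 Y1; first by rewrite tmulPl tsymP.
by rewrite tmulPr tsymP.
Qed.

Lemma mu_veeP a S T : mu_vee (a *: S + T) = a *: mu_vee S + mu_vee T.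
Proof.
apply: otextP => /= b X1 X2 Y1; first by rewrite tmulPl tsymP.
by rewrite tmulPr tsymP.
Qed.

HB.instance Definition _ :=
  GRing.isLinear.Build C (otensor (tensor V) (tensor V)) (tensor V) *:%R mu_vee mu_veeP.

Section Contract.
Variable Lambda : {bilinear V -> V -> C | *%R & *%R}.

Let LambdaPl a p q z : Lambda (a *: p + q) z = a * Lambda p z + Lambda q z.
Proof. exact: (linearPl Lambda z a). Qed.

Let LambdaPr a p q z : Lambda z (a *: p + q) = a * Lambda z p + Lambda z q.
Proof. exact: (linearPr Lambda z a). Qed.

Lemma contract_word_rcons x z y : contract_word Lambda (rcons x z) y =
  (((size x).+1 * size y)%:R * Lambda z (head 0 y)) *:
    otens (tens x) (tens (behead y)).
Proof. by rewrite /contract_word size_rcons last_rcons -cats1 take_size_cat. Qed.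

Lemma contract_word_multilinearl y :
  multilinear idfun (fun x => contract_word Lambda x y).
Proof.
move=> u v a p q; case/lastP: v => [|v z].
  rewrite !cats1 !contract_word_rcons LambdaPl.
  by rewrite mulrDr scalerDl mulrCA scalerA.
rewrite -!rcons_cons -!rcons_cat !contract_word_rcons !size_cat /=.
rewrite tens_multilinear otensPl scalerDr !scalerA /=.
by rewrite [_ * a]mulrC.
Qed.

Lemma contract_word_multilinearr x : multilinear idfun (contract_word Lambda x).
Proof.
move=> [|z u] v a p q; rewrite /contract_word /= ?LambdaPr.
  by rewrite mulrDr scalerDl mulrCA scalerA.
rewrite !size_cat /= tens_multilinear otensPr scalerDr !scalerA /=.
by rewrite [_ * a]mulrC.
Qed.

Let contract2 : tensor V * tensor V -> otensor (tensor V) (tensor V) :=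
  fun XY => text2 idfun idfun (contract_word Lambda) XY.1 XY.2.

Let contract2l a X Y Z :
  contract2 (a *: X + Y, Z) = a *: contract2 (X, Z) + contract2 (Y, Z).
Proof. by apply: text2Pl; exact: contract_word_multilinearl. Qed.

Let contract2r a X Y Z :
  contract2 (Z, a *: X + Y) = a *: contract2 (Z, X) + contract2 (Z, Y).
Proof. by apply: text2Pr; exact: contract_word_multilinearr. Qed.

Lemma contract_tens x y :
  contract Lambda (otens (tens x) (tens y)) = contract_word Lambda x y.
Proof.
rewrite /contract (otext_gen contract2l contract2r) /contract2 /= text2_gen //.
  exact: contract_word_multilinearl.
exact: contract_word_multilinearr.
Qed.

Lemma contractP a S T :
  contract Lambda (a *: S + T) = a *: contract Lambda S + contract Lambda T.
Proof. exact: (otextP contract2l contract2r). Qed.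

Lemma iter_contractP n a S T :
  iter n (contract Lambda) (a *: S + T) =
  a *: iter n (contract Lambda) S + iter n (contract Lambda) T.
Proof. by elim: n S T => //= n IHn S T; rewrite IHn contractP. Qed.

Lemma iter_contract0 n : iter n (contract Lambda) 0 = 0.
Proof.
by have := iter_contractP n (-1) 0 0; rewrite scaler0 addr0 scaleN1r addNr.
Qed.

Lemma iter_contract_tens n x y : (size x < n)%N ->
  iter n (contract Lambda) (otens (tens x) (tens y)) = 0.
Proof.
elim: n x y => // n IHn x y; rewrite ltnS iterSr contract_tens => xn.
case/lastP: x xn => [|x z] xn.
  by rewrite /contract_word mul0n mul0r scale0r iter_contract0.
rewrite contract_word_rcons -[_ *: _]addr0 iter_contractP iter_contract0 addr0.
by rewrite IHn ?scaler0 //; rewrite size_rcons in xn.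
Qed.

Lemma tens_span X :
  exists r : seq (C * seq V), X = \sum_(p <- r) p.1 *: tens p.2.
Proof.
exists [seq (mcoeff i (prepr X), i) | i <- msupp (prepr X)].
by rewrite big_map /=; exact: presented_gen.
Qed.

Lemma otens0l Y : otens (0 : tensor V) Y = 0.
Proof.
have := otensPl (-1) (0 : tensor V) 0 Y.
by rewrite scaler0 addr0 scaleN1r addNr.
Qed.

Lemma otens0r X : otens X (0 : tensor V) = 0.
Proof.
have := otensPr (-1) (0 : tensor V) 0 X.
by rewrite scaler0 addr0 scaleN1r addNr.
Qed.

Lemma otens_span X Y :
  exists r : seq (C * (seq V * seq V)),
    otens X Y = \sum_(p <- r) p.1 *: otens (tens p.2.1) (tens p.2.2).
Proof.
have [s ->] := tens_span X; have [t ->] := tens_span Y.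
elim: s => [|[a x] s [r rE]]; first by exists [::]; rewrite !big_nil otens0l.
rewrite big_cons otensPl rE {rE} /=.
suff [r' ->] : exists r' : seq (C * (seq V * seq V)),
    a *: otens (tens x) (\sum_(p <- t) p.1 *: tens p.2) =
    \sum_(p <- r') p.1 *: otens (tens p.2.1) (tens p.2.2).
  by exists (r' ++ r); rewrite big_cat.
elim: t => [|[b y] t [r' rE]].
  by exists [::]; rewrite !big_nil otens0r scaler0.
exists ((a * b, (x, y)) :: r').
by rewrite !big_cons otensPr scalerDr rE /= scalerA.
Qed.

Lemma star_finite_support X Y : finite_set
  [set t : nat | (t`!%:R)^-1 *: mu_vee (iter t (contract Lambda) (otens X Y)) != 0].
Proof.
have [r ->] := otens_span X Y.
pose N := \max_(p <- r) (size p.2.1).+1.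
apply: (sub_finite_set _ (finite_II N)) => t /=; rewrite ltnNge.
apply: contraNN => Nt.
have -> : iter t (contract Lambda)
   (\sum_(p <- r) p.1 *: otens (tens p.2.1) (tens p.2.2)) = 0; last first.
  by rewrite linear0 scaler0.
have {Nt} : all (fun p => (size p.2.1) < t)%N r.
  apply/allP => p pr; apply: leq_trans Nt.
  by rewrite /N (big_rem p pr) /= leq_maxl.
elim: r {N} => [|p r IHr] /=; first by rewrite big_nil iter_contract0.
case/andP => pt rt; rewrite big_cons iter_contractP IHr// addr0.
by rewrite iter_contract_tens ?scaler0.
Qed.

End Contract.

Section Adjoint.
Variable cj : {linear V -> V | Num.conj \; *:%R}.

Lemma adj_word_multilinear : multilinear Num.conj (fun w => tens (rev (map cj w))).
Proof.
move=> u v a p q; rewrite !map_cat /= !rev_cat !rev_cons -!cats1 -!catA /=.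
by rewrite linearP tens_multilinear.
Qed.

Lemma tadj_tens w : tadj cj (tens w) = tens (rev (map cj w)).
Proof. exact/text_gen/adj_word_multilinear. Qed.

Lemma tadjP a X Y : tadj cj (a *: X + Y) = a^* *: tadj cj X + tadj cj Y.
Proof. exact: (textP adj_word_multilinear). Qed.

HB.instance Definition _ := GRing.isLinear.Build C (tensor V) (tensor V)
  (Num.conj \; *:%R) (tadj cj) tadjP.

Lemma tadj_sym_word x : tadj cj (sym_word x) = sym_word (rev (map cj x)).
Proof.
set n := size x; set y := map cj x.
have yn : size y = n by rewrite size_map.
rewrite (@sym_wordE n x erefl) (@sym_wordE n (rev y)) ?size_rev//.
rewrite linearZ linear_sum /= fmorphV /= conjC_nat; congr (_ *: _).
pose rho : {perm 'I_n} := perm (@rev_ord_inj n).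
have rhoinj : injective (fun s : {perm 'I_n} => rho * s * rho)%g.
  by move=> s t /mulIg/mulgI.
rewrite [RHS](reindex_inj rhoinj); apply: eq_bigr => s _ /=.
rewrite tadj_tens; congr tens; rewrite -map_comp -map_rev.
have -> : rev (enum 'I_n) = map (@rev_ord n) (enum 'I_n).
  apply: (inj_map val_inj); rewrite map_rev val_enum_ord -map_comp.
  rewrite (@eq_map _ _ _ ((fun k => n - k.+1)%N \o val))// map_comp val_enum_ord.
  apply: (@eq_from_nth _ 0%N); first by rewrite size_rev size_map.
  move=> k; rewrite size_rev size_iota => kn.
  rewrite nth_rev ?size_iota// (nth_map 0%N) ?size_iota// !nth_iota//.
  by rewrite ltn_subrL; case: (n) kn.
rewrite -map_comp; apply: eq_map => i /=.
rewrite !permM /rho !permE /=; set k := s _.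
rewrite nth_rev yn ?ltn_subrL ?subnSK ?subKn ?(nth_map 0)//; first exact: ltnW.
exact: leq_ltn_trans (leq0n _) (ltn_ord k).
Qed.

End Adjoint.

Section InnerProduct.
Variable h : {bilinear V -> V -> C | Num.conj \; *%R & *%R}.

Let hPl a p q z : h (a *: p + q) z = a^* * h p z + h q z.
Proof. exact: (linearPl h z a). Qed.

Let hPr a p q z : h z (a *: p + q) = a * h z p + h z q.
Proof. exact: (linearPr h z a). Qed.

Let ip_distr (b c A B k l : C) :
  c * (A * ((b * k + l) * B)) = b * (c * (A * (k * B))) + c * (A * (l * B)).
Proof. by ring. Qed.

Lemma ip_word_multilinearl y : multilinear Num.conj (ip_word h ^~ y).
Proof.
move=> u v a p q; rewrite /ip_word !size_cat /=.
case: eqP => [uvy|_]; last by rewrite scaler0 addr0.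
have [y1 [z [y2 [-> uy1]]]] : exists y1 z y2, y = y1 ++ z :: y2 /\ size u = size y1.
  exists (take (size u) y), (nth 0 y (size u)), (drop (size u).+1 y).
  have uy : (size u < size y)%N by rewrite -uvy addnS ltnS leq_addr.
  by rewrite -drop_nth// cat_take_drop size_takel// ltnW.
rewrite !zip_cat// !big_cat /= !big_cons /= hPl.
exact: ip_distr.
Qed.

Lemma ip_word_multilinearr x : multilinear idfun (ip_word h x).
Proof.
move=> u v a p q; rewrite /ip_word !size_cat /=.
case: eqP => [xuv|_]; last by rewrite scaler0 addr0.
have [x1 [z [x2 [-> ux1]]]] : exists x1 z x2, x = x1 ++ z :: x2 /\ size x1 = size u.
  exists (take (size u) x), (nth 0 x (size u)), (drop (size u).+1 x).
  have ux : (size u < size x)%N by rewrite xuv addnS ltnS leq_addr.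
  by rewrite -drop_nth// cat_take_drop size_takel// ltnW.
rewrite !zip_cat// !big_cat /= !big_cons /= hPr.
exact: ip_distr.
Qed.

Lemma tip_tens x y : tip h (tens x) (tens y) = ip_word h x y.
Proof.
rewrite /tip text2_gen //; first exact: ip_word_multilinearl.
exact: ip_word_multilinearr.
Qed.

Lemma tipPl a X Y Z : tip h (a *: X + Y) Z = a^* * tip h X Z + tip h Y Z.
Proof.
by apply: text2Pl; exact: ip_word_multilinearl.
Qed.

Lemma tipPr a X Y Z : tip h Z (a *: X + Y) = a * tip h Z X + tip h Z Y.
Proof.
by apply: text2Pr; exact: ip_word_multilinearr.
Qed.

End InnerProduct.

End TensorOperations.

Section SymmetricTensors.
Context {C : numClosedFieldType}.

Definition symmetric_tensor (V : lmodType C) : {pred tensor V} :=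
  fun X => X \in range (@tsym C V).

Lemma symmetricP (V : lmodType C) (X : tensor V) :
  reflect (exists Y, X = tsym Y) (X \in @symmetric_tensor V).
Proof.
apply: (iffP (asboolP _)) => [[Y _ <-]|[Y ->]]; first by exists Y.
by exists Y.
Qed.

Fact symmetric_tensor_submod_closed (V : lmodType C) : submod_closed (@symmetric_tensor V).
Proof.
split; first by apply/symmetricP; exists 0; rewrite linear0.
move=> a _ _ /symmetricP[X ->] /symmetricP[Y ->]; apply/symmetricP.
by exists (a *: X + Y); rewrite linearP.
Qed.

HB.instance Definition _ (V : lmodType C) :=
  GRing.isSubmodClosed.Build C (tensor V) (@symmetric_tensor V)
    (@symmetric_tensor_submod_closed V).

Record symt (V : lmodType C) :=
  SymT { symt_val : tensor V; symt_valP : symt_val \in @symmetric_tensor V }.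

HB.instance Definition _ (V : lmodType C) := [isSub for @symt_val V].
HB.instance Definition _ (V : lmodType C) := [Choice of symt V by <:].
HB.instance Definition _ (V : lmodType C) :=
  [SubChoice_isSubLmodule of symt V by <:].

Context {V : lmodType C}.

Lemma mu_vee_symmetric (T : otensor (tensor V) (tensor V)) :
  mu_vee T \in @symmetric_tensor V.
Proof.
rewrite /mu_vee /pext /malg_eval; apply: rpred_sum => i _; apply: rpredZ.
by apply/symmetricP; eexists.
Qed.

Lemma star_symmetric (Lambda : V -> V -> C) (X Y : tensor V) :
  star Lambda X Y \in @symmetric_tensor V.
Proof.
by rewrite /star; apply: rpred_sum => t _; apply/rpredZ/mu_vee_symmetric.
Qed.

Lemma tadj_symmetric (cj : {linear V -> V | Num.conj \; *:%R}) (X : tensor V) :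
  X \in @symmetric_tensor V -> tadj cj X \in @symmetric_tensor V.
Proof.
move=> /symmetricP[Y ->]; have [r ->] := tens_span Y.
rewrite [tsym _]raddf_sum raddf_sum /=; apply: rpred_sum => p _.
rewrite [tsym _]linearZ linearZ /=; apply: rpredZ.
rewrite tsym_tens tadj_sym_word -tsym_tens.
by apply/symmetricP; eexists.
Qed.

Definition sstar (Lambda : V -> V -> C) (X Y : symt V) : symt V :=
  SymT (star_symmetric Lambda (symt_val X) (symt_val Y)).

Definition sadj (cj : {linear V -> V | Num.conj \; *:%R}) (X : symt V) : symt V :=
  SymT (tadj_symmetric cj (symt_valP X)).

End SymmetricTensors.

Section HilbertSeminorms.
Context {R : realType} {V : tvsType R[i]}.

Definition cont_pos_herm_form : set {bilinear V -> V -> R[i] | Num.conj \; *%R & *%R} :=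
  [set h | [/\ forall v w, h v w = (h w v)^*,
               forall v, 0 <= h v v &
               continuous (fun p : V * V => h p.1 p.2 : R[i]^o)]].

Definition form_norm (h : V -> V -> R[i]) (v : V) : R :=
  Num.sqrt (complex.Re (h v v)).

Definition tnorm (h : V -> V -> R[i]) (X : tensor V) : R :=
  Num.sqrt (complex.Re (tip h X X)).

Definition tball (h : V -> V -> R[i]) (X : tensor V) (e : R) : set (tensor V) :=
  [set Y | tnorm h (Y - X) < e].

Definition seminorm (p : V -> R) : Prop :=
  (forall v w, p (v + w) <= p v + p w) /\
  (forall a v, p (a *: v) = complex.Re `|a| * p v).

Definition hermitian_bilinear (cj : V -> V) (b : V -> V -> R[i]) : Prop :=
  forall v w, b v w = (b (cj w) (cj v))^*.

Definition hilbert_schmidt (b : V -> V -> R[i]) : Prop :=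
  exists2 h : {bilinear V -> V -> R[i] | Num.conj \; *%R & *%R},
    cont_pos_herm_form h &
    (forall v w, form_norm h v = 0 \/ form_norm h w = 0 -> b v w = 0) /\
    (forall (d : nat) (e : 'I_d -> V),
      (forall i j, h (e i) (e j) = (i == j)%:R) ->
      \sum_(i < d) \sum_(j < d) `|b (e i) (e j)| ^+ 2 <= 1).

End HilbertSeminorms.

Definition hilbert_seminorms_cofinal {R : realType} (V : tvsType R[i]) : Prop :=
  forall p : V -> R, seminorm p -> continuous p ->
  exists2 h : {bilinear V -> V -> R[i] | Num.conj \; *%R & *%R},
    cont_pos_herm_form h & forall v, p v <= form_norm h v.

(* The topology defined by the seminorms [tnorm h]: the coarsest one in which
   all their open balls, with arbitrary centres, are open. *)
HB.instance Definition _ (R : realType) (V : tvsType R[i]) :=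
  @isSubBaseTopological.Build (tensor V) (set (tensor V))
    [set B | exists h X e,
       [/\ @cont_pos_herm_form R V h, 0 < e & B = tball h X e]] id.

(* The subspace topology inherited from [tensor V]. *)
HB.instance Definition _ (R : realType) (V : tvsType R[i]) :=
  Topological.copy (symt V) (initial_topology (@symt_val _ V)).

Definition cont_pos_functional {R : realType} {V : tvsType R[i]}
    (cj : {linear V -> V | Num.conj \; *:%R}) (Lambda : V -> V -> R[i])
    : set {scalar symt V} :=
  [set omega | continuous (omega : symt V -> R[i]^o) /\
     forall X, 0 <= omega (sstar Lambda (sadj cj X) X)].

(* Main.v *)
From HB Require Import structures.
From mathcomp Require Import all_boot all_order all_algebra perm finmap complex.
From mathcomp Require Import ring lra zify.
From mathcomp Require Import all_classical all_reals all_analysis.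
Require Import Defs.

(** Write X^+ for the involution on symmetric tensors, v \/ w for the
    symmetric product and 1 for the empty tensor.

    Necessity. Let omega be a nonzero continuous positive functional. The form
    (X, Y) |-> omega (X^+ star Y) is positive, and the Cauchy-Schwarz inequality
    against 1 gives omega 1 > 0. Put b(v, w) = omega (v \/ w) / omega 1
    ([functional_form]). Since v^+ star v = cj v \/ v + Lambda(cj v, v) 1, the
    positivity of omega is the required inequality. Continuity bounds |omega|^2 by a
    multiple of the square of a seminorm which in degree 2 is a Hilbert-Schmidt
    norm; evaluating this bound on the sum of the
    conj(b(e_i, e_j)) e_i \/ e_j, for an orthonormal e, shows that b is of
    Hilbert-Schmidt type.

    Sufficiency. Given b and a continuous linear rho with rho (cj v) = conj (rho v),
    the Wick functional W sends x_1 \/ ... \/ x_k to the sum, over all partial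
    pairings of the letters, of the product of the b(x_i, x_j) over the pairs and of
    the rho x_i over the letters left alone (in the Gaussian picture, the moments of
    a Gaussian field of covariance b and mean rho, for b not necessarily positive).

    It is continuous ([wick_bounded]). In the language of positive kernels, the
    Hilbert-Schmidt condition on b says that the rank one kernel
    conj(b(x, y)) b(x', y') is dominated by h(x, x') h(y, y')
    ([hilbert_schmidt_dom]); by Schur's product theorem domination passes to
    products, hence to each term of W ([wick_mono_dom]). The square of the number of
    partial pairings with m pairs and r single letters is at most k! 2^k for
    k = 2m + r, which the factor k! of the inner product in degree k and a rescaling
    of h absorb.

    It is positive ([wick_star_ge0]). Powers x^k span the symmetric tensors
    ([symmetric_powers]). With f_k(x) = W(x^k), the values of W on the products
    x^p \/ y^q follow from those on (x + s y)^K by comparing powers of s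
    ([wick_mixed]); the contractions by Lambda in the star product and those by b in
    W then combine, by the binomial formula, to
        W (x^k star y^l)
          = sum_N k_N l_N / N! (Lambda + b)(x, y)^N f_(k-N)(x) f_(l-N)(y)
    where k_N is the falling factorial ([wick_star_nseq]). On replacing x by cj x,
    each summand is a product of a rank one kernel and of a power of the positive
    form (Lambda + b)(cj x, y), so Schur's product theorem applies again.

    Finally, these functionals separate points ([wick_separating]). Replacing rho by
    s rho for all naturals s isolates the part of W with a given number of single
    letters. So if every W vanishes on X, then by descending induction on k the
    component of degree k of X is annihilated by every k-th power of a real
    functional rho, by polarization also by all products of k functionals, and hence
    is 0, because the functionals rho separate the points of V
    ([real_functional_separating]): the space is Hausdorff and its topology is given
    by Hilbert seminorms. *)

Set Implicit Arguments.
Unset Strict Implicit.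
Unset Printing Implicit Defensive.

Import Order.TTheory GRing.Theory Num.Theory numFieldNormedType.Exports.
Local Open Scope ring_scope.

(** * Positive kernels and domination *)

Section Kernels.
Context {C : numClosedFieldType}.
Implicit Types (T : Type).

Definition gram T (K : T -> T -> C) (s : seq (C * T)) : C :=
  \sum_(p <- s) \sum_(q <- s) p.1^* * q.1 * K p.2 q.2.

Definition psd T (K : T -> T -> C) : Prop := forall s, 0 <= gram K s.

Definition rank1 T (f : T -> C) : T -> T -> C := fun x y => (f x)^* * f y.

(** Domination of kernels. For a linear f and a positive form h, domination
    of [rank1 f] by h means |f|^2 <= h; on kernels the notion is moreover stable
    under products ([domM]). *)
Definition dom T (K L : T -> T -> C) : Prop := psd (fun x y => L x y - K x y).

Lemma eq_gram T (K L : T -> T -> C) s :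
  (forall x y, K x y = L x y) -> gram K s = gram L s.
Proof. by move=> KL; do 2![apply: eq_bigr => ? _]; rewrite KL. Qed.

Lemma eq_psd T (K L : T -> T -> C) : (forall x y, K x y = L x y) -> psd K -> psd L.
Proof. by move=> KL Kp s; rewrite -(eq_gram s KL). Qed.

Lemma eq_dom T (K K' L L' : T -> T -> C) :
  (forall x y, K x y = K' x y) -> (forall x y, L x y = L' x y) ->
  dom K L -> dom K' L'.
Proof. by move=> KK LL; apply: eq_psd => x y; rewrite KK LL. Qed.

Lemma gramD T (K L : T -> T -> C) s :
  gram (fun x y => K x y + L x y) s = gram K s + gram L s.
Proof.
rewrite /gram -big_split; apply: eq_bigr => p _ /=.
by rewrite -big_split; apply: eq_bigr => q _ /=; rewrite mulrDr.
Qed.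

Lemma gramZ T a (K : T -> T -> C) s :
  gram (fun x y => a * K x y) s = a * gram K s.
Proof.
rewrite /gram mulr_sumr; apply: eq_bigr => p _ /=.
by rewrite mulr_sumr; apply: eq_bigr => q _ /=; ring.
Qed.

Lemma gramB T (K L : T -> T -> C) s :
  gram (fun x y => K x y - L x y) s = gram K s - gram L s.
Proof.
rewrite -mulN1r -gramZ -gramD; apply: eq_gram => x y.
by rewrite mulN1r.
Qed.

Lemma gram_rank1 T (f : T -> C) s :
  gram (rank1 f) s = `|\sum_(p <- s) p.1 * f p.2| ^+ 2.
Proof.
rewrite normCKC rmorph_sum mulr_suml; apply: eq_bigr => p _ /=.
by rewrite mulr_sumr; apply: eq_bigr => q _ /=; rewrite /rank1 rmorphM /=; ring.
Qed.

Lemma psd_rank1 T (f : T -> C) : psd (rank1 f).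
Proof. by move=> s; rewrite gram_rank1 exprn_ge0. Qed.

Lemma psdD T (K L : T -> T -> C) : psd K -> psd L -> psd (fun x y => K x y + L x y).
Proof. by move=> Kp Lp s; rewrite gramD addr_ge0. Qed.

Lemma psdZ T a (K : T -> T -> C) : 0 <= a -> psd K -> psd (fun x y => a * K x y).
Proof. by move=> a0 Kp s; rewrite gramZ mulr_ge0. Qed.

Lemma psd0 T : psd (fun _ _ : T => 0).
Proof.
by apply: (@eq_psd _ (rank1 (fun _ => 0))) (@psd_rank1 _ _) => x y; rewrite /rank1 mulr0.
Qed.

Lemma psd1 T : psd (fun _ _ : T => 1).
Proof.
apply: (@eq_psd _ (rank1 (fun _ => 1))) (@psd_rank1 _ _) => x y.
by rewrite /rank1 mulr1 rmorph1.
Qed.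

Lemma psd_sum T (I : Type) (r : seq I) (P : pred I) (K : I -> T -> T -> C) :
  (forall i, P i -> psd (K i)) -> psd (fun x y => \sum_(i <- r | P i) K i x y).
Proof.
move=> Kp; elim: r => [|i r IHr].
  by apply: eq_psd (@psd0 T) => x y; rewrite big_nil.
case Pi: (P i).
  by apply: eq_psd (psdD (Kp i Pi) IHr) => x y; rewrite big_cons Pi.
by apply: eq_psd IHr => x y; rewrite big_cons Pi.
Qed.

Lemma gram_comp T T' (f : T' -> T) (K : T -> T -> C) s :
  gram (fun x y => K (f x) (f y)) s = gram K [seq (p.1, f p.2) | p <- s].
Proof. by rewrite /gram big_map; apply: eq_bigr => p _; rewrite big_map. Qed.

Lemma psd_comp T T' (f : T' -> T) (K : T -> T -> C) :
  psd K -> psd (fun x y => K (f x) (f y)).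
Proof. by move=> Kp s; rewrite gram_comp. Qed.

Lemma psd_diag T (K : T -> T -> C) x : psd K -> 0 <= K x x.
Proof.
by move=> /(_ [:: (1, x)]); rewrite /gram !big_seq1 /= rmorph1 !mul1r.
Qed.

Lemma gram2 T (K : T -> T -> C) a b x y :
  gram K [:: (a, x); (b, y)] =
  a^* * a * K x x + b^* * b * K y y + (a^* * b * K x y + b^* * a * K y x).
Proof. by rewrite /gram !big_cons !big_nil /=; ring. Qed.

(** Testing on combinations of two points, with coefficients 1, 1 and 1, 'i,
    makes K x y + K y x and 'i (K x y - K y x) real. *)
Lemma psd_herm T (K : T -> T -> C) x y : psd K -> K x y = (K y x)^*.
Proof.
move=> Kp; have rKx := ger0_real (psd_diag x Kp); have rKy := ger0_real (psd_diag y Kp).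
have r1 : K x y + K y x \is Num.real.
  have /ger0_real := Kp [:: (1, x); (1, y)].
  by rewrite gram2 rmorph1 !mul1r rpredDl // rpredD.
have r2 : 'i * K x y - 'i * K y x \is Num.real.
  have /ger0_real := Kp [:: (1, x); ('i, y)].
  rewrite gram2 rmorph1 conjCi !mul1r !mulr1 mulNr.
  rewrite -expr2 sqrCi opprK mul1r rpredDl; last exact: rpredD.
  by rewrite mulNr.
move: r1 r2; rewrite !CrealE => /eqP r1 /eqP r2.
have ii : 'i != 0 :> C by exact: neq0Ci.
move: r1 r2; rewrite rmorphD rmorphB !rmorphM /= conjCi => r1 r2.
have /(mulfI ii) r3 : 'i * ((K y x)^* - (K x y)^*) = 'i * (K x y - K y x).
  by rewrite mulrBr [RHS]mulrBr -r2; ring.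
have : (K x y) *+ 2 = (K y x)^* *+ 2.
  have -> : K x y *+ 2 = (K x y + K y x) + (K x y - K y x) by ring.
  by rewrite -r1 -r3; ring.
by move/eqP; rewrite eqrMn2r // => /eqP.
Qed.

(** The Schur complement of the point x, with the value of K itself when
    K x x = 0. *)
Definition schur_compl T (K : T -> T -> C) (x y z : T) : C := K y z - K y x * K x z / K x x.

(** Adding to s the point x with the coefficient that minimizes the form turns
    the Gram value of K into that of the complement. *)
Lemma psd_schur_compl T (K : T -> T -> C) x : psd K -> psd (schur_compl K x).
Proof.
move=> Kp s; set m := \sum_(p <- s) p.1 * K x p.2.
have -> : gram (schur_compl K x) s = gram K s - m^* * m / K x x.
  rewrite -normCKC -(gram_rank1 (K x)) mulrC -gramZ -gramB; apply: eq_gram => y z.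
  by rewrite /schur_compl /rank1 -(psd_herm y x Kp); ring.
have [Kx0|Kx0] := eqVneq (K x x) 0; first by rewrite Kx0 invr0 mulr0 subr0.
have := Kp ((- m / K x x, x) :: s).
have rK : (K x x)^* = K x x by apply/CrealP/ger0_real/psd_diag.
rewrite /gram big_cons big_cons /=.
under [X in _ + X]eq_bigr => p _ do rewrite big_cons /=.
rewrite big_split /= -/(gram K s).
have -> : \sum_(i <- s) i.1^* * (- m / K x x) * K i.2 x = - m^* * m / K x x.
  transitivity (\sum_(i <- s) (i.1 * K x i.2)^* * (- m / K x x)).
    by apply: eq_bigr => i _; rewrite (psd_herm i.2 x Kp) rmorphM /=; ring.
  by rewrite -mulr_suml -rmorph_sum -/m; ring.
have -> : \sum_(j <- s) (- m / K x x)^* * j.1 * K x j.2 = - m^* * m / K x x.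
  under eq_bigr => i _ do rewrite -mulrA.
  by rewrite -mulr_sumr -/m rmorphM rmorphN fmorphV /= rK; ring.
rewrite rmorphM rmorphN fmorphV /= rK.
set g := gram K s => H.
suff -> : g - m^* * m / K x x = - m^* / K x x * (- m / K x x) * K x x +
  - m^* * m / K x x + (- m^* * m / K x x + g) by [].
by field.
Qed.

Lemma psd_CS T (K : T -> T -> C) x y : psd K -> `|K x y| ^+ 2 <= K x x * K y y.
Proof.
move=> Kp; have := psd_diag y (psd_schur_compl x Kp).
have [Kx0|Kx0] := eqVneq (K x x) 0; last first.
  rewrite /schur_compl subr_ge0 ler_pdivrMr; last by rewrite lt0r Kx0 psd_diag.
  by rewrite (psd_herm y x Kp) -normCKC mulrC.
move=> _; rewrite Kx0 mul0r; case: (eqVneq (K x y) 0) => [->|Kxy0].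
  by rewrite normr0 expr0n.
(* A null vector x with K x y nonzero could be scaled to make the form
   negative; this coefficient makes it equal to - (K y y + 2). *)
pose n := `|K x y| ^+ 2; have n0 : 0 < n by rewrite exprn_gt0 ?normr_gt0.
have := Kp [:: (- (K y y + 1) / n * K x y, x); (1, y)].
rewrite gram2 Kx0 mulr0 rmorph1 !mul1r mulr1 add0r.
have rK : (K y y)^* = K y y by apply/CrealP/ger0_real/psd_diag.
have rn : n^* = n by apply/CrealP/ger0_real/ltW.
rewrite !rmorphM !rmorphN rmorphD fmorphV /= rn rK rmorph1.
rewrite (psd_herm y x Kp).
have nE : n = K x y * (K x y)^* by rewrite /n normCK.
have -> : - (K y y + 1) / n * (K x y)^* * K x y = - (K y y + 1).
  by rewrite -mulrA [_^* * _]mulrC -nE mulfVK ?gt_eqF.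
have -> : - (K y y + 1) / n * K x y * (K x y)^* = - (K y y + 1).
  by rewrite -mulrA -nE mulfVK ?gt_eqF.
have -> : K y y + (- (K y y + 1) - (K y y + 1)) = - (K y y + 2) by ring.
by rewrite oppr_ge0 lt_geF // ltr_wpDl ?psd_diag.
Qed.

Lemma psd_diag0 T (K : T -> T -> C) x y : psd K -> K x x = 0 -> K x y = 0.
Proof.
move=> Kp Kx0; have := psd_CS x y Kp; rewrite Kx0 mul0r.
move=> n0; apply/eqP; rewrite -normr_eq0 -sqrf_eq0.
by apply/eqP/le_anti; rewrite n0 exprn_ge0.
Qed.

Lemma psd_sum_rank1 T (l : seq (C * (T -> C))) : all (fun a => 0 <= a.1) l ->
  psd (fun x y => \sum_(a <- l) a.1 * rank1 a.2 x y).
Proof.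
elim: l => [|a l IHl] /=.
  by move=> _; apply: eq_psd (@psd0 T) => x y; rewrite big_nil.
case/andP => a0 l0; have := psdD (psdZ a0 (@psd_rank1 T a.2)) (IHl l0).
by apply: eq_psd => x y; rewrite big_cons.
Qed.

(** Schur complements at the successive points of s split off weighted rank one
    kernels; the remainder is positive and vanishes at each of these points. This is
    a diagonalization of the Gram matrix on s. *)
Lemma psd_decomp T (s : seq T) (K : T -> T -> C) : psd K ->
  exists l : seq (C * (T -> C)), let K' x y :=
    K x y - \sum_(a <- l) a.1 * rank1 a.2 x y in
  [/\ all (fun a => 0 <= a.1) l, psd K' &
   forall i, (i < size s)%N -> forall x0 y, K' (nth x0 s i) y = 0].
Proof.
elim: s K => [|x s IHs] K Kp.
  exists [::]; split=> //; first by apply: eq_psd Kp => y z; rewrite big_nil subr0.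
have [l [l0 K'p K's]] := IHs _ (psd_schur_compl x Kp).
exists (((K x x)^-1, K x) :: l); move: K'p K's; set K' := (fun x y => _ - _) => K'p K's K''.
have E y z : K'' y z = K' y z.
  rewrite /K'' /K' big_cons /= /schur_compl /rank1 -(psd_herm y x Kp); ring.
split=> /=.
- by rewrite invr_ge0 psd_diag.
- exact: eq_psd K'p.
case=> [|i] ixs x0 y; rewrite E; last exact: K's.
apply: psd_diag0 => //=; apply: le_anti; rewrite psd_diag // andbT /K' /schur_compl.
have S0 : 0 <= \sum_(a <- l) a.1 * rank1 a.2 x x.
  exact: (psd_diag x (psd_sum_rank1 l0)).
have [->|Kx0] := eqVneq (K x x) 0; last by rewrite mulfK // subrr add0r oppr_le0.
by rewrite invr0 mulr0 subr0 add0r oppr_le0.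
Qed.

(** Schur's product theorem: on the points at hand K is a nonnegative
    combination of rank one kernels, and multiplication by a rank one kernel is a
    mere change of coefficients. *)
Lemma psdM T (K L : T -> T -> C) : psd K -> psd L -> psd (fun x y => K x y * L x y).
Proof.
move=> Kp Lp s; have [l [l0 _ Ks]] := psd_decomp [seq p.2 | p <- s] Kp.
have -> : gram (fun x y => K x y * L x y) s =
    \sum_(a <- l) a.1 * gram L [seq (p.1 * a.2 p.2, p.2) | p <- s].
  transitivity (\sum_(p <- s) \sum_(q <- s) \sum_(a <- l)
      a.1 * ((p.1 * a.2 p.2)^* * (q.1 * a.2 q.2) * L p.2 q.2)).
    case: s Ks => [|p0 s0 Ks]; first by rewrite /gram !big_nil.
    set s := p0 :: s0 in Ks *.
    rewrite /gram (big_nth p0) [RHS](big_nth p0); apply: eq_big_nat => i /andP[_ ilt].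
    apply: eq_bigr => q _.
    have := Ks i _ p0.2 q.2; rewrite size_map => /(_ ilt).
    rewrite (nth_map p0) // => /eqP; rewrite subr_eq0 => /eqP ->.
    rewrite mulr_suml mulr_sumr; apply: eq_bigr => a _.
    by rewrite /rank1 rmorphM; ring.
  under eq_bigr => p _ do rewrite exchange_big /=.
  rewrite exchange_big /=; apply: eq_bigr => a _.
  rewrite /gram big_map mulr_sumr; apply: eq_bigr => p _.
  by rewrite big_map mulr_sumr; apply: eq_bigr => q _.
elim: l {Ks} l0 => [|a l IHl] /=; first by rewrite big_nil.
by case/andP => a0 l0; rewrite big_cons addr_ge0 ?IHl // mulr_ge0.
Qed.

Lemma psdX T (K : T -> T -> C) n : psd K -> psd (fun x y => K x y ^+ n).
Proof.
move=> Kp; elim: n => [|n IHn].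
  by apply: eq_psd (@psd1 T) => x y; rewrite expr0.
by apply: eq_psd (psdM Kp IHn) => x y; rewrite exprS.
Qed.

(** L L' - K K' = (L - K) L' + K (L' - K'). *)
Lemma domM T (K K' L L' : T -> T -> C) : psd K -> psd L' ->
  dom K L -> dom K' L' -> dom (fun x y => K x y * K' x y) (fun x y => L x y * L' x y).
Proof.
move=> Kp L'p KL KL'; apply: eq_psd (psdD (psdM KL L'p) (psdM Kp KL')) => x y /=; ring.
Qed.

Lemma dom_refl T (K : T -> T -> C) : dom K K.
Proof. by apply: eq_psd (@psd0 T) => x y; rewrite subrr. Qed.

Lemma dom_trans T (K L M : T -> T -> C) : dom K L -> dom L M -> dom K M.
Proof. by move=> KL LM; apply: eq_psd (psdD KL LM) => x y; ring. Qed.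

Lemma dom_psd T (K L : T -> T -> C) : psd K -> dom K L -> psd L.
Proof. by move=> Kp KL; apply: eq_psd (psdD Kp KL) => x y; ring. Qed.

Lemma dom_gram T (K L : T -> T -> C) s : dom K L -> gram K s <= gram L s.
Proof. by move=> /(_ s); rewrite gramB subr_ge0. Qed.

(** The pullback of K along a partial map, extended by zero. Kernels on words
    are built letter by letter with it, the partial map removing leading letters. *)
Definition pkernel T T' (e : T' -> option T) (K : T -> T -> C) x y : C :=
  if (e x, e y) is (Some u, Some v) then K u v else 0.

Lemma psd_partial T T' (e : T' -> option T) (K : T -> T -> C) :
  psd K -> psd (pkernel e K).
Proof.
move=> Kp s; pose s' := pmap (fun p => omap (pair p.1) (e p.2)) s.
suff -> : gram (pkernel e K) s = gram K s' by [].
have H (F : C * T -> C) : \sum_(p <- s') F p =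
    \sum_(p <- s) if e p.2 is Some u then F (p.1, u) else 0.
  rewrite /s'; elim: (s) => [|p r IHr]; first by rewrite !big_nil.
  rewrite big_cons /= /oapp; case: (e p.2) => [u|] /=; last by rewrite add0r.
  by rewrite big_cons IHr.
rewrite /gram H; apply: eq_bigr => p _; rewrite /pkernel.
case: (e p.2) => [u|]; last by rewrite big1 // => q _; rewrite mulr0.
by rewrite H; apply: eq_bigr => q _; case: (e q.2) => [v|] //; rewrite mulr0.
Qed.

Lemma dom_partial T T' (e : T' -> option T) (K L : T -> T -> C) :
  dom K L -> dom (pkernel e K) (pkernel e L).
Proof.
move=> KL; apply: eq_psd (psd_partial e KL) => x y; rewrite /pkernel.
by case: (e x) => [u|]; case: (e y) => [v|]; rewrite ?subrr.
Qed.

End Kernels.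

(** * Hermitian forms and Hilbert-Schmidt domination *)

Lemma exists_bilinear {C : nzRingType} {V W : lmodType C} {Z : zmodType}
    (s s' : GRing.Scale.law C Z) (f : V -> W -> Z) :
  (forall z a x y, f (a *: x + y) z = s a (f x z) + f y z) ->
  (forall z a x y, f z (a *: x + y) = s' a (f z x) + f z y) ->
  exists B : {bilinear V -> W -> Z | s & s'}, forall x y, B x y = f x y.
Proof.
move=> fl fr.
have fP : bilinear_for s s' f.
  by split=> [u'|u] a x y; [exact: fl|exact: fr].
pose B : {bilinear V -> W -> Z | s & s'} :=
  HB.pack f (@bilinear_isBilinear.Build C V W Z s s' f fP).
by exists B.
Qed.

Section Forms.
Context {C : numClosedFieldType} {V : lmodType C}.
Implicit Types h : {bilinear V -> V -> C | Num.conj \; *%R & *%R}.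

Lemma bilinearZl (b : {bilinear V -> V -> C | *%R & *%R}) a x z :
  b (a *: x) z = a * b x z.
Proof. exact: (linearZl_LR b). Qed.

Lemma bilinearZr (b : {bilinear V -> V -> C | *%R & *%R}) a x z :
  b z (a *: x) = a * b z x.
Proof. exact: (linearZr_LR b). Qed.

Lemma formPl h a x y z : h (a *: x + y) z = a^* * h x z + h y z.
Proof. exact: (linearPl h z a). Qed.

Lemma formPr h a x y z : h z (a *: x + y) = a * h z x + h z y.
Proof. exact: (linearPr h z a). Qed.

Lemma formZl h a x z : h (a *: x) z = a^* * h x z.
Proof. by rewrite -[a *: x]addr0 formPl linear0l addr0. Qed.

Lemma formZr h a x z : h z (a *: x) = a * h z x.
Proof. by rewrite -[a *: x]addr0 formPr linear0r addr0. Qed.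

Lemma form_suml h (I : Type) (r : seq I) (c : I -> C) (x : I -> V) z :
  h (\sum_(i <- r) c i *: x i) z = \sum_(i <- r) (c i)^* * h (x i) z.
Proof.
by rewrite linear_sumlz; apply: eq_bigr => i _; rewrite formZl.
Qed.

Lemma form_sumr h (I : Type) (r : seq I) (c : I -> C) (x : I -> V) z :
  h z (\sum_(i <- r) c i *: x i) = \sum_(i <- r) c i * h z (x i).
Proof. by rewrite linear_sumr; apply: eq_bigr => i _; rewrite formZr. Qed.

(** Dictionary between sesquilinear forms and kernels: a sesquilinear form
    evaluated on a finite combination of the v x is the Gram value of the kernel
    it induces on the index type. *)
Lemma sesquilinear_gram (U : lmodType C) (F : U -> U -> C)
    (Fl : forall a x y z, F (a *: x + y) z = a^* * F x z + F y z)
    (Fr : forall a x y z, F z (a *: x + y) = a * F z x + F z y)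
    (T : Type) (v : T -> U) (s : seq (C * T)) :
  F (\sum_(p <- s) p.1 *: v p.2) (\sum_(p <- s) p.1 *: v p.2) =
  gram (fun x y => F (v x) (v y)) s.
Proof.
have F0l z : F 0 z = 0.
  by have := Fl (-1) 0 0 z; rewrite scaler0 addr0 rmorphN1 mulN1r addNr.
have F0r z : F z 0 = 0.
  by have := Fr (-1) 0 0 z; rewrite scaler0 addr0 mulN1r addNr.
have Fsl (r : seq (C * T)) z :
    F (\sum_(p <- r) p.1 *: v p.2) z = \sum_(p <- r) (p.1)^* * F (v p.2) z.
  by elim: r => [|p r IHr]; rewrite ?big_nil ?F0l // !big_cons Fl IHr.
have Fsr (r : seq (C * T)) z :
    F z (\sum_(p <- r) p.1 *: v p.2) = \sum_(p <- r) p.1 * F z (v p.2).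
  by elim: r => [|p r IHr]; rewrite ?big_nil ?F0r // !big_cons Fr IHr.
rewrite Fsl; apply: eq_bigr => p _; rewrite Fsr mulr_sumr.
by apply: eq_bigr => q _; rewrite mulrA.
Qed.

Lemma psd_form h : (forall v, 0 <= h v v) -> psd h.
Proof.
move=> h0 s; rewrite -(sesquilinear_gram (formPl h) (formPr h) id); exact: h0.
Qed.

Definition orthonormal h d (e : nat -> V) : Prop :=
  forall i j, (i < d)%N -> (j < d)%N -> h (e i) (e j) = (i == j)%:R.

Definition hproj h d (e : nat -> V) (x : V) : V := \sum_(i < d) h (e i) x *: e i.

Lemma hproj_coef h d e x k : orthonormal h d e -> (k < d)%N ->
  h (e k) (hproj h d e x) = h (e k) x.
Proof.
move=> eo kd; rewrite /hproj form_sumr (bigD1 (Ordinal kd)) //= eo // eqxx mulr1.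
rewrite big1 ?addr0 // => j jk; rewrite eo // [k == j]eq_sym.
by rewrite -[k]/(val (Ordinal kd)) (inj_eq val_inj) (negPf jk) mulr0.
Qed.

(** A semidefinite h has no orthonormal basis in general; a finite family
    lies in the span of an orthonormal one only up to null vectors. *)
Lemma gram_schmidt h (s : seq V) : psd h ->
  exists d e, orthonormal h d e /\
    {in s, forall x, h (x - hproj h d e x) (x - hproj h d e x) = 0}.
Proof.
move=> hp; elim: s => [|x s [d [e [eo es]]]]; first by exists 0%N, (fun=> 0).
set x' := x - hproj h d e x.
have ex' i : (i < d)%N -> h (e i) x' = 0.
  by move=> id; rewrite linearBr hproj_coef // subrr.
have [x'0|x'0] := eqVneq (h x' x') 0.
  by exists d, e; split=> // y; rewrite inE => /orP[/eqP->|/es].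
pose c := sqrtC (h x' x'); have c0 : c != 0 by rewrite sqrtC_eq0.
have rc : c^* = c by apply/CrealP/ger0_real; rewrite sqrtC_ge0 psd_diag.
pose e' i := if (i < d)%N then e i else c^-1 *: x'.
have e'E i : (i < d)%N -> e' i = e i by rewrite /e' => ->.
have e'd : e' d = c^-1 *: x' by rewrite /e' ltnn.
have e'o : orthonormal h d.+1 e'.
  move=> i j; rewrite [in X in X -> _]ltnS [in X in _ -> X -> _]ltnS.
  rewrite leq_eqVlt => /orP[/eqP->|id]; rewrite leq_eqVlt => /orP[/eqP->|jd].
  - rewrite e'd formZl formZr fmorphV /= rc eqxx mulrA -invfM -expr2 sqrtCK.
    by rewrite mulVf.
  - rewrite e'd e'E // formZl (psd_herm x' _ hp) ex' // rmorph0 mulr0.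
    by rewrite gtn_eqF.
  - by rewrite e'd e'E // formZr ex' // mulr0 ltn_eqF.
  - by rewrite !e'E // eo.
have projE y : hproj h d.+1 e' y = hproj h d e y + h (e' d) y *: e' d.
  rewrite /hproj big_ord_recr /=; congr (_ + _).
  by apply: eq_bigr => i _; rewrite e'E.
exists d.+1, e'; split=> // y; rewrite inE => /orP[/eqP->|ys].
  suff -> : x - hproj h d.+1 e' x = 0 by rewrite linear0r.
  rewrite projE opprD addrA -/x' e'd formZl fmorphV /= rc scalerA.
  have -> : h x' x = h x' x'.
    rewrite -[x in h x' x](subrK (hproj h d e x)) linearDr -/x'.
    rewrite [X in _ + X](_ : _ = 0) ?addr0 // /hproj form_sumr big1 // => i _.
    by rewrite (psd_herm x' _ hp) ex' // rmorph0 mulr0.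
  by rewrite mulrAC -invfM -expr2 sqrtCK mulVf // scale1r subrr.
rewrite projE.
suff -> : h (e' d) y = 0 by rewrite scale0r addr0; exact: es.
rewrite e'd formZl.
rewrite -[y](subrK (hproj h d e y)) linearDr.
rewrite (psd_herm x' _ hp) (psd_diag0 _ hp (es _ ys)) rmorph0 add0r.
rewrite /hproj form_sumr big1 ?mulr0 // => i _.
by rewrite (psd_herm x' _ hp) ex' // rmorph0 mulr0.
Qed.

Lemma parseval h d e x y : psd h -> orthonormal h d e ->
  h (x - hproj h d e x) (x - hproj h d e x) = 0 ->
  h x y = \sum_(i < d) (h (e i) x)^* * h (e i) y.
Proof.
move=> hp eo x0; rewrite -[in LHS](subrK (hproj h d e x) x) linearDl.
by rewrite (psd_diag0 _ hp x0) add0r /hproj form_suml.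
Qed.

(** Cauchy-Schwarz, as the instance of [psd_CS] for the sum over I of the
    evaluation kernels. *)
Lemma CS_sum (I : finType) (a b : I -> C) :
  `|\sum_i a i * b i| ^+ 2 <= (\sum_i `|a i| ^+ 2) * (\sum_i `|b i| ^+ 2).
Proof.
pose K (f g : I -> C) := \sum_i (f i)^* * g i.
have Kp : psd K by apply: psd_sum => i _; exact: (psd_rank1 (fun f : I -> C => f i)).
have := psd_CS (fun i => (a i)^*) b Kp; rewrite /K.
under eq_bigr => i _ do rewrite conjCK.
under [X in _ <= X * _]eq_bigr => i _ do rewrite conjCK -normCK.
by under [X in _ <= _ * X]eq_bigr => i _ do rewrite -normCKC.
Qed.

(** For z = sum_p p.1 (p.2.1 (x) p.2.2), expand all letters in an orthonormal
    family e of h. This is exact up to null vectors, which b ignores. Then b(z) is the scalar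
    product of the coefficients b(e_i, e_j) with those of z, and
    Cauchy-Schwarz bounds |b(z)|^2 by the Hilbert-Schmidt norm, at most 1, times
    (h (x) h)(z, z). *)
Lemma hilbert_schmidt_dom h (b : {bilinear V -> V -> C | *%R & *%R}) : psd h ->
  (forall v w, h v v = 0 \/ h w w = 0 -> b v w = 0) ->
  (forall d (e : 'I_d -> V), (forall i j, h (e i) (e j) = (i == j)%:R) ->
     \sum_(i < d) \sum_(j < d) `|b (e i) (e j)| ^+ 2 <= 1) ->
  dom (rank1 (fun p : V * V => b p.1 p.2)) (fun p q => h p.1 q.1 * h p.2 q.2).
Proof.
move=> hp b0 b1 s; rewrite gramB subr_ge0 gram_rank1.
have [d [e [eo es]]] :=
  gram_schmidt ([seq p.2.1 | p <- s] ++ [seq p.2.2 | p <- s]) hp.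
have es1 p : p \in s -> h (p.2.1 - hproj h d e p.2.1) (p.2.1 - hproj h d e p.2.1) = 0.
  by move=> ps; apply: es; rewrite mem_cat (map_f (fun p : C * (V * V) => p.2.1)) //.
have es2 p : p \in s -> h (p.2.2 - hproj h d e p.2.2) (p.2.2 - hproj h d e p.2.2) = 0.
  by move=> ps; apply: es; rewrite mem_cat (map_f (fun p : C * (V * V) => p.2.2)) ?orbT.
pose A (ij : 'I_d * 'I_d) := \sum_(p <- s) p.1 * (h (e ij.1) p.2.1 * h (e ij.2) p.2.2).
pose B (ij : 'I_d * 'I_d) := b (e ij.1) (e ij.2).
have -> : \sum_(p <- s) p.1 * b p.2.1 p.2.2 = \sum_ij B ij * A ij.
  transitivity (\sum_(p <- s) \sum_ij B ij * (p.1 * (h (e ij.1) p.2.1 * h (e ij.2) p.2.2))).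
    apply: eq_big_seq => p ps.
    have -> : b p.2.1 p.2.2 = b (hproj h d e p.2.1) (hproj h d e p.2.2).
      rewrite -[in LHS](subrK (hproj h d e p.2.1) p.2.1) linearDl b0; last first.
        by left; exact: es1.
      rewrite -[in LHS](subrK (hproj h d e p.2.2) p.2.2) linearDr.
      by rewrite b0 ?add0r //; right; exact: es2.
    rewrite linear_sumlz mulr_sumr -(pair_bigA _ (fun i j : 'I_d => B (i, j) *
       (p.1 * (h (e i) p.2.1 * h (e j) p.2.2)))) /=.
    apply: eq_bigr => i _; rewrite bilinearZl linear_sumr !mulr_sumr.
    by apply: eq_bigr => j _; rewrite bilinearZr /B /=; ring.
  by rewrite exchange_big; apply: eq_bigr => ij _; rewrite mulr_sumr.
apply: le_trans (CS_sum _ _) _.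
have -> : gram (fun p q : V * V => h p.1 q.1 * h p.2 q.2) s = \sum_ij `|A ij| ^+ 2.
  transitivity (\sum_(ij : 'I_d * 'I_d) gram (rank1 (fun p : V * V => h (e ij.1) p.1 * h (e ij.2) p.2)) s);
    last by apply: eq_bigr => ij _; rewrite gram_rank1.
  rewrite /gram [RHS]exchange_big /=; apply: eq_big_seq => p ps.
  rewrite [RHS]exchange_big /=; apply: eq_bigr => q _.
  rewrite -mulr_sumr (parseval _ hp eo (es1 p ps)) (parseval _ hp eo (es2 p ps)).
  rewrite mulr_suml -(pair_bigA _ (fun i j : 'I_d => rank1 (fun p : V * V =>
     h (e i) p.1 * h (e j) p.2) p.2 q.2)) /=.
  congr (_ * _); apply: eq_bigr => i _; rewrite mulr_sumr; apply: eq_bigr => j _.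
  by rewrite /rank1 rmorphM; ring.
rewrite ler_piMl //; first by apply: sumr_ge0 => ij _; rewrite exprn_ge0.
rewrite -(pair_bigA _ (fun i j : 'I_d => `|B (i, j)| ^+ 2)) /=.
apply: (b1 d (fun i => e i)) => i j; rewrite eo //.
Qed.

End Forms.

(** * Inner products of words *)

Section WordKernels.
Context {C : numClosedFieldType} {V : lmodType C}.
Implicit Types h : {bilinear V -> V -> C | Num.conj \; *%R & *%R}.

Definition unnil (w : seq V) : option unit := if w is [::] then Some tt else None.
Definition uncons (w : seq V) : option (V * seq V) :=
  if w is x :: w' then Some (x, w') else None.
Definition uncons2 (w : seq V) : option ((V * V) * seq V) :=
  if w is x :: y :: w' then Some ((x, y), w') else None.

(** The k-th tensor power of h, as a kernel on words that is zero outside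
    words of length k; the recursive form lets Schur's theorem apply one letter at a
    time. *)
Fixpoint pow_ker (h : V -> V -> C) k : seq V -> seq V -> C :=
  if k is k'.+1 then pkernel uncons (fun p q => h p.1 q.1 * pow_ker h k' p.2 q.2)
  else pkernel unnil (fun _ _ => 1).

Lemma pow_kerE h k x y : pow_ker h k x y =
  if (size x == k) && (size y == k) then \prod_(p <- zip x y) h p.1 p.2 else 0.
Proof.
elim: k x y => [|k IHk] [|x0 x] [|y0 y] //=.
- by rewrite /pkernel /= big_nil.
- by rewrite /pkernel /= andbF.
by rewrite /pkernel /= IHk !eqSS; case: ifP => // _; rewrite ?big_cons // mulr0.
Qed.

Lemma psd_pow_ker h k : psd h -> psd (pow_ker h k).
Proof.
move=> hp; elim: k => [|k IHk] /=; first exact/psd_partial/psd1.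
by apply/psd_partial/psdM; exact: psd_comp.
Qed.

Lemma dom_pow_ker h h' k : psd h -> dom h h' -> dom (pow_ker h k) (pow_ker h' k).
Proof.
move=> hp hh'; elim: k => [|k IHk] /=; first exact: dom_refl.
apply: dom_partial; apply: domM.
- exact: (psd_comp fst hp).
- exact: (psd_comp snd (psd_pow_ker k (dom_psd hp hh'))).
- exact: (psd_comp fst hh').
- exact: (psd_comp snd IHk).
Qed.

Lemma pow_kerZ h h' c k x y : (forall v w, h' v w = c * h v w) ->
  pow_ker h' k x y = c ^+ k * pow_ker h k x y.
Proof.
move=> h'E; elim: k x y => [|k IHk] x y /=.
  by rewrite expr0 mul1r.
rewrite /pkernel; case: (uncons x) => [p|] /=; last by rewrite mulr0.
case: (uncons y) => [q|] /=; last by rewrite mulr0.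
by rewrite IHk h'E exprS; ring.
Qed.

Lemma ip_word_pow_ker h N x y : (size x < N)%N ->
  ip_word h x y = \sum_(k < N) k`!%:R * pow_ker h k x y.
Proof.
move=> xN; rewrite (bigD1 (Ordinal xN)) //= pow_kerE eqxx /= [X in _ + X]big1 ?addr0.
  by rewrite /ip_word eq_sym; case: ifP; rewrite ?mulr0.
move=> i; rewrite pow_kerE -(inj_eq val_inj) /= eq_sym => /negPf ->.
by rewrite mulr0.
Qed.

Lemma gram_ip_word h s : exists N0, forall N, (N0 <= N)%N ->
  gram (ip_word h) s = \sum_(k < N) k`!%:R * gram (pow_ker h k) s.
Proof.
exists (\max_(p <- s) (size p.2).+1)%N => N N0N.
under [RHS]eq_bigr => k _ do rewrite -gramZ.
rewrite /gram [RHS]exchange_big; apply: eq_big_seq => p ps /=.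
rewrite [RHS]exchange_big; apply: eq_bigr => q _ /=.
rewrite -mulr_sumr -ip_word_pow_ker //.
by apply: leq_trans N0N; rewrite (big_rem p ps) /= leq_maxl.
Qed.

Lemma psd_ip_word h : psd h -> psd (ip_word h).
Proof.
move=> hp s; have [N /(_ N (leqnn N)) ->] := gram_ip_word h s.
by apply: sumr_ge0 => k _; rewrite mulr_ge0 ?ler0n // psd_pow_ker.
Qed.

Lemma dom_ip_word h h' : psd h -> dom h h' -> dom (ip_word h) (ip_word h').
Proof.
move=> hp hh' s; rewrite gramB subr_ge0.
have [N NE] := gram_ip_word h s; have [N' N'E] := gram_ip_word h' s.
rewrite (NE (maxn N N')) ?leq_maxl // (N'E (maxn N N')) ?leq_maxr //.
apply: ler_sum => k _; rewrite ler_wpM2l ?ler0n //.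
by apply: dom_gram; exact: dom_pow_ker.
Qed.

(** The degree k part of an orthogonal sum is at most the whole; this is where
    the factor k! of the inner product becomes available. *)
Lemma pow_ker_le_ip_word h k s : psd h ->
  k`!%:R * gram (pow_ker h k) s <= gram (ip_word h) s.
Proof.
move=> hp; have [N NE] := gram_ip_word h s.
rewrite (NE (maxn N k.+1)) ?leq_maxl //.
have kN : (k < maxn N k.+1)%N by rewrite leq_maxr.
rewrite (bigD1 (Ordinal kN)) //= lerDl; apply: sumr_ge0 => i _.
by rewrite mulr_ge0 ?ler0n // psd_pow_ker.
Qed.

Lemma linfun_sum (W : lmodType C) (phi : tensor V -> W) :
  (forall a X Y, phi (a *: X + Y) = a *: phi X + phi Y) ->
  forall r : seq (C * seq V), phi (\sum_(p <- r) p.1 *: tens p.2) =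
    \sum_(p <- r) p.1 *: phi (tens p.2).
Proof.
move=> phil.
have phi0 : phi 0 = 0.
  by have := phil (-1) 0 0; rewrite scaler0 addr0 scaleN1r addNr.
by elim=> [|p r IHr]; rewrite ?big_nil // !big_cons phil IHr.
Qed.

Lemma text_sum (W : lmodType C) (f : seq V -> W) : multilinear idfun f ->
  forall r : seq (C * seq V), pext idfun f (\sum_(p <- r) p.1 *: tens p.2) =
    \sum_(p <- r) p.1 *: f p.2.
Proof.
move=> fl r; rewrite linfun_sum; last exact: textP.
by apply: eq_bigr => p _; rewrite text_gen.
Qed.

Lemma tip_gram h (r : seq (C * seq V)) :
  tip h (\sum_(p <- r) p.1 *: tens p.2) (\sum_(p <- r) p.1 *: tens p.2) =
  gram (ip_word h) r.
Proof.
rewrite (sesquilinear_gram (tipPl h) (tipPr h)); apply: eq_gram => x y.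
exact: tip_tens.
Qed.

Lemma tip_ge0 h X : psd h -> 0 <= tip h X X.
Proof.
by move=> hp; have [r ->] := tens_span X; rewrite tip_gram; exact: psd_ip_word.
Qed.

Lemma tip_le h h' X : psd h -> dom h h' -> tip h X X <= tip h' X X.
Proof.
move=> hp hh'; have [r ->] := tens_span X; rewrite !tip_gram.
exact/dom_gram/dom_ip_word.
Qed.

Lemma psd_tip h : psd h -> psd (tip h).
Proof.
move=> hp s; rewrite -(sesquilinear_gram (tipPl h) (tipPr h) id); exact: tip_ge0.
Qed.

End WordKernels.

(** * The Wick functional *)

Section Wick.
Context {C : numClosedFieldType} {V : lmodType C}.
Implicit Types h : {bilinear V -> V -> C | Num.conj \; *%R & *%R}.
Variables (b : {bilinear V -> V -> C | *%R & *%R}) (rho : {scalar V}).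

(** The partial pairing in which the first 2m letters are paired with their
    neighbours and the last r letters are left alone. *)
Fixpoint wick_mono m r (w : seq V) : C :=
  if m is m'.+1 then
    if w is x :: y :: w' then b x y * wick_mono m' r w' else 0
  else if size w == r then \prod_(x <- w) rho x else 0.

Lemma wick_mono_out m r w : size w != (m.*2 + r)%N -> wick_mono m r w = 0.
Proof.
elim: m w => [|m IHm] w /=; first by move=> /negPf ->.
case: w => [|x [|y w]] //= wr; rewrite IHm ?mulr0 //.
Qed.

Lemma wick_mono_multilinear m r : multilinear idfun (wick_mono m r : seq V -> C^o).
Proof.
have bl a x y z : b (a *: x + y) z = a * b x z + b y z by exact: (linearPl b z a).
have br a x y z : b z (a *: x + y) = a * b z x + b z y by exact: (linearPr b z a).
elim: m => [|m IHm] u v a x y /=.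
  rewrite !size_cat /=; case: ifP => _; last by rewrite scaler0 addr0.
  rewrite !big_cat /= !big_cons linearP /= -![a *: _]/(a * _).
  by ring.
case: u => [|x0 [|x1 u]] /=.
- case: v => [|z v]; first by rewrite scaler0 addr0.
  by rewrite bl -![a *: _]/(a * _); ring.
- by rewrite br -![a *: _]/(a * _); ring.
- by rewrite IHm /= -![a *: _]/(a * _); ring.
Qed.

(** The number of partial pairings of 2m + r letters with m pairs. *)
Definition wick_coef m r : C :=
  (m.*2 + r)`!%:R / (m`!%:R * 2%:R ^+ m * r`!%:R).

(** On symmetric tensors all partial pairings with m pairs have the same value,
    so it is enough to take the standard one with multiplicity. Lengths enter only
    through [wick_mono], which vanishes unless w has length 2m + r; the bounds of the
    two sums are thus immaterial once large enough ([wick_bounded_sum]). *)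
Definition wick (w : seq V) : C :=
  \sum_(m < (size w).+1) \sum_(r < (size w).+1) wick_coef m r * wick_mono m r w.

Lemma wick_bounded_sum N w : (size w < N)%N ->
  wick w = \sum_(m < N) \sum_(r < N) wick_coef m r * wick_mono m r w.
Proof.
move=> wN; have out m r : (size w < m)%N || (size w < r)%N ->
    wick_coef m r * wick_mono m r w = 0.
  move=> mr; rewrite wick_mono_out ?mulr0 //; apply: contraL mr => /eqP ->.
  by rewrite negb_or -!leqNgt leq_addl andbT -addnn -addnA leq_addr.
rewrite /wick (big_ord_widen N (fun m => \sum_(r < (size w).+1)
  wick_coef m r * wick_mono m r w)) //.
rewrite [LHS]big_mkcond /=; apply: eq_bigr => m _; case: ifP => mw; last first.
  by rewrite big1 // => r _; apply: out; rewrite ltnNge -ltnS mw.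
rewrite (big_ord_widen N (fun r => wick_coef m r * wick_mono m r w)) //.
rewrite [LHS]big_mkcond /=; apply: eq_bigr => r _; case: ifP => // rw.
by rewrite out // orbC ltnNge -ltnS rw.
Qed.

Lemma wick_multilinear : multilinear idfun (wick : seq V -> C^o).
Proof.
move=> u v a x y; set N := (size u + size v).+2.
have sz z : (size (u ++ z :: v) < N)%N by rewrite size_cat /= addnS.
rewrite /= !(wick_bounded_sum (sz _)) -[X in _ = X + _]/(a * _) mulr_sumr -big_split.
apply: eq_bigr => m _ /=; rewrite mulr_sumr -big_split; apply: eq_bigr => r _ /=.
have -> : wick_mono m r (u ++ (a *: x + y) :: v) =
    a * wick_mono m r (u ++ x :: v) + wick_mono m r (u ++ y :: v).
  exact: wick_mono_multilinear.
by rewrite mulrDr mulrCA.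
Qed.

(** Each factor b x y, resp. rho x, of the product is a rank one kernel
    dominated by h (x) h, resp. h; [domM] multiplies these dominations. *)
Lemma wick_mono_dom h m r : psd h ->
  dom (rank1 (fun p : V * V => b p.1 p.2)) (fun p q => h p.1 q.1 * h p.2 q.2) ->
  dom (rank1 rho) h ->
  dom (rank1 (wick_mono m r)) (pow_ker h (m.*2 + r)).
Proof.
move=> hp bh rhoh; elim: m => [|m IHm].
  elim: r => [|r IHr].
    apply: (@eq_dom _ _ (pkernel unnil (fun _ _ => 1))) (dom_refl _) => // x y.
    case: x => [|? ?]; case: y => [|? ?]; rewrite /pkernel /rank1 /= ?big_nil;
      by rewrite ?rmorph1 ?rmorph0 ?mulr1 ?mul0r ?mulr0.
  apply: (@eq_dom _ _ (pkernel uncons (fun p q =>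
      rank1 rho p.1 q.1 * rank1 (wick_mono 0 r) p.2 q.2))); last first.
  - apply: dom_partial; apply: domM.
    + exact/psd_comp/psd_rank1.
    + exact: (psd_comp snd (psd_pow_ker _ hp)).
    + exact: (psd_comp fst rhoh).
    + exact: (psd_comp snd IHr).
  - by [].
  move=> [|x0 x] [|y0 y]; rewrite /pkernel /rank1 /= ?rmorph0 ?mul0r ?mulr0 //.
  rewrite !eqSS; case: ifP => _; case: ifP => _; rewrite ?rmorph0 ?mul0r ?mulr0 //.
  by rewrite !big_cons rmorphM /=; ring.
apply: (@eq_dom _ _ (pkernel uncons2 (fun p q =>
      rank1 (fun p : V * V => b p.1 p.2) p.1 q.1 * rank1 (wick_mono m r) p.2 q.2)) _
   (pkernel uncons2 (fun p q => (h p.1.1 q.1.1 * h p.1.2 q.1.2) *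
       pow_ker h (m.*2 + r) p.2 q.2)) _).
- move=> [|x0 [|x1 x]] [|y0 [|y1 y]]; rewrite /pkernel /rank1 /= ?rmorph0 ?mul0r ?mulr0 //.
  by rewrite rmorphM /=; ring.
- move=> [|x0 [|x1 x]] [|y0 [|y1 y]];
    rewrite doubleS !addSn /= /pkernel /= /pkernel /= ?mulr0 //.
  by rewrite mulrA.
apply: dom_partial; apply: domM.
- exact: (psd_comp fst (psd_rank1 (fun p : V * V => b p.1 p.2))).
- exact: (psd_comp snd (psd_pow_ker _ hp)).
- exact: (psd_comp fst bh).
- exact: (psd_comp snd IHm).
Qed.

End Wick.

(** * Continuity of the Wick functional *)

Lemma leq_bin_exp n k : ('C(n, k) <= 2 ^ n)%N.
Proof.
elim: n k => [|n IHn] [|k]; rewrite ?bin0 ?expn_gt0 //.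
by rewrite binS expnS mul2n -addnn leq_add.
Qed.

(** Both (2m)! / m!^2 and (2m + r)! / ((2m)! r!) are binomial coefficients, hence
    at most 2^(2m) and 2^(2m + r). *)
Lemma fact_wick m r : ((m.*2 + r)`! <= 2 ^ (m.*2 + r) * (m`! * 2 ^ m * r`!) ^ 2)%N.
Proof.
have f2m : (m.*2`! <= 2 ^ m.*2 * m`! ^ 2)%N.
  rewrite -(@bin_fact m.*2 m) -addnn ?leq_addr // addnK mulnn.
  by rewrite leq_mul2r leq_bin_exp orbT.
rewrite -(@bin_fact (m.*2 + r) r) ?leq_addl // addnK.
apply: leq_mul; first exact: leq_bin_exp.
rewrite mulnC; apply: (@leq_trans (2 ^ m.*2 * m`! ^ 2 * r`! ^ 2)).
  by apply: leq_mul => //; rewrite expnS leq_pmulr // expn1 fact_gt0.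
by rewrite !expnMn -expnM muln2 [(m`! ^ 2 * _)%N]mulnC.
Qed.

Section WickBound.
Context {C : numClosedFieldType} {V : lmodType C}.
Implicit Types h : {bilinear V -> V -> C | Num.conj \; *%R & *%R}.
Variables (b : {bilinear V -> V -> C | *%R & *%R}) (rho : {scalar V}).

Lemma wick_coef_le m r :
  wick_coef m r ^+ 2 <= (m.*2 + r)`!%:R * 2%:R ^+ (m.*2 + r) :> C.
Proof.
have p0 : 0 < (m`!%:R * 2%:R ^+ m * r`!%:R) ^+ 2 :> C.
  by rewrite exprn_gt0 // !mulr_gt0 ?exprn_gt0 ?ltr0n ?fact_gt0.
rewrite /wick_coef exprMn exprVn ler_pdivrMr // [leLHS]expr2 -[leRHS]mulrA ler_wpM2l ?ler0n //.
by rewrite -!natrX -!natrM -!natrX -natrM ler_nat fact_wick.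
Qed.

Lemma wick_coef_ge0 m r : 0 <= wick_coef m r :> C.
Proof. by rewrite divr_ge0 ?ler0n // !mulr_ge0 ?exprn_ge0 ?ler0n. Qed.

Lemma geom4_le (N : nat) : \sum_(m < N) (4%:R : C) ^- m <= 2%:R.
Proof.
suff : \sum_(m < N) (4%:R : C) ^- m + 2%:R * 4%:R ^- N <= 2%:R.
  by apply: le_trans; rewrite lerDl mulr_ge0 ?invr_ge0 ?exprn_ge0.
elim: N => [|N IHN]; first by rewrite big_ord0 add0r expr0 invr1 mulr1.
apply: le_trans IHN; rewrite big_ord_recr /= -addrA lerD2l.
rewrite exprS invfM mulrA -[X in X + _]mul1r -mulrDl.
rewrite ler_wpM2r ?invr_ge0 ?exprn_ge0 //.
rewrite -(ler_pM2r (_ : 0 < 4%:R :> C)) ?ltr0n // mulrDl mul1r mulfVK ?pnatr_eq0 //.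
by rewrite -natrD -natrM ler_nat.
Qed.

(** Each term (m, r), of degree k = 2m + r, satisfies
    |coef Z|^2 <= k! 2^k h^k <= 16^(-k) (k! (32 h)^k), the last factor being at most
    the inner product for 32 h. The terms are summed by Cauchy-Schwarz with the weights
    2^(-(m + r)), whose squares have sum at most 4. *)
Lemma wick_bounded h h' X : psd h -> (forall v w, h' v w = 32%:R * h v w) ->
  dom (rank1 (fun p : V * V => b p.1 p.2)) (fun p q => h p.1 q.1 * h p.2 q.2) ->
  dom (rank1 rho) h ->
  `|pext idfun (wick b rho : seq V -> C^o) X : C| ^+ 2 <= 16%:R * tip h' X X.
Proof.
move=> hp h'E bh rhoh.
have h'p : psd h' by apply: eq_psd (psdZ _ hp) => [x y|]; rewrite ?h'E ?ler0n.
have [s ->] := tens_span X; rewrite tip_gram text_sum; last exact: wick_multilinear.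
pose N := \max_(p <- s) (size p.2).+1.
pose Z m r := \sum_(p <- s) p.1 * wick_mono b rho m r p.2.
have -> : \sum_(p <- s) p.1 *: (wick b rho p.2 : C^o) =
    \sum_(m < N) \sum_(r < N) wick_coef m r * Z m r.
  transitivity (\sum_(p <- s) \sum_(m < N) \sum_(r < N)
     p.1 * (wick_coef m r * wick_mono b rho m r p.2)).
    apply: eq_big_seq => p ps; rewrite (@wick_bounded_sum _ _ _ _ N); last first.
      by rewrite /N (big_rem p ps) /= leq_maxl.
    rewrite -[LHS]/(p.1 * _) mulr_sumr; apply: eq_bigr => m _.
    by rewrite mulr_sumr.
  rewrite exchange_big; apply: eq_bigr => m _; rewrite exchange_big.
  by apply: eq_bigr => r _; rewrite mulr_sumr; apply: eq_bigr => p _; ring.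
rewrite pair_bigA /=; set T := gram (ip_word h') s.
have T0 : 0 <= T by exact: psd_ip_word.
have Zle m r : `|wick_coef m r * Z m r| ^+ 2 <= T * 16%:R ^- (m.*2 + r).
  set k := (m.*2 + r)%N.
  have := pow_ker_le_ip_word k s h'p; rewrite -/T.
  under eq_gram => x y do rewrite (pow_kerZ k x y h'E).
  rewrite gramZ => kT.
  have := dom_gram s (wick_mono_dom m r hp bh rhoh).
  rewrite gram_rank1 -/(Z m r) -/k => Zk.
  rewrite normrM exprMn ger0_norm ?wick_coef_ge0 //.
  apply: le_trans (ler_pM _ _ (wick_coef_le m r) Zk) _;
    rewrite ?exprn_ge0 ?wick_coef_ge0 //.
  rewrite -/k ler_pdivlMr ?exprn_gt0 ?ltr0n //.
  apply: le_trans kT; rewrite le_eqVlt; apply/orP; left; apply/eqP.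
  have -> : 32%:R = 2%:R * 16%:R :> C by rewrite -natrM.
  by rewrite exprMn; ring.
pose a (mr : 'I_N * 'I_N) : C := 2%:R ^- (mr.1 + mr.2).
pose c (mr : 'I_N * 'I_N) := 2%:R ^+ (mr.1 + mr.2) * (wick_coef mr.1 mr.2 * Z mr.1 mr.2).
have -> : \sum_(p : 'I_N * 'I_N) wick_coef p.1 p.2 * Z p.1 p.2 = \sum_p a p * c p.
  by apply: eq_bigr => p _; rewrite /a /c mulKf // expf_neq0 // pnatr_eq0.
apply: le_trans (CS_sum a c) _.
have S0 : \sum_(m < N) \sum_(r < N) (4%:R : C) ^- (m + r) <= 4%:R.
  have E4 : 4%:R = 2%:R * 2%:R :> C by rewrite -natrM.
  rewrite [leRHS]E4.
  under eq_bigr => m _ do under eq_bigr => r _ do rewrite exprD invfM.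
  under eq_bigr => m _ do rewrite -mulr_sumr.
  rewrite -mulr_suml; apply: ler_pM; rewrite ?geom4_le //;
    by apply: sumr_ge0 => i _; rewrite invr_ge0 exprn_ge0 ?ler0n.
have e4 (n : nat) : (2%:R ^- n) ^+ 2 = 4%:R ^- n :> C.
  by rewrite exprVn exprAC -natrX.
have a_ge0 p : 0 <= a p by rewrite /a invr_ge0 exprn_ge0 ?ler0n.
have aS : \sum_i `|a i| ^+ 2 <= 4%:R.
  apply: le_trans S0; rewrite pair_bigA /= le_eqVlt; apply/orP; left; apply/eqP.
  apply: eq_bigr => p _; rewrite ger0_norm ?a_ge0 //; exact: e4.
have cS : \sum_i `|c i| ^+ 2 <= T * 4%:R.
  apply: le_trans (ler_wpM2l T0 S0); rewrite pair_bigA mulr_sumr /=.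
  apply: ler_sum => -[m r] _ /=; rewrite /c /= normrM exprMn.
  apply: le_trans (ler_wpM2l _ (Zle _ _)) _; first by rewrite exprn_ge0.
  rewrite mulrCA ler_wpM2l // ger0_norm ?exprn_ge0 // -exprM.
  rewrite -[in leRHS]div1r ler_pdivlMr ?exprn_gt0 ?ltr0n //.
  rewrite mulrAC ler_pdivrMr ?exprn_gt0 ?ltr0n // mul1r -!natrX -natrM ler_nat.
  rewrite (_ : 4 = 2 ^ 2)%N // (_ : 16 = 2 ^ 4)%N // -!expnM -expnD leq_exp2l //.
  rewrite -addnn; lia.
have -> : 16%:R * T = 4%:R * (T * 4%:R).
  have -> : 16%:R = 4%:R * 4%:R :> C by rewrite -natrM.
  by ring.
apply: ler_pM => //; apply: sumr_ge0 => i _; exact: exprn_ge0.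
Qed.

End WickBound.

(** * Symmetric tensors *)

Lemma sum_ord_vanish (U : nmodType) (F : nat -> U) N M : (N <= M)%N ->
  (forall n, (N <= n)%N -> F n = 0) -> \sum_(n < N) F n = \sum_(n < M) F n.
Proof.
move=> NM F0; rewrite (big_ord_widen M F NM) [LHS]big_mkcond /=.
by apply: eq_bigr => n _; case: ltnP => // /F0.
Qed.

Section BinomialSums.
Context {C : comNzRingType} {U : lmodType C}.
Implicit Types G : nat -> nat -> U.

(** The expansion of (x + s y)^K when G p q stands for the product of x^p and
    y^q in a commutative setting. *)
Definition binsum s K G : U :=
  \sum_(q < K.+1) (s ^+ q * 'C(K, q)%:R) *: G (K - q)%N q.

Lemma eq_binsum s K G H : (forall q, (q <= K)%N -> G (K - q)%N q = H (K - q)%N q) ->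
  binsum s K G = binsum s K H.
Proof. by move=> GH; apply: eq_bigr => q _; rewrite GH // -ltnS. Qed.

Lemma binsumS s K G : binsum s K.+1 G =
  binsum s K (fun p q => G p.+1 q) + s *: binsum s K (fun p q => G p q.+1).
Proof.
rewrite /binsum [LHS]big_ord_recl /= bin0.
under [in LHS]eq_bigr => q _ do rewrite /bump leq0n add1n binS natrD mulrDr scalerDl subSS.
rewrite [in LHS]big_split /= addrA; congr (_ + _); last first.
  by rewrite scaler_sumr; apply: eq_bigr => q _; rewrite scalerA mulrA -exprS.
rewrite [in RHS]big_ord_recl /= bin0 !subn0; congr (_ + _).
rewrite [in LHS]big_ord_recr /= bin_small // mulr0 scale0r addr0.
by apply: eq_bigr => q _; rewrite /bump leq0n add1n subnSK.
Qed.

Lemma binsumD s K G H :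
  binsum s K (fun p q => G p q + H p q) = binsum s K G + binsum s K H.
Proof. by rewrite /binsum -big_split; apply: eq_bigr => q _; rewrite scalerDr. Qed.

Lemma binsumZ s K a G : binsum s K (fun p q => a *: G p q) = a *: binsum s K G.
Proof.
by rewrite /binsum scaler_sumr; apply: eq_bigr => q _; rewrite !scalerA mulrC.
Qed.

Lemma binsum_left s K G :
  binsum s K (fun p q => p%:R *: G p.-1 q) = K%:R *: binsum s K.-1 G.
Proof.
case: K => [|K].
  by rewrite /binsum big_ord_recl big_ord0 !scale0r scaler0 addr0.
rewrite /binsum big_ord_recr /= subnn scale0r scaler0 addr0 scaler_sumr.
apply: eq_bigr => q _; rewrite !scalerA subSn ?leq_ord // -subSn ?leq_ord //.
congr (_ *: _); last by rewrite subSn ?leq_ord.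
rewrite -mulrA -natrM mulrCA -natrM; congr (_ * _%:R).
by rewrite mulnC -mul_bin_down.
Qed.

Lemma binsum_right s K G :
  binsum s K (fun p q => q%:R *: G p q.-1) = (K%:R * s) *: binsum s K.-1 G.
Proof.
case: K => [|K].
  by rewrite /binsum big_ord_recl big_ord0 mul0r !scale0r scaler0 addr0.
rewrite /binsum big_ord_recl /= scale0r scaler0 add0r scaler_sumr.
apply: eq_bigr => q _; rewrite !scalerA /bump leq0n add1n subSS /=.
congr (_ *: _); rewrite -mulrA -natrM mulnC -mul_bin_diag natrM exprS; ring.
Qed.

End BinomialSums.

Section Symmetrization.
Context {C : numClosedFieldType} {V : lmodType C}.

Lemma fact_neq0 n : n`!%:R != 0 :> C.
Proof. by rewrite pnatr_eq0 -lt0n fact_gt0. Qed.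

Lemma tsym_perm (x y : seq V) : perm_eq x y -> tsym (tens x) = tsym (tens y).
Proof.
move=> xy; have sxy := perm_size xy; rewrite !tsym_tens (sym_wordE sxy) (sym_wordE (erefl (size y))).
congr (_ *: _).
have : perm_eq x (in_tuple y) by [].
case/tuple_permP => p xE.
have {}xE (i : 'I_(size y)) : x`_i = y`_(p i).
  by rewrite xE -tnth_nth tnth_mktuple (tnth_nth 0).
rewrite [RHS](reindex_inj (mulIg p)) /=; apply: eq_bigr => s _.
by congr tens; apply: eq_map => i; rewrite xE permM.
Qed.

(** A linear map that does not distinguish the rearrangements of a word does
    not see its symmetrization. *)
Lemma sym_word_perm (x : seq V) (F : tensor V -> tensor V) :
  (forall a X Y, F (a *: X + Y) = a *: F X + F Y) ->
  (forall y, perm_eq y x -> F (tens y) = F (tens x)) ->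
  F (sym_word x) = F (tens x).
Proof.
set n := size x => Fl Fx; have F0 : F 0 = 0.
  by have := Fl (-1) 0 0; rewrite scaler0 addr0 scaleN1r addNr.
rewrite (sym_wordE (erefl n)) -[X in F X]addr0 Fl F0 addr0.
have -> : F (\sum_(s : {perm 'I_n}) tens [seq x`_(s i) | i <- enum 'I_n]) =
    \sum_(s : {perm 'I_n}) F (tens x).
  rewrite (big_morph F (id1 := 0) (op1 := +%R)) //; last first.
    by move=> X Y; have := Fl 1 X Y; rewrite !scale1r.
  apply: eq_bigr => s _; apply: Fx; rewrite perm_sym.
  have -> : [seq x`_(s i) | i <- enum 'I_n] = [tuple tnth (in_tuple x) (s i) | i < n].
    by apply: eq_map => i; rewrite (tnth_nth 0).
  by rewrite perm_sym; apply/(tuple_permP (t := in_tuple x)); exists s.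
rewrite sumr_const card_Sn -[X in _ *: X]scaler_nat scalerA.
by rewrite mulVf ?fact_neq0 ?scale1r.
Qed.

Lemma tsymK (X : tensor V) : tsym (tsym X) = tsym X.
Proof.
have [r ->] := tens_span X; rewrite [RHS](linfun_sum (@tsymP C V)).
rewrite (linfun_sum (phi := fun X => tsym (tsym X))); last by move=> a Y Z; rewrite !tsymP.
apply: eq_bigr => p _; congr (_ *: _); rewrite [in LHS]tsym_tens.
apply: (@sym_word_perm p.2 (@tsym C V)); first exact: tsymP.
by move=> y; exact: tsym_perm.
Qed.

Lemma tsym_nseq k (x : V) : tsym (tens (nseq k x)) = tens (nseq k x).
Proof.
rewrite tsym_tens (@sym_word_perm _ id) // => y yx.
have /all_pred1P -> : all (pred1 x) y by rewrite (perm_all _ yx) all_pred1_nseq.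
by rewrite (perm_size yx) size_nseq.
Qed.

Lemma symmetric_tsym (X : tensor V) : X \in @symmetric_tensor C V -> tsym X = X.
Proof. by case/symmetricP => Y ->; rewrite tsymK. Qed.

(** Binomial expansion of a power, under symmetrization and next to a fixed
    prefix u; the prefix is what makes the induction on K go through. *)
Lemma tsym_expand K (u : seq V) s (x y : V) :
  tsym (tens (u ++ nseq K (x + s *: y))) =
  binsum s K (fun p q => tsym (tens (u ++ nseq p x ++ nseq q y))).
Proof.
elim: K u => [|K IHK] u.
  by rewrite /binsum big_ord_recl big_ord0 addr0 expr0 mul1r scale1r.
have -> : tsym (tens (u ++ nseq K.+1 (x + s *: y))) =
    tsym (tens ((u ++ [:: x]) ++ nseq K (x + s *: y))) +
    s *: tsym (tens ((u ++ [:: y]) ++ nseq K (x + s *: y))).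
  rewrite [nseq K.+1 _]/=; set w := nseq K _.
  by rewrite [x + _]addrC tens_multilinear tsymP [RHS]addrC -!catA.
rewrite !IHK binsumS; apply: (congr2 (fun X Y => X + s *: Y)).
  by apply: eq_binsum => q _; rewrite -catA.
apply: eq_binsum => q _; apply: tsym_perm; rewrite -catA perm_cat2l /=.
by rewrite -cat1s -[y :: nseq q y]cat1s perm_catCA.
Qed.

End Symmetrization.

(** * The Wick functional on products of two powers *)

Section Hermite.
Context {C : numClosedFieldType}.

Lemma poly_eq_fun (p q : {poly C}) : (forall s, p.[s] = q.[s]) -> p = q.
Proof.
move=> pq; apply/eqP; rewrite -subr_eq0; apply/eqP.
apply: (@roots_geq_poly_eq0 _ _ [seq i%:R | i <- iota 0 (size (p - q)%R)]).
- by apply/allP => s _; rewrite rootE hornerD hornerN pq subrr.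
- by rewrite map_inj_uniq ?iota_uniq // => i j /eqP; rewrite eqr_nat => /eqP.
- by rewrite size_map size_iota.
Qed.

(** The recursion of the polynomials sum_m k! / (m! 2^m (k - 2m)!) beta^m rho^(k-2m),
    which are the Hermite polynomials up to normalization. *)
Definition hermite_rec (beta rho : C) (f : nat -> C) : Prop :=
  f 0%N = 1 /\ forall k, f k.+1 = rho * f k + k%:R * beta * f k.-1.

Lemma hermite_uniq beta rho f f' : hermite_rec beta rho f -> hermite_rec beta rho f' ->
  f =1 f'.
Proof.
move=> [f0 fS] [f'0 f'S] k; suff : f k = f' k /\ f k.+1 = f' k.+1 by case.
elim: k => [|k [IH1 IH2]].
  by split; rewrite ?fS ?f'S f0 f'0 // !mul0r.
by split; rewrite // fS f'S IH2 /= IH1.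
Qed.

Lemma ffactS1 p n : (p.+1 ^_ n.+1 = p ^_ n.+1 + n.+1 * p ^_ n)%N.
Proof.
rewrite ffactSS ffactnSr; have [np|pn] := leqP n p; last by rewrite ffact_small // !muln0.
by rewrite mulnC [(n.+1 * _)%N]mulnC -mulnDr; congr (_ * _)%N; lia.
Qed.

(** The contribution of n pairs formed across the two groups of p and q
    letters: p^_n q^_n / n! is the number of ways to choose them, gamma the value
    of such a pair, and f, f' the values of the remaining groups. *)
Definition mixed_term (gamma : C) (f f' : nat -> C) p q n : C :=
  (p ^_ n)%:R * (q ^_ n)%:R / n`!%:R * gamma ^+ n * f (p - n)%N * f' (q - n)%N.

Definition mixed gamma f f' p q : C :=
  \sum_(n < (p + q).+1) mixed_term gamma f f' p q n.

Lemma mixed_term_sym gamma f f' p q n :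
  mixed_term gamma f f' p q n = mixed_term gamma f' f q p n.
Proof. by rewrite /mixed_term; ring. Qed.

Lemma mixedC gamma f f' p q : mixed gamma f f' p q = mixed gamma f' f q p.
Proof.
by rewrite /mixed addnC; apply: eq_bigr => n _; exact: mixed_term_sym.
Qed.

Lemma mixedE gamma f f' M p q : (q < M)%N ->
  mixed gamma f f' p q = \sum_(n < M) mixed_term gamma f f' p q n.
Proof.
move=> qM; have out n : (q < n)%N -> mixed_term gamma f f' p q n = 0.
  by move=> qn; rewrite /mixed_term (ffact_small qn) mulr0 !mul0r.
rewrite /mixed -(@sum_ord_vanish _ (mixed_term gamma f f' p q) q.+1) //; last first.
  by rewrite ltnS leq_addl.
exact: sum_ord_vanish.
Qed.

(** Removing a letter from the left group: it is single, or paired within its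
    group, or paired with a letter of the right group. *)
Lemma mixed_recl gamma beta rho f f' p q : hermite_rec beta rho f ->
  mixed gamma f f' p.+1 q =
  rho * mixed gamma f f' p q + beta * (p%:R * mixed gamma f f' p.-1 q)
  + gamma * (q%:R * mixed gamma f f' p q.-1).
Proof.
move=> [_ fS]; rewrite !(@mixedE _ _ _ q.+1) //; last by case: q.
(* A n collects the cross pairings that avoid the removed letter. *)
pose A n := (p ^_ n)%:R * (q ^_ n)%:R / n`!%:R * gamma ^+ n * f (p.+1 - n)%N * f' (q - n)%N.
have AE n : A n = rho * mixed_term gamma f f' p q n +
    beta * (p%:R * mixed_term gamma f f' p.-1 q n).
  rewrite /A /mixed_term; have [np|pn] := leqP n p; last first.
    rewrite (ffact_small pn) !mul0r mulr0 add0r.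
    by rewrite (@ffact_small p.-1) ?mul0r ?mulr0 //; lia.
  rewrite subSn // fS.
  have -> : (p.-1 - n = (p - n).-1)%N by lia.
  have -> : (p ^_ n)%:R * (q ^_ n)%:R / n`!%:R * gamma ^+ n *
      (rho * f (p - n)%N + (p - n)%:R * beta * f (p - n).-1) * f' (q - n)%N =
    rho * ((p ^_ n)%:R * (q ^_ n)%:R / n`!%:R * gamma ^+ n * f (p - n)%N * f' (q - n)%N)
    + beta * (((p ^_ n)%:R * (p - n)%:R) * (q ^_ n)%:R / n`!%:R * gamma ^+ n *
       f (p - n).-1 * f' (q - n)%N) by ring.
  have -> : (p ^_ n)%:R * (p - n)%:R = p%:R * (p.-1 ^_ n)%:R :> C.
    by rewrite -!natrM -ffactnSr ffactnS.
  ring.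
rewrite !mulr_sumr -[in RHS]big_split /=.
under [X in _ = X + _]eq_bigr => n _ do rewrite -AE.
rewrite [in LHS]big_ord_recl [X in _ = X + _]big_ord_recl /= -addrA; congr (_ + _).
rewrite [X in _ = _ + X]big_ord_recr /=.
have -> : gamma * (q%:R * mixed_term gamma f f' p q.-1 q) = 0.
  case: (posnP q) => [->|q0]; first by rewrite mul0r mulr0.
  by rewrite /mixed_term (@ffact_small q.-1) ?prednK // !(mulr0, mul0r).
rewrite addr0 -big_split; apply: eq_bigr => n _; rewrite /bump leq0n add1n /=.
rewrite /A /mixed_term ffactS1 !subSS natrD.
have -> : (q.-1 - n = q - n.+1)%N by lia.
rewrite [(q ^_ n.+1)%N]ffactnS factS exprS !natrM.
have := fact_neq0 (C := C) n; have : n.+1%:R != 0 :> C by rewrite pnatr_eq0.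
by rewrite -natr1 addrC => n1 n2; field; apply/andP.
Qed.

Lemma mixed_recr gamma beta rho f f' p q : hermite_rec beta rho f' ->
  mixed gamma f f' p q.+1 =
  rho * mixed gamma f f' p q + beta * (q%:R * mixed gamma f f' p q.-1)
  + gamma * (p%:R * mixed gamma f f' p.-1 q).
Proof. by move=> f'S; rewrite mixedC (mixed_recl _ _ _ _ f'S) !(mixedC _ f' f). Qed.

(** The mixed values recombine to the sequence of the vector x + s y, for which
    beta is the quadratic polynomial in s below and rho is affine. *)
Lemma binsum_mixed gamma beta beta' rho rho' f f' s :
  hermite_rec beta rho f -> hermite_rec beta' rho' f' ->
  hermite_rec (beta + 2%:R * s * gamma + s ^+ 2 * beta') (rho + s * rho')
    (fun K => binsum s K (mixed gamma f f' : nat -> nat -> C^o)).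
Proof.
move=> fS f'S; split.
  rewrite /binsum big_ord_recl big_ord0 addr0 /mixed big_ord_recl big_ord0 addr0.
  rewrite /mixed_term /= expr0 !ffactn0 fS.1 f'S.1 invr1 !mulr1.
  by rewrite -[LHS]/(1 * 1) mulr1.
move=> K; rewrite binsumS.
have -> : binsum s K (fun p q => mixed gamma f f' p.+1 q : C^o) =
   binsum s K (fun p q => rho *: (mixed gamma f f' p q : C^o)
     + beta *: (p%:R *: (mixed gamma f f' p.-1 q : C^o))
     + gamma *: (q%:R *: (mixed gamma f f' p q.-1 : C^o))).
  by apply: eq_binsum => q _; rewrite (mixed_recl _ _ _ _ fS).
have -> : binsum s K (fun p q => mixed gamma f f' p q.+1 : C^o) =
   binsum s K (fun p q => rho' *: (mixed gamma f f' p q : C^o)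
     + beta' *: (q%:R *: (mixed gamma f f' p q.-1 : C^o))
     + gamma *: (p%:R *: (mixed gamma f f' p.-1 q : C^o))).
  by apply: eq_binsum => q _; rewrite (mixed_recr _ _ _ _ f'S).
rewrite !binsumD !binsumZ !binsum_left !binsum_right.
set B := binsum s K _; set B' := binsum s K.-1 _.
rewrite -![_ *: _]/(_ * _); ring.
Qed.

End Hermite.

Section WickPowers.
Context {C : numClosedFieldType} {V : lmodType C}.
Variables (b : {bilinear V -> V -> C | *%R & *%R}) (rho : {scalar V}).
Hypothesis b_sym : forall x y, b x y = b y x.

Lemma wick_mono_nseq m r k x : wick_mono b rho m r (nseq k x) =
  if k == (m.*2 + r)%N then b x x ^+ m * rho x ^+ r else 0.
Proof.
elim: m k => [|m IHm] [|[|k]] //=.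
- by rewrite big_nil expr0 mul1r; case: r => [|r]; rewrite ?expr0.
- by rewrite big_seq1 expr0 mul1r; case: eqP => [<-|//]; rewrite expr1.
- rewrite size_nseq; case: eqP => [<-|//].
  by rewrite !big_cons big_nseq iter_mulr_1 expr0 mul1r !exprS.
by rewrite IHm doubleS !addSn !eqSS; case: ifP => _; rewrite ?mulr0 // exprS mulrA.
Qed.

(** W (x^k) / k! is the coefficient E of t^k in exp(b(x, x) t^2 / 2 + rho(x) t).
    The recursion is the differential equation of this series; its two terms come
    from splitting k = 2m + r in front of E. *)
Lemma wick_nseq_hermite x :
  hermite_rec (b x x) (rho x) (fun k => wick b rho (nseq k x)).
Proof.
pose A m : C := b x x ^+ m / (m`!%:R * 2%:R ^+ m).
pose B r : C := rho x ^+ r / r`!%:R.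
pose E k M N : C := \sum_(m < M) \sum_(r < N) if k == (m.*2 + r)%N then A m * B r else 0.
have Eout k M N : (k < M)%N -> (k < N)%N -> E k M N = E k k.+1 k.+1.
  move=> kM kN; rewrite /E -(@sum_ord_vanish _ (fun m => \sum_(r < N)
    if k == (m.*2 + r)%N then A m * B r else 0) k.+1) //; last first.
    by move=> m km; rewrite big1 // => r _; rewrite ifN //; lia.
  apply: eq_bigr => m _; rewrite -(@sum_ord_vanish _ (fun r =>
    if k == (m.*2 + r)%N then A m * B r else 0) k.+1) //.
  by move=> r kr; rewrite ifN //; lia.
have wE k : wick b rho (nseq k x) = k`!%:R * E k k.+1 k.+1.
  rewrite /wick size_nseq mulr_sumr; apply: eq_bigr => m _; rewrite mulr_sumr.
  apply: eq_bigr => r _; rewrite wick_mono_nseq; case: eqP => [kE|_]; last by rewrite !mulr0.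
  rewrite /wick_coef -kE /A /B !invfM; ring.
split; first by rewrite wE /E !big_ord_recl !big_ord0 /A /B /= !expr0 !(fact0, mulr1, mul1r, invr1, addr0).
move=> k; rewrite !wE.
have ER : k.+1%:R * E k.+1 k.+2 k.+2 =
    rho x * E k k.+1 k.+1 + (if k is k'.+1 then b x x * E k' k'.+1 k'.+1 else 0).
  have A1 m : m.+1.*2%:R * A m.+1 = b x x * A m.
    rewrite /A -muln2 natrM factS natrM !exprS !invfM.
    have m1 : 1 + m%:R != 0 :> C by rewrite addrC natr1 pnatr_eq0.
    have n2 : 2%:R != 0 :> C by rewrite pnatr_eq0.
    have mf := fact_neq0 (C := C) m.
    by field; rewrite ?mf ?n2 ?m1 ?expf_neq0.
  have B1 r : r.+1%:R * B r.+1 = rho x * B r.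
    rewrite /B factS natrM exprS invfM.
    have r1 : 1 + r%:R != 0 :> C by rewrite addrC natr1 pnatr_eq0.
    have rf := fact_neq0 (C := C) r.
    by field; rewrite ?rf ?r1.
  transitivity (\sum_(m < k.+2) \sum_(r < k.+2)
      (if k.+1 == (m.*2 + r)%N then A m * (r%:R * B r) else 0) +
    \sum_(m < k.+2) \sum_(r < k.+2)
      (if k.+1 == (m.*2 + r)%N then (m.*2%:R * A m) * B r else 0)).
    rewrite -big_split mulr_sumr; apply: eq_bigr => m _.
    rewrite -big_split mulr_sumr; apply: eq_bigr => r _ /=.
    case: eqP => [kE|_]; last by rewrite mulr0 addr0.
    have -> : k.+1%:R = m.*2%:R + r%:R :> C by rewrite -natrD -kE.
    ring.
  congr (_ + _).
    rewrite -(@Eout k k.+2 k.+1) // /E mulr_sumr; apply: eq_bigr => m _.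
    rewrite big_ord_recl /= mul0r mulr0 if_same add0r mulr_sumr.
    apply: eq_bigr => r _; rewrite /bump leq0n add1n B1 addnS eqSS.
    by case: ifP => _; rewrite ?mulr0 // mulrCA.
  rewrite big_ord_recl /= [X in X + _]big1 ?add0r; last first.
    by move=> r _; rewrite mul0r mul0r if_same.
  case: k => [|k] /=.
    by rewrite big1 // => m _; rewrite big1.
  rewrite -(@Eout k k.+2 k.+3); [|lia|lia].
  rewrite /E mulr_sumr; apply: eq_bigr => m _.
  rewrite mulr_sumr; apply: eq_bigr => r _.
  rewrite ?/bump ?leq0n ?add1n A1 ?doubleS ?addSn ?eqSS.
  by case: ifP => _; rewrite ?mulr0 // mulrA.
rewrite factS mulnC natrM -mulrA ER mulrDr mulrCA; congr (_ + _).
case: k {ER} => [|k] /=; first by rewrite !mul0r mulr0.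
rewrite factS natrM; ring.
Qed.

Definition wick_fun (X : tensor V) : C := pext idfun (wick b rho : seq V -> C^o) X.

Lemma wick_funP a X Y : wick_fun (a *: X + Y) = a * wick_fun X + wick_fun Y.
Proof. exact: (textP (@wick_multilinear _ _ b rho)). Qed.

Lemma wick_fun_tens w : wick_fun (tens w) = wick b rho w.
Proof. exact: (text_gen (@wick_multilinear _ _ b rho)). Qed.

Lemma wick_fun_sum (r : seq (C * seq V)) :
  wick_fun (\sum_(p <- r) p.1 *: tens p.2) = \sum_(p <- r) p.1 * wick b rho p.2.
Proof. exact: (text_sum (@wick_multilinear _ _ b rho)). Qed.

Lemma wick_fun_binsum s K (G : nat -> nat -> tensor V) :
  wick_fun (binsum s K G) = binsum s K (fun p q => wick_fun (G p q) : C^o).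
Proof.
have w0 : wick_fun 0 = 0 by have := wick_funP (-1) 0 0; rewrite scaler0 addr0 mulN1r addNr.
rewrite /binsum (big_morph wick_fun (id1 := 0) (op1 := +%R)) //; last first.
  by move=> X Y; have := wick_funP 1 X Y; rewrite scale1r mul1r.
apply: eq_bigr => q _; have := wick_funP (s ^+ q * 'C(K, q)%:R) (G (K - q)%N q) 0.
by rewrite w0 !addr0.
Qed.

(** Both sides, summed with the weights binomial(K, q) s^q over p + q = K, obey
    the recursion of (x + s y)^K: the left one by expansion of that power and the
    right one by [binsum_mixed]. Equality for every s gives equality of the
    coefficients. *)
Lemma wick_mixed x y p q :
  wick_fun (tsym (tens (nseq p x ++ nseq q y))) =
  mixed (b x y) (fun k => wick b rho (nseq k x)) (fun k => wick b rho (nseq k y)) p q.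
Proof.
set g := mixed _ _ _; pose g' p q := wick_fun (tsym (tens (nseq p x ++ nseq q y))).
pose K := (p + q)%N.
pose P (G : nat -> nat -> C) : {poly C} :=
  \poly_(i < K.+1) ('C(K, i)%:R * G (K - i)%N i).
have PE G s : (P G).[s] = binsum s K (G : nat -> nat -> C^o).
  rewrite horner_poly; apply: eq_bigr => i _ /=.
  by rewrite -[RHS]/(_ * _); ring.
have PP : P g' = P g.
  apply: poly_eq_fun => s; rewrite !PE.
  have -> : binsum s K (g' : nat -> nat -> C^o) = wick b rho (nseq K (x + s *: y)).
    rewrite -wick_fun_tens -tsym_nseq -[nseq K _]cat0s tsym_expand.
    by rewrite wick_fun_binsum.
  have := binsum_mixed (b x y) s (wick_nseq_hermite x) (wick_nseq_hermite y).
  rewrite -/g => H.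
  have bE : b (x + s *: y) (x + s *: y) = b x x + 2%:R * s * b x y + s ^+ 2 * b y y.
    by rewrite linearDl !linearDr !(bilinearZl b) !(bilinearZr b) (b_sym y x); ring.
  have := wick_nseq_hermite (x + s *: y); rewrite bE linearD linearZ => H'.
  exact: (hermite_uniq H' H K).
have := congr1 (fun R : {poly C} => R`_q) PP; rewrite !coef_poly ltnS leq_addl /K addnK.
by move/mulfI; apply; rewrite pnatr_eq0 -lt0n bin_gt0 leq_addl.
Qed.

End WickPowers.

(** * Polarization *)

Section CoefficientExtraction.
Context {C : numClosedFieldType} {U : lmodType C}.
Variable P : U -> Prop.
Hypothesis (P0 : P 0) (PD : forall a x y, P x -> P y -> P (a *: x + y)).

Lemma submod_sum (I : Type) (r : seq I) (c : I -> C) (v : I -> U) :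
  (forall i, P (v i)) -> P (\sum_(i <- r) c i *: v i).
Proof.
move=> Pv; elim: r => [|i r IHr]; rewrite ?big_nil // big_cons; exact: PD.
Qed.

(** A polynomial whose values at all naturals lie in a submodule has its
    coefficients there. The combination v(2s) - 2^n v(s) cancels the term of degree
    n and multiplies the others by 2^q - 2^n, which is nonzero for q < n. *)
Lemma coef_extract n (v : nat -> U) :
  (forall s : nat, P (\sum_(q < n) (s%:R ^+ q : C) *: v q)) ->
  forall q, (q < n)%N -> P (v q).
Proof.
elim: n v => [//|n IHn] v Pv.
have Pn q : (q < n)%N -> P (v q).
  move=> qn; pose c q : C := 2%:R ^+ q - 2%:R ^+ n.
  have Pc s : P (\sum_(q < n) (s%:R ^+ q : C) *: (c q *: v q)).
    have := PD (- 2%:R ^+ n) (Pv s) (Pv (2 * s)%N).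
    rewrite scaler_sumr -big_split big_ord_recr /= scalerA -scalerDl.
    rewrite natrM exprMn [X in _ + X *: _](_ : _ = 0) ?scale0r ?addr0; last by ring.
    congr P; apply: eq_bigr => i _; rewrite /= !scalerA -scalerDl.
    by rewrite exprMn /c; congr (_ *: _); ring.
  have c0 : c q != 0.
    by rewrite /c subr_eq0 -!natrX eqr_nat eqn_exp2l //; lia.
  have := PD (c q)^-1 (IHn (fun q => c q *: v q) Pc q qn) P0.
  by rewrite addr0 scalerA mulVf ?scale1r.
move=> q; rewrite ltnS leq_eqVlt => /orP[/eqP->|/Pn //].
have := Pv 1%N; rewrite big_ord_recr /= expr1n scale1r => Pn1.
have Pn0 : P (\sum_(i < n) (1%:R ^+ i : C) *: v i).
  apply: (big_ind P) => // [x y Px Py|i _].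
    by rewrite -[x]scale1r; exact: PD.
  by rewrite expr1n -[_ *: _]addr0; apply: PD => //; exact: Pn.
by have := PD (-1) Pn0 Pn1; rewrite scaleN1r addKr.
Qed.

End CoefficientExtraction.

Section Powers.
Context {C : numClosedFieldType} {V : lmodType C}.

Definition powt (p : nat * V) : tensor V := tens (nseq p.1 p.2).

(** Polarization. By induction on the length of u, the symmetrization of
    u y^K is a combination of powers: u z y^K is, up to the factor K + 1, the
    coefficient of s^K in u (z + s y)^(K + 1). *)
Lemma symmetric_powers (X : tensor V) : X \in @symmetric_tensor C V ->
  exists r : seq (C * (nat * V)), X = \sum_(p <- r) p.1 *: powt p.2.
Proof.
pose P (X : tensor V) := exists r : seq (C * (nat * V)), X = \sum_(p <- r) p.1 *: powt p.2.
have P0 : P 0 by exists [::]; rewrite big_nil.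
have PD a Y Z : P Y -> P Z -> P (a *: Y + Z).
  move=> [r ->] [r' ->]; exists ([seq (a * p.1, p.2) | p <- r] ++ r').
  rewrite big_cat big_map scaler_sumr; apply: (congr2 +%R) => //.
  by apply: eq_bigr => p _; rewrite scalerA.
have Pw u K (y : V) : P (tsym (tens (u ++ nseq K y))).
  elim: u K y => [|z u IHu] K y.
    by rewrite tsym_nseq; exists [:: (1, (K, y))]; rewrite big_seq1 scale1r.
  pose v q := 'C(K.+1, q)%:R *: tsym (tens (u ++ nseq (K.+1 - q) z ++ nseq q y)).
  have : forall s : nat, P (\sum_(q < K.+2) (s%:R ^+ q : C) *: v q).
    move=> s; have := IHu K.+1 (z + s%:R *: y); rewrite tsym_expand.
    by congr P; apply: eq_bigr => q _; rewrite scalerA.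
  move=> /(coef_extract P0 PD)/(_ K (leqnSn _))/(PD (K.+1%:R)^-1)/(_ P0).
  rewrite addr0 /v binSn scalerA mulVf ?pnatr_eq0 // scale1r subSnn /=.
  by congr P; apply: tsym_perm; rewrite -cat1s -[z :: _]cat1s perm_catCA.
move=> /symmetric_tsym <-; have [r ->] := tens_span X.
rewrite (linfun_sum (@tsymP C V)); apply: (submod_sum P0 PD) => p.
by have := Pw p.2 0%N 0; rewrite cats0.
Qed.

End Powers.

(** * The star product of powers, and positivity *)

Section Star.
Context {C : numClosedFieldType} {V : lmodType C}.
Variable Lambda : {bilinear V -> V -> C | *%R & *%R}.

Definition star_term X Y t : tensor V := (t`!%:R)^-1 *: mu_vee (iter t (contract Lambda) (otens X Y)).

Lemma star_termPl a X Y Z t :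
  star_term (a *: X + Y) Z t = a *: star_term X Z t + star_term Y Z t.
Proof.
by rewrite /star_term otensPl iter_contractP linearP scalerDr !scalerA mulrC.
Qed.

Lemma star_termPr a X Y Z t :
  star_term Z (a *: X + Y) t = a *: star_term Z X t + star_term Z Y t.
Proof.
by rewrite /star_term otensPr iter_contractP linearP scalerDr !scalerA mulrC.
Qed.

(** A single bound N0 on the number of contractions serves all larger N; sums
    for different arguments can therefore be cut at a common place. *)
Lemma star_termE X Y : exists N0, forall N, (N0 <= N)%N ->
  star Lambda X Y = \sum_(t < N) star_term X Y t.
Proof.
have [r XY] := otens_span X Y.
exists (\max_(p <- r) (size p.2.1).+1)%N => N N0N.
have out t : (N <= t)%N -> star_term X Y t = 0.
  move=> Nt; rewrite /star_term XY.
  suff -> : iter t (contract Lambda) (\sum_(p <- r) p.1 *: otens (tens p.2.1) (tens p.2.2)) = 0.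
    by rewrite linear0 scaler0.
  have {N0N} : all (fun p => (size p.2.1 < t)%N) r.
    apply/allP => p pr; apply: leq_trans (leq_trans N0N Nt).
    exact: (leq_bigmax_seq (F := fun p => (size p.2.1).+1)).
  elim: (r) => [|p r' IHr] /=; first by rewrite big_nil iter_contract0.
  case/andP => pt rt; rewrite big_cons iter_contractP IHr // addr0.
  by rewrite iter_contract_tens // scaler0.
rewrite /star fsbig_ord; symmetry; apply: fsbig_widen => // t [_ /= tN].
by apply: out; rewrite leqNgt; apply/negP.
Qed.

Lemma starPl a X Y Z : star Lambda (a *: X + Y) Z = a *: star Lambda X Z + star Lambda Y Z.
Proof.
have [N1 E1] := star_termE (a *: X + Y) Z.
have [N2 E2] := star_termE X Z; have [N3 E3] := star_termE Y Z.
pose N := maxn N1 (maxn N2 N3).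
rewrite (E1 N) ?(E2 N) ?(E3 N) ?leq_max ?leqnn ?orbT //.
rewrite scaler_sumr -big_split; apply: eq_bigr => t _; exact: star_termPl.
Qed.

Lemma starPr a X Y Z : star Lambda Z (a *: X + Y) = a *: star Lambda Z X + star Lambda Z Y.
Proof.
have [N1 E1] := star_termE Z (a *: X + Y).
have [N2 E2] := star_termE Z X; have [N3 E3] := star_termE Z Y.
pose N := maxn N1 (maxn N2 N3).
rewrite (E1 N) ?(E2 N) ?(E3 N) ?leq_max ?leqnn ?orbT //.
rewrite scaler_sumr -big_split; apply: eq_bigr => t _; exact: star_termPr.
Qed.

Lemma contractZ a S : contract Lambda (a *: S) = a *: contract Lambda S.
Proof.
have D0 : contract Lambda 0 = 0 by exact: (iter_contract0 Lambda 1).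
have E := contractP Lambda a S 0.
rewrite -{1}[a *: S]addr0 E; exact: (etrans (congr1 (+%R _) D0) (addr0 _)).
Qed.

Lemma contract_word_nseq k l x y :
  contract_word Lambda (nseq k x) (nseq l y) =
  ((k * l)%:R * Lambda x y) *: otens (tens (nseq k.-1 x)) (tens (nseq l.-1 y)).
Proof.
rewrite /contract_word !size_nseq.
have z (c c' : C) (S T : otensor (tensor V) (tensor V)) :
    c = 0 -> c' = 0 -> c *: S = c' *: T by move=> -> ->; rewrite !scale0r.
case: k => [|k]; first by apply: z; rewrite mul0n mul0r.
case: l => [|l]; first by apply: z; rewrite muln0 mul0r.
have -> : take k.+1.-1 (nseq k.+1 x) = nseq k x by rewrite take_nseq.
by have -> : last 0 (nseq k.+1 x) = x by elim: (k).
Qed.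

Lemma iter_contract_nseq t k l x y :
  iter t (contract Lambda) (otens (tens (nseq k x)) (tens (nseq l y))) =
  ((k ^_ t)%:R * (l ^_ t)%:R * Lambda x y ^+ t) *:
    otens (tens (nseq (k - t) x)) (tens (nseq (l - t) y)).
Proof.
elim: t => [|t IHt]; first by rewrite !ffactn0 expr0 !mul1r scale1r !subn0.
rewrite iterS IHt; set c := _ * _ ^+ t.
rewrite contractZ contract_tens.
rewrite contract_word_nseq -!subnS; move: (otens _ _) => T.
rewrite scalerA; apply: (congr1 (fun z => z *: T)).
by rewrite /c !ffactnSr !natrM exprS; ring.
Qed.

Lemma star_nseq M k l x y : (k < M)%N ->
  star Lambda (tens (nseq k x)) (tens (nseq l y)) =
  \sum_(t < M) ((k ^_ t)%:R * (l ^_ t)%:R / t`!%:R * Lambda x y ^+ t) *: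
     tsym (tens (nseq (k - t) x ++ nseq (l - t) y)).
Proof.
move=> kM; have [N0 E] := star_termE (tens (nseq k x)) (tens (nseq l y)).
rewrite (E (maxn N0 M)) ?leq_maxl //.
have F t : star_term (tens (nseq k x)) (tens (nseq l y)) t =
   ((k ^_ t)%:R * (l ^_ t)%:R / t`!%:R * Lambda x y ^+ t) *:
     tsym (tens (nseq (k - t) x ++ nseq (l - t) y)).
  rewrite /star_term iter_contract_nseq linearZ /= mu_vee_otens tmul_tens scalerA.
  by congr (_ *: _); ring.
rewrite -(@sum_ord_vanish _ (star_term (tens (nseq k x)) (tens (nseq l y))) M) ?leq_maxr //.
  by apply: eq_bigr => t _; exact: F.
by move=> t Mt; rewrite F ffact_small ?(leq_trans kM) // !mul0r scale0r.
Qed.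

End Star.

Lemma sum_triangle (U : nmodType) M (a : nat -> nat -> U) :
  (forall t n, (M <= t + n)%N -> a t n = 0) ->
  \sum_(t < M) \sum_(n < M) a t n = \sum_(N < M) \sum_(i < N.+1) a i (N - i)%N.
Proof.
move=> a0; transitivity (\sum_(t < M) \sum_(n < M - t) a t n).
  apply: eq_bigr => t _; rewrite -(@sum_ord_vanish _ (a t) (M - t)) ?leq_subr //.
  by move=> n Mn; apply: a0; rewrite -leq_subLR.
elim: M {a0} => [|M IHM]; first by rewrite !big_ord0.
rewrite [RHS]big_ord_recr /= -IHM [LHS]big_ord_recr /= subSnn big_ord1.
rewrite [X in _ = _ + X]big_ord_recr /= subnn addrA; congr (_ + _).
rewrite -big_split; apply: eq_bigr => t _ /=.
by rewrite subSn ?leq_ord // ?(ltnW (ltn_ord t)) // big_ord_recr.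
Qed.

Section Positivity.
Context {C : numClosedFieldType} {V : lmodType C}.
Variables (Lambda b : {bilinear V -> V -> C | *%R & *%R}) (rho : {scalar V}).
Variable cj : {linear V -> V | Num.conj \; *:%R}.
Hypotheses (b_sym : forall x y, b x y = b y x)
  (b_herm : forall x y, b x y = (b (cj y) (cj x))^*)
  (rho_real : forall x, rho (cj x) = (rho x)^*)
  (H_ge0 : forall v, 0 <= Lambda (cj v) v + b (cj v) v).

Let f x k := wick b rho (nseq k x).

(** Both sides obey the same recursion, as b (cj x) (cj x) and rho (cj x) are
    the conjugates of b x x and rho x. *)
Lemma wick_nseq_conj x k : f (cj x) k = (f x k)^*.
Proof.
have := wick_nseq_hermite b rho (cj x); rewrite rho_real => H.
apply: (hermite_uniq (f' := fun k => (f x k)^*) H); have [f0 fS] := wick_nseq_hermite b rho x.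
split; first by rewrite /f f0 rmorph1.
move=> n; rewrite /f fS rmorphD !rmorphM /= conjC_nat; congr (_ + _ * _ * _).
by rewrite (b_herm x x) conjCK.
Qed.

Lemma ffactD k t n : (k ^_ (t + n) = k ^_ t * (k - t) ^_ n)%N.
Proof.
elim: t k => [|t IHt] k; first by rewrite ffactn0 mul1n subn0.
case: k => [|k]; first by rewrite addSn !ffact0n.
by rewrite addSn !ffactSS IHt subSS mulnA.
Qed.

(** The star product contracts t letters by Lambda, then the functional pairs n
    letters by b across the two groups. Only N = t + n enters the combinatorial
    factors, so the binomial formula merges the two kinds of pairs. *)
Lemma wick_star_nseq M k l x y : (k < M)%N ->
  wick_fun b rho (star Lambda (tens (nseq k x)) (tens (nseq l y))) =
  \sum_(N < M) (k ^_ N)%:R * (l ^_ N)%:R / N`!%:R * (Lambda x y + b x y) ^+ N *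
     f x (k - N)%N * f y (l - N)%N.
Proof.
move=> kM; rewrite (star_nseq _ _ _ _ kM).
have w0 : wick_fun b rho 0 = 0.
  by have := wick_funP b rho (-1) 0 0; rewrite scaler0 addr0 mulN1r addNr.
rewrite (big_morph (wick_fun b rho) (id1 := 0) (op1 := +%R)) //; last first.
  by move=> X Y; have := wick_funP b rho 1 X Y; rewrite scale1r mul1r.
pose a t n : C := (k ^_ (t + n))%:R * (l ^_ (t + n))%:R / (t`!%:R * n`!%:R) *
   Lambda x y ^+ t * b x y ^+ n * f x (k - (t + n))%N * f y (l - (t + n))%N.
transitivity (\sum_(t < M) \sum_(n < M) a t n).
  apply: eq_bigr => t _; set c := _ * _ ^+ t.
  have := wick_funP b rho c (tsym (tens (nseq (k - t) x ++ nseq (l - t) y))) 0.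
  rewrite w0 !addr0 => ->; rewrite wick_mixed // mixedC (@mixedE _ _ _ _ M); last first.
    exact: leq_ltn_trans (leq_subr _ _) kM.
  rewrite mulr_sumr; apply: eq_bigr => n _.
  by rewrite /a /mixed_term !ffactD !natrM !subnDA /c -!/(f _ _) invfM; ring.
rewrite sum_triangle; last first.
  move=> t n Mtn; rewrite /a ffact_small ?mul0r //; exact: leq_trans Mtn.
have distr3 (n : nat) (G : 'I_n -> C) c F1 F2 :
    c * (\sum_i G i) * F1 * F2 = \sum_i c * G i * F1 * F2.
  by rewrite mulr_sumr !mulr_suml.
apply: eq_bigr => N _; rewrite [Lambda x y + _]addrC exprDn distr3.
apply: eq_bigr => i _; have iN : (i <= N)%N by rewrite -ltnS.
rewrite /a subnKC // -mulr_natr -[N`!%:R]/(N`!%:R) -(@bin_fact N i iN) !natrM.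
have := fact_neq0 (C := C) i; have := fact_neq0 (C := C) (N - i).
have : 'C(N, i)%:R != 0 :> C by rewrite pnatr_eq0 -lt0n bin_gt0.
by move=> n1 n2 n3; field; rewrite n1 n2 n3.
Qed.

Lemma psd_twist : psd (fun x y => Lambda (cj x) y + b (cj x) y).
Proof.
have [H HE] : exists H : {bilinear V -> V -> C | Num.conj \; *%R & *%R},
    forall x y, H x y = Lambda (cj x) y + b (cj x) y.
  apply: (@exists_bilinear C V V C (Num.conj \; *%R) *%R) => z a x y.
    by rewrite linearP !linearDl (bilinearZl Lambda) (bilinearZl b) /=; ring.
  by rewrite !linearDr (bilinearZr Lambda) (bilinearZr b) /=; ring.
apply: eq_psd (psd_form (h := H) _) => [x y|v]; by rewrite HE.
Qed.

(** In a combination of powers, the pairing (X, Y) |-> W (X^+ star Y) is the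
    kernel on pairs (k, x) given by [wick_star_nseq], a nonnegative combination of
    products of positive kernels. *)
Lemma wick_star_ge0 X : X \in @symmetric_tensor C V ->
  0 <= wick_fun b rho (star Lambda (tadj cj X) X).
Proof.
move=> /symmetric_powers[r ->].
pose K (p q : nat * V) := wick_fun b rho (star Lambda (powt (p.1, cj p.2)) (powt q)).
have -> : wick_fun b rho (star Lambda (tadj cj (\sum_(p <- r) p.1 *: powt p.2))
    (\sum_(p <- r) p.1 *: powt p.2)) = gram K r.
  pose F X Y := wick_fun b rho (star Lambda (tadj cj X) Y).
  rewrite -[LHS]/(F _ _) (@sesquilinear_gram _ _ F); first last.
  - by move=> a X1 X2 Y; rewrite /F starPr wick_funP.
  - by move=> a X1 X2 Y; rewrite /F tadjP starPl wick_funP.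
  by apply: eq_gram => p q; rewrite /F /K /powt tadj_tens map_nseq rev_nseq.
pose M := (\max_(p <- r) p.2.1).+1.
have -> : gram K r = gram (fun p q : nat * V =>
   \sum_(N < M) (N`!%:R)^-1 * (rank1 (fun p : nat * V => (p.1 ^_ N)%:R * f p.2 (p.1 - N)) p q *
     (Lambda (cj p.2) q.2 + b (cj p.2) q.2) ^+ N)) r.
  apply: eq_big_seq => p pr; apply: eq_bigr => q _; congr (_ * _).
  rewrite /K /powt (@wick_star_nseq M); last first.
    by rewrite ltnS (leq_bigmax_seq (F := fun p : C * (nat * V) => p.2.1)).
  apply: eq_bigr => N _; rewrite wick_nseq_conj /rank1 rmorphM /= conjC_nat; ring.
apply: psd_sum => N _; apply: psdZ; first by rewrite invr_ge0 ler0n.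
apply: psdM; first exact: psd_rank1.
apply: psdX; exact: (psd_comp (fun p : nat * V => p.2) psd_twist).
Qed.

End Positivity.

(** * Separation of points *)

Section Separation.
Context {C : numClosedFieldType} {V : lmodType C}.
Variable good : {scalar V} -> Prop.
Hypothesis goodP : forall (a : C) rho1 rho2, a \is Num.real -> good rho1 -> good rho2 ->
  exists2 rho, good rho & forall x, rho x = a * rho1 x + rho2 x.
Hypothesis good_sep : forall v, v != 0 -> exists2 rho, good rho & rho v != 0.

(** The complex span of the real vector space [good]. A plain function carries
    enough structure here, since only its values matter. *)
Definition cgood (f : V -> C) : Prop :=
  exists rho1 rho2, [/\ good rho1, good rho2 & forall x, f x = rho1 x + 'i * rho2 x].

Lemma good_zero rho : good rho -> exists2 rho0, good rho0 & forall x, rho0 x = 0.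
Proof.
move=> gr; have [|rho0 g0 E] := goodP (a := -1) _ gr gr; first by rewrite rpredN rpred1.
by exists rho0 => // x; rewrite E mulN1r addNr.
Qed.

Lemma good_cgood rho : good rho -> cgood rho.
Proof.
move=> gr; have [rho0 g0 E] := good_zero gr.
by exists rho, rho0; split=> // x; rewrite E mulr0 addr0.
Qed.

Lemma cgoodP a f g : cgood f -> cgood g -> cgood (fun x => a * f x + g x).
Proof.
move=> [f1 [f2 [gf1 gf2 fE]]] [g1 [g2 [gg1 gg2 gE]]].
have [h1 gh1 h1E] := goodP (Creal_Re a) gf1 gg1.
have [|k1 gk1 k1E] := goodP (a := - 'Im a) _ gf2 gh1; first by rewrite rpredN Creal_Im.
have [h2 gh2 h2E] := goodP (Creal_Re a) gf2 gg2.
have [k2 gk2 k2E] := goodP (Creal_Im a) gf1 gh2.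
exists k1, k2; split=> // x; rewrite k1E k2E h1E h2E fE gE [in LHS](Crect a).
rewrite !mulrDl !mulrDr mulrACA -expr2 sqrCi; ring.
Qed.

Lemma cgood_sum a0 (l : seq ((V -> C) * V)) (c : V -> C) : cgood a0 ->
  (forall p, List.In p l -> cgood p.1) ->
  cgood (fun x => a0 x - \sum_(p <- l) c p.2 * p.1 x).
Proof.
move=> ga; elim: l => [|p l IHl] gl.
  have [r1 [r2 [g1 g2 E]]] := ga; exists r1, r2; split=> // x.
  by rewrite big_nil subr0.
have gl' q : List.In q l -> cgood q.1 by move=> ql; apply: gl; right.
have [r1 [r2 [g1 g2 E]]] := cgoodP (- c p.2) (gl p (or_introl erefl)) (IHl gl').
by exists r1, r2; split=> // x; rewrite -E big_cons; ring.
Qed.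

(** Each x of s outside the span of the previous ones contributes the direction
    x - P x, with a functional that is nonzero on it and corrected to vanish on the
    previous span. *)
Lemma dual_system (s : seq V) : exists l : seq ((V -> C) * V),
  (forall p, List.In p l -> cgood p.1) /\
  {in s, forall x, x = \sum_(p <- l) p.1 x *: p.2}.
Proof.
elim: s => [|x s [l [gl ls]]]; first by exists [::].
pose P y := \sum_(p <- l) p.1 y *: p.2.
have [x0|x0] := eqVneq (x - P x) 0.
  exists l; split=> // y; rewrite inE => /orP[/eqP->|/ls //].
  by apply/eqP; rewrite -subr_eq0 x0.
have [rho gr rx] := good_sep x0.
pose sigma y := rho y - \sum_(p <- l) rho p.2 * p.1 y.
have sigmaE y : sigma y = rho (y - P y).
  rewrite linearB /= /sigma /P; congr (_ - _); rewrite linear_sum.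
  by apply: eq_bigr => p _; rewrite linearZ /= mulrC.
exists ((sigma, (rho (x - P x))^-1 *: (x - P x)) :: l); split=> [p /= [<-|/gl //]|].
  exact: (cgood_sum _ (good_cgood gr) gl).
move=> y; rewrite inE big_cons -/(P y) /= sigmaE => /orP[/eqP->|/ls yE].
  by rewrite scalerA mulfV // scale1r subrK.
have -> : y - P y = 0 by rewrite {1}yE subrr.
by rewrite linear0 scale0r add0r.
Qed.

Variable r : seq (C * (nat * V)).

(** The component of degree k of the symmetric tensor sum_p p.1 x_p^(k_p) is
    annihilated by the product of the functionals in us. *)
Definition vanish_words k (us : seq (V -> C)) : Prop :=
  \sum_(p <- r | p.2.1 == k) p.1 * \prod_(f <- us) f p.2.2 = 0.

(** Polarization in the functionals: the factor z comes out as the coefficient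
    of s^j in (z + s rho)^(j + 1), up to the factor j + 1. *)
Lemma vanish_polarize k :
  (forall rho, good rho -> \sum_(p <- r | p.2.1 == k) p.1 * rho p.2.2 ^+ k = 0) ->
  forall (us : seq {scalar V}) j rho, (forall f, List.In f us -> good f) -> good rho ->
  (size us + j = k)%N ->
  \sum_(p <- r | p.2.1 == k) p.1 * ((\prod_(f <- us) f p.2.2) * rho p.2.2 ^+ j) = 0.
Proof.
move=> vr; elim=> [|z us IHus] j rho gus gr usj.
  rewrite add0n in usj; rewrite -[RHS](vr _ gr) usj.
  by apply: eq_bigr => p _; rewrite big_nil mul1r.
pose v q : C^o := 'C(j.+1, q)%:R * \sum_(p <- r | p.2.1 == k)
  p.1 * ((\prod_(f <- us) f p.2.2) * (z p.2.2 ^+ (j.+1 - q) * rho p.2.2 ^+ q)).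
have vE (s : nat) : \sum_(q < j.+2) (s%:R ^+ q : C) *: v q = 0.
  have gz : good z by apply: gus; left.
  have [|rho' gr' E] := goodP (a := s%:R) _ gr gz; first exact: realn.
  have gus' f : List.In f us -> good f by move=> fu; apply: gus; right.
  rewrite -[RHS](IHus j.+1 _ gus' gr'); last by rewrite addnS.
  under [RHS]eq_bigr => p _ do rewrite E [s%:R * _ + _]addrC exprDn !mulr_sumr.
  rewrite exchange_big; apply: eq_bigr => q _.
  rewrite -[LHS]/(_ * _) /v !mulr_sumr; apply: eq_bigr => p _.
  by rewrite exprMn -mulr_natr; ring.
have PD (a x y : C^o) : x = 0 -> y = 0 -> a *: x + y = 0.
  by move=> -> ->; rewrite scaler0 addr0.
have /eqP := @coef_extract _ C^o (fun c => c = 0) erefl PD j.+2 v vE j (leqnSn _).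
rewrite /v binSn mulf_eq0 pnatr_eq0 /= subSnn => /eqP vj.
rewrite -[RHS]vj; apply: eq_bigr => p _; rewrite big_cons expr1; ring.
Qed.

Lemma vanish_good k (rho0 : {scalar V}) : good rho0 ->
  (forall rho, good rho -> \sum_(p <- r | p.2.1 == k) p.1 * rho p.2.2 ^+ k = 0) ->
  forall us : seq {scalar V}, (forall f, List.In f us -> good f) -> size us = k ->
  \sum_(p <- r | p.2.1 == k) p.1 * (\prod_(f <- us) f p.2.2) = 0.
Proof.
move=> g0 vr [|z us] gus usk.
  by rewrite -[RHS](vr _ g0) -usk; apply: eq_bigr => p _; rewrite big_nil.
have gus' f : List.In f us -> good f by move=> fu; apply: gus; right.
have gz : good z by apply: gus; left.
have us1 : (size us + 1 = k)%N by rewrite addn1.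
rewrite -[RHS](vanish_polarize vr gus' gz us1); apply: eq_bigr => p _.
by rewrite big_cons expr1; ring.
Qed.

Lemma vanish_cgood k (rho0 : {scalar V}) : good rho0 ->
  (forall rho, good rho -> \sum_(p <- r | p.2.1 == k) p.1 * rho p.2.2 ^+ k = 0) ->
  forall us, (forall f, List.In f us -> cgood f) -> size us = k -> vanish_words k us.
Proof.
move=> g0 vr us gus usk.
suff : forall vs : seq {scalar V}, (forall f, List.In f vs -> good f) ->
    (size vs + size us = k)%N ->
    \sum_(p <- r | p.2.1 == k) p.1 *
      ((\prod_(f <- vs) f p.2.2) * \prod_(f <- us) f p.2.2) = 0.
  move=> /(_ [::]) H; rewrite /vanish_words -[RHS]H //.
  by apply: eq_bigr => p _; rewrite big_nil mul1r.
elim: us gus {usk} => [|f us IHus] gus vs gvs vus.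
  rewrite -[RHS](vanish_good g0 vr gvs); last by rewrite addn0 in vus.
  by apply: eq_bigr => p _; rewrite big_nil mulr1.
have gus' g : List.In g us -> cgood g by move=> gu; apply: gus; right.
have [r1 [r2 [g1 g2 E]]] : cgood f by apply: gus; left.
have H rho : good rho -> \sum_(p <- r | p.2.1 == k) p.1 *
      ((\prod_(f <- rho :: vs) f p.2.2) * \prod_(f <- us) f p.2.2) = 0.
  move=> gr; apply: IHus => //; first by move=> g [<-|/gvs].
  by rewrite addSnnS.
transitivity (\sum_(p <- r | p.2.1 == k) p.1 *
      ((\prod_(f <- r1 :: vs) f p.2.2) * \prod_(f <- us) f p.2.2) +
   'i * \sum_(p <- r | p.2.1 == k) p.1 *
      ((\prod_(f <- r2 :: vs) f p.2.2) * \prod_(f <- us) f p.2.2)).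
  rewrite mulr_sumr -big_split; apply: eq_bigr => p _ /=.
  by rewrite !big_cons E; ring.
by rewrite !H // mulr0 addr0.
Qed.

Lemma multilinear_sum (U : lmodType C) (f : seq V -> U) : multilinear idfun f ->
  forall (l : seq ((V -> C) * V)) (c : (V -> C) * V -> C) u w,
  f (u ++ (\sum_(q <- l) c q *: q.2) :: w) = \sum_(q <- l) c q *: f (u ++ q.2 :: w).
Proof.
move=> fl l c u w; elim: l => [|q l IHl]; last by rewrite !big_cons fl IHl.
rewrite !big_nil; have := fl u w (-1) 0 0.
by rewrite scaler0 addr0 scaleN1r addNr.
Qed.

Lemma sum_In0 (U : nmodType) (I : Type) (l : seq I) (F : I -> U) :
  (forall q, List.In q l -> F q = 0) -> \sum_(q <- l) F q = 0.
Proof.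
elim: l => [|q l IHl] H; first by rewrite big_nil.
by rewrite big_cons (H q) ?IHl ?addr0 //; [move=> q' ?; apply: H; right|left].
Qed.

(** Replacing the letters one after the other by their expansion in a dual
    system reduces any multilinear f to products of functionals. *)
Lemma vanish_multilinear k (U : lmodType C) (f : seq V -> U) : multilinear idfun f ->
  (forall us, (forall f, List.In f us -> cgood f) -> size us = k -> vanish_words k us) ->
  \sum_(p <- r | p.2.1 == k) p.1 *: f (nseq p.2.1 p.2.2) = 0.
Proof.
move=> fl vk; have [l [gl ls]] := dual_system [seq p.2.2 | p <- r].
suff H j u us : (forall g, List.In g us -> cgood g) -> (size us + j = k)%N ->
    \sum_(p <- r | p.2.1 == k) (p.1 * \prod_(g <- us) g p.2.2) *: f (u ++ nseq j p.2.2) = 0.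
  rewrite -[RHS](@H k [::] [::]) //; apply: eq_bigr => p /eqP ->.
  by rewrite big_nil mulr1.
elim: j u us => [|j IHj] u us gus usk.
  under eq_bigr => p _ do rewrite [nseq 0 _]/= cats0.
  rewrite -scaler_suml [X in X *: _](vk us) ?scale0r //.
  by rewrite addn0 in usk.
transitivity (\sum_(q <- l) \sum_(p <- r | p.2.1 == k)
   (p.1 * \prod_(g <- q.1 :: us) g p.2.2) *: f ((u ++ [:: q.2]) ++ nseq j p.2.2)); last first.
  apply: sum_In0 => q ql; apply: IHj; last by rewrite /= addSnnS.
  by move=> g /= [<-|/gus //]; exact: gl.
rewrite exchange_big big_seq_cond [RHS]big_seq_cond; apply: eq_bigr => p /andP[pr _].
rewrite [nseq j.+1 _]/= {2}(ls p.2.2); last exact: (map_f (fun p : C * (nat * V) => p.2.2)).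
rewrite multilinear_sum // scaler_sumr; apply: eq_bigr => q _.
by rewrite scalerA big_cons -catA; congr (_ *: _); ring.
Qed.

End Separation.

Lemma partition_sum (U : nmodType) (I : eqType) (l : seq I) (g : I -> nat) (F : I -> U) N :
  {in l, forall i, (g i < N)%N} ->
  \sum_(i <- l) F i = \sum_(k < N) \sum_(i <- l | g i == k) F i.
Proof.
move=> gN; under [RHS]eq_bigr => k _ do rewrite big_mkcond.
rewrite exchange_big; apply: eq_big_seq => i il /=.
rewrite (bigD1 (Ordinal (gN i il))) //= eqxx big1 ?addr0 // => k.
by rewrite -(inj_eq val_inj) /= eq_sym => /negPf ->.
Qed.

Section WickSeparation.
Context {C : numClosedFieldType} {V : lmodType C}.
Variable good : {scalar V} -> Prop.
Hypothesis goodP : forall (a : C) rho1 rho2, a \is Num.real -> good rho1 -> good rho2 ->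
  exists2 rho, good rho & forall x, rho x = a * rho1 x + rho2 x.
Hypothesis good_sep : forall v, v != 0 -> exists2 rho, good rho & rho v != 0.
Variables (b : {bilinear V -> V -> C | *%R & *%R}) (rho0 : {scalar V}).
Hypothesis good0 : good rho0.

Lemma wick_monoZ (rho rho' : {scalar V}) (s : C) m r w : (forall x, rho' x = s * rho x) ->
  wick_mono b rho' m r w = s ^+ r * wick_mono b rho m r w.
Proof.
move=> E; elim: m w => [|m IHm] w /=.
  case: eqP => [<-|_]; last by rewrite mulr0.
  under eq_bigr => x _ do rewrite E.
  by rewrite big_split big_const_seq count_predT iter_mulr_1.
by case: w => [|x [|y w]]; rewrite ?mulr0 // IHm mulrCA.
Qed.

(** Descending induction on the degree k. Scaling rho extracts the terms of W
    with exactly k single letters. Those with at least one pair see only components of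
    degree k + 2m > k, which are already known to vanish; what remains is the k-th
    power of rho on the component of degree k. *)
Lemma wick_separating X : X \in @symmetric_tensor C V ->
  (forall rho, good rho -> wick_fun b rho X = 0) -> X = 0.
Proof.
move=> /symmetric_powers[r ->] wX.
pose N := (\max_(p <- r) p.2.1).+1.
have rN : {in r, forall p, (p.2.1 < N)%N}.
  by move=> p pr; rewrite ltnS (leq_bigmax_seq (F := fun p : C * (nat * V) => p.2.1)).
have vanish n k : (N <= k + n)%N ->
    forall us, (forall f, List.In f us -> cgood good f) -> size us = k -> vanish_words r k us.
  elim: n k => [|n IHn] k.
    rewrite addn0 => Nk us _ _; rewrite /vanish_words big_seq_cond big_pred0 // => p.
    by case: (boolP (p \in r)) => //= /rN pN; rewrite ltn_eqF // (leq_trans pN Nk).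
  move=> Nk; have [kN|kN] := leqP N k; first by apply: IHn; lia.
  apply: (vanish_cgood goodP good0) => rho gr.
  pose Z m q (rho : {scalar V}) := \sum_(p <- r) p.1 * wick_mono b rho m q (nseq p.2.1 p.2.2).
  pose w q : C^o := \sum_(m < N) wick_coef m q * Z m q rho.
  have wE (s : nat) : \sum_(q < N) (s%:R ^+ q : C) *: w q = 0.
    (* The closure property only gives a rho1 + rho2, so s rho is written as
       (s - 1) rho + rho. *)
    have [|rho' gr' E] := goodP (a := s%:R - 1) _ gr gr.
      by rewrite rpredB ?realn ?rpred1.
    have {}E x : rho' x = s%:R * rho x by rewrite E; ring.
    rewrite -[RHS](wX _ gr').
    have -> : \sum_(p <- r) p.1 *: powt p.2 = \sum_(p <- [seq (p.1, nseq p.2.1 p.2.2) | p <- r]) p.1 *: tens p.2.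
      by rewrite big_map.
    rewrite wick_fun_sum big_map /=.
    transitivity (\sum_(m < N) \sum_(q < N) wick_coef m q * Z m q rho').
      rewrite exchange_big; apply: eq_bigr => q _.
      rewrite -[LHS]/(_ * _) /w mulr_sumr; apply: eq_bigr => m _.
      rewrite mulrCA; congr (_ * _); rewrite /Z mulr_sumr; apply: eq_bigr => p _.
      by rewrite (wick_monoZ _ _ _ E); ring.
    transitivity (\sum_(m < N) \sum_(q < N) \sum_(p <- r)
        p.1 * (wick_coef m q * wick_mono b rho' m q (nseq p.2.1 p.2.2))).
      apply: eq_bigr => m _; apply: eq_bigr => q _; rewrite /Z mulr_sumr.
      by apply: eq_bigr => p _; rewrite mulrCA.
    transitivity (\sum_(m < N) \sum_(p <- r) \sum_(q < N)
        p.1 * (wick_coef m q * wick_mono b rho' m q (nseq p.2.1 p.2.2))).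
      by apply: eq_bigr => m _; exact: exchange_big.
    rewrite exchange_big; apply: eq_big_seq => p pr.
    rewrite (@wick_bounded_sum _ _ _ _ N) ?size_nseq ?rN // mulr_sumr.
    by apply: eq_bigr => m _; rewrite mulr_sumr.
  have PD (a x y : C^o) : x = 0 -> y = 0 -> a *: x + y = 0.
    by move=> -> ->; rewrite scaler0 addr0.
  have := @coef_extract _ C^o (fun c => c = 0) erefl PD N w wE k kN.
  rewrite /w big_ord_recl /= big1 ?addr0 => [|m _].
    rewrite /wick_coef fact0 expr0 mulr1 mul1r divff ?fact_neq0 // mul1r => Z0.
    rewrite -[RHS]Z0 /Z [LHS]big_mkcond; apply: eq_bigr => p _ /=.
    rewrite size_nseq; case: eqP => [pk|_]; last by rewrite mulr0.
    by rewrite big_nseq iter_mulr_1 pk.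
  rewrite /bump leq0n add1n [X in _ * X](_ : _ = 0) ?mulr0 //.
  have VM : \sum_(p <- r | p.2.1 == (m.+1.*2 + k)%N)
      p.1 *: (wick_mono b rho m.+1 k (nseq p.2.1 p.2.2) : C^o) = 0.
    apply: (vanish_multilinear goodP good_sep (wick_mono_multilinear b rho m.+1 k)).
    by apply: IHn; lia.
  rewrite -[RHS]VM /Z [RHS]big_mkcond; apply: eq_bigr => p _.
  case: eqP => [//|pk]; rewrite wick_mono_out ?mulr0 // size_nseq.
  exact/eqP.
rewrite (partition_sum _ rN) big1 // => k _.
have := @vanish_multilinear _ _ _ goodP good_sep r k _ (@tens C V) (@tens_multilinear C V).
by apply; exact: (vanish N k (leq_addl _ _)).
Qed.

End WickSeparation.
(** * Continuous seminorms on a Hausdorff locally convex space *)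

Local Open Scope classical_set_scope.
Local Open Scope ring_scope.

Lemma gt0_complexP (R : rcfType) (e : R[i]) : 0 < e -> exists2 r : R, 0 < r & e = r%:C%C.
Proof.
move=> e0; have eE : (complex.Re e)%:C%C = e by apply/RRe_real/gtr0_real.
by exists (complex.Re e) => //; rewrite -(ltcR 0) eE.
Qed.

Section Tvs.
Context {R : realType} {V : tvsType R[i]}.

Lemma convex_comb (A : set V) (x y : V) (t : R) : convex_set A ->
  0 <= t <= 1 -> A x -> A y -> A (t%:C%C *: x + (1 - t)%:C%C *: y).
Proof.
move=> cA /andP[t0 t1] Ax Ay.
have t01 : (0 <= t%:C%C :> R[i]) && (t%:C%C <= 1 :> R[i]).
  by rewrite (ler0c t) t0 -[1]/(1%:C%C) lecR.
pose l : {i01 R[i]} := Itv01 (proj1 (andP t01)) (proj2 (andP t01)).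
have /set_mem := cA x y l (mem_set Ax) (mem_set Ay).
by rewrite /conv /= rmorphB.
Qed.

Lemma nbhs_shift (x : V) (c : R[i]) (U : set V) : nbhs 0 U ->
  nbhs x [set y | U (c *: (y - x))].
Proof.
move=> U0; have : (fun y : V => c *: (y - x)) @ x --> c *: (x - x).
  apply: (@continuous_comp _ _ _ (fun y : V => (c : R[i]^o, y - x))
    (fun z : R[i]^o * V => z.1 *: z.2)); last exact: scale_continuous.
  apply: (@cvg_pair _ _ _ _ (nbhs (c : R[i]^o))); first exact: cvg_cst.
  apply: (@continuous_comp _ _ _ (fun y : V => (y, - x))
    (fun z : V * V => z.1 + z.2)); last exact: add_continuous.
  by apply: cvg_pair; [exact: cvg_id|exact: cvg_cst].
by rewrite subrr scaler0 => /(_ U U0).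
Qed.

Lemma nbhs_absorb (x : V) (U : set V) : nbhs 0 U ->
  exists2 e : R, 0 < e & forall a : R[i], `|a| < e%:C%C -> U (a *: x).
Proof.
move=> U0; have := @scale_continuous _ V (0 : R[i]^o, x).
rewrite /continuous_at /= scale0r => /(_ U U0)[[A B] [/= /nbhs_ballP[e /= e0 eA] Bx] AB].
have [r r0 eE] := gt0_complexP e0; exists r => // a ae.
apply: (AB (a, x)); split; last exact: nbhs_singleton.
by apply: eA; rewrite /ball /= sub0r normrN eE.
Qed.

(** The set of the x whose multiples by scalars of modulus at most e stay in U
    is the intersection of dilates of U: it is balanced, convex if U is, and still a
    neighbourhood of 0 by joint continuity of the scalar multiplication. *)
Lemma nbhs_scale (U : set V) : nbhs 0 U ->
  exists2 e : R, 0 < e & nbhs 0 [set x : V | forall a : R[i], `|a| <= e%:C%C -> U (a *: x)].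
Proof.
move=> U0; have := @scale_continuous _ V (0 : R[i]^o, 0).
rewrite /continuous_at /= scale0r => /(_ U U0)[[A B] [/= /nbhs_ballP[e /= e0 eA] B0] AB].
have [r r0 eE] := gt0_complexP e0; exists (r / 2); first by rewrite divr_gt0.
apply: filterS B0 => x Bx a ae; apply: (AB (a, x)); split => //=.
apply: eA; rewrite /ball /= sub0r normrN eE (le_lt_trans ae) // ltcR.
by rewrite ltr_pdivrMr // mulr2n mulrDr mulr1 ltrDl.
Qed.

Lemma seminorm_continuous (p : V -> R) : seminorm p ->
  nbhs 0 [set x | p x <= 1] -> continuous p.
Proof.
move=> [pD pZ] p1 x; apply/cvgrPdist_lt => e e0.
have pN y : p (- y) = p y by rewrite -scaleN1r pZ normrN normr1 mul1r.
have : nbhs x [set y | p ((2 / e)%:C%C *: (y - x)) <= 1].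
  exact: (nbhs_shift x (2 / e)%:C%C p1).
apply: filterS => y /=; rewrite pZ normc_def /= expr0n addr0 sqrtr_sqr.
have e20 : 0 < 2 / e by rewrite divr_gt0.
rewrite (ger0_norm (ltW e20)) => pyx.
have {}pyx : p (y - x) < e.
  have : p (y - x) <= e / 2.
    rewrite -(ler_pM2l e20) (le_trans pyx) // mulrA mulfVK ?gt_eqF //.
    by rewrite divff.
  move=> /le_lt_trans; apply; lra.
have := pD (y - x) x; have := pD (- (y - x)) y.
rewrite pN subrK opprB subrK => H1 H2.
rewrite ltr_norml; apply/andP; split; lra.
Qed.

Lemma exists_convex_balanced (v : V) : hausdorff_space V -> v != 0 ->
  exists (U : set V) (e : R), [/\ 0 < e, nbhs 0 U, ~ U (e^-1%:C%C *: v),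
    (forall x y (t : R), 0 <= t <= 1 -> U x -> U y ->
       U (t%:C%C *: x + (1 - t)%:C%C *: y)) &
    (forall (a : R[i]) x, `|a| <= 1 -> U x -> U (a *: x))].
Proof.
move=> hV v0; have [|A [oA /set_mem A0 /set_mem Av]] := @hausdorff_accessible V hV 0 v.
  by rewrite eq_sym.
have [B Bconvex [Bopen Bbasis]] := @locally_convex _ V.
have [A' [BA' A'0] A'A] := Bbasis 0 A (open_nbhs_nbhs (conj oA A0)).
have cA' : convex_set A' by apply/Bconvex/mem_set.
have nA' : nbhs 0 A' by apply: open_nbhs_nbhs; split=> //; exact: Bopen.
have [e e0 eU] := nbhs_scale nA'.
exists [set x : V | forall a : R[i], `|a| <= e%:C%C -> A' (a *: x)], e; split=> //.
- have en : `|e%:C%C| = e%:C%C :> R[i] by rewrite ger0_norm // ler0c ltW.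
  move=> /(_ e%:C%C); rewrite en lexx => /(_ isT).
  rewrite scalerA -rmorphM divff ?gt_eqF // scale1r => /A'A; exact: Av.
- move=> x y t t01 Ux Uy a ae; rewrite scalerDr !scalerA ![a * _]mulrC -!scalerA.
  by apply: convex_comb => //; [exact: Ux|exact: Uy].
- move=> a x a1 Ux c ce; rewrite scalerA; apply: Ux.
  by rewrite normrM (le_trans _ ce) // ler_piMr.
Qed.

(** The Minkowski gauge of a convex balanced neighbourhood U of 0 such that e U
    misses v; its value at v is then at least e. *)
Lemma exists_seminorm (v : V) : hausdorff_space V -> v != 0 ->
  exists p : V -> R, [/\ seminorm p, continuous p & 0 < p v].
Proof.
move=> hV v0; have [U [e [e0 U0 Uv Uconvex Ubal]]] := exists_convex_balanced hV v0.
have inv_ge (t : R) : 0 < t -> 0 <= t^-1%:C%C :> R[i] by move=> t0; rewrite ler0c invr_ge0 ltW.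
pose S x := [set t : R | 0 < t /\ U (t^-1%:C%C *: x)].
pose p x := inf (S x).
have S_up x s t : S x s -> s <= t -> S x t.
  move=> [s0 Us] st; have t0 := lt_le_trans s0 st; split=> //.
  have -> : t^-1%:C%C *: x = (s / t)%:C%C *: (s^-1%:C%C *: x).
    by rewrite scalerA -rmorphM mulrAC divff ?gt_eqF // mul1r.
  have st0 : 0 <= s / t by rewrite divr_ge0 ?ltW.
  apply: Ubal => //; rewrite ger0_norm ?ler0c //.
  by rewrite -[1]/(1%:C%C) lecR ler_pdivrMr // mul1r.
have S_nonempty x : S x !=set0.
  have [r r0 rU] := nbhs_absorb x U0; exists (2 / r); split; first by rewrite divr_gt0.
  have r20 : 0 <= r / 2 by rewrite divr_ge0 ?ltW.
  apply: rU; rewrite invf_div ger0_norm ?ler0c // ltcR.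
  by rewrite ltr_pdivrMr // mulr2n mulrDr mulr1 ltrDl.
have S_inf x : has_inf (S x).
  by split=> //; exists 0 => t [/ltW].
have p_ge0 x : 0 <= p x by apply: lb_le_inf => // t [/ltW].
have p_le x t : S x t -> p x <= t by move=> St; apply: ge_inf => //; case: (S_inf x).
have p_lt x t : p x < t -> S x t.
  move=> pt; have d0 : 0 < t - p x by rewrite subr_gt0.
  have [s Ss st] := inf_adherent d0 (S_inf x).
  apply: S_up Ss _; move: st; rewrite -/(p x) addrC subrK; exact: ltW.
have p_eps x (a : R) : (forall t, S x t -> a <= t) -> a <= p x.
  by move=> H; apply: lb_le_inf.
have pZ_le (a : R[i]) x : a != 0 -> p (a *: x) <= complex.Re `|a| * p x.
  move=> a0; have [r r0 aE] : exists2 r : R, 0 < r & `|a| = r%:C%C.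
    by apply: gt0_complexP; rewrite normr_gt0.
  rewrite aE /= mulrC -ler_pdivrMr //; apply: p_eps => t [t0 Ut].
  rewrite ler_pdivrMr //; apply: p_le; split; first exact: mulr_gt0.
  rewrite scalerA.
  have -> : (t * r)^-1%:C%C * a = (a / `|a|) * t^-1%:C%C.
    by rewrite aE -fmorphV -mulrA -rmorphM /= -invfM [LHS]mulrC [t * r]mulrC.
  by rewrite -scalerA; apply: Ubal => //; rewrite normrM normfV normr_id divff // normr_eq0.
have p0 : p 0 = 0.
  apply/le_anti; rewrite p_ge0 andbT leNgt; apply/negP => p0.
  have St : S 0 (p 0 / 2).
    by split; [rewrite divr_gt0|rewrite scaler0; exact: nbhs_singleton].
  have := p_le _ _ St; rewrite ler_pdivlMr // mulr2n mulrDr mulr1.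
  by rewrite gerDl leNgt p0.
have pS : seminorm p.
  split=> [x y|a x].
    rewrite -lerBlDr; apply: (p_eps) => s [s0 Us].
    rewrite lerBlDr [s + _]addrC -lerBlDr; apply: (p_eps) => t [t0 Ut].
    rewrite lerBlDr; have st0 : 0 < t + s by rewrite addr_gt0.
    apply: p_le; split=> //.
    have -> : (t + s)^-1%:C%C *: (x + y) =
        (s / (t + s))%:C%C *: (s^-1%:C%C *: x) + (1 - s / (t + s))%:C%C *: (t^-1%:C%C *: y).
      have -> : 1 - s / (t + s) = t / (t + s).
        by rewrite -[1](@divff _ (t + s)) ?gt_eqF // -mulrBl addrK.
      rewrite scalerDr !scalerA -!rmorphM; congr (_%:C%C *: _ + _%:C%C *: _).
        by rewrite mulrAC divff ?gt_eqF // mul1r.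
      by rewrite mulrAC divff ?gt_eqF // mul1r.
    apply: Uconvex => //; apply/andP; split; first by rewrite divr_ge0 ?ltW.
    by rewrite ler_pdivrMr // mul1r lerDr ltW.
  have [->|a0] := eqVneq a 0; first by rewrite scale0r p0 normr0 mul0r.
  apply/le_anti/andP; split; first exact: pZ_le.
  have ai0 : a^-1 != 0 by rewrite invr_eq0.
  have [r r0 aE] : exists2 r : R, 0 < r & `|a| = r%:C%C.
    by apply: gt0_complexP; rewrite normr_gt0.
  have := pZ_le a^-1 (a *: x) ai0; rewrite scalerA mulVf // scale1r normfV aE -fmorphV /=.
  by rewrite mulrC ler_pdivlMr // mulrC.
exists p; split=> //.
  apply: seminorm_continuous => //; apply: filterS U0 => x Ux /=.
  by apply: p_le; split; rewrite ?ltr01 // invr1 scale1r.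
rewrite (lt_le_trans e0) // leNgt; apply/negP => /p_lt[_].
exact: Uv.
Qed.

End Tvs.

(** * The topology of the tensor algebra *)

Lemma exists_scalar {C : nzRingType} {V : lmodType C} (f : V -> C) :
  (forall a x y, f (a *: x + y) = a * f x + f y) ->
  exists g : {scalar V}, forall x, g x = f x.
Proof.
move=> fl; pose g : {scalar V} := HB.pack f (GRing.isLinear.Build C V C *%R f fl).
by exists g.
Qed.

Section SymmetricCoercion.
Context {C : numClosedFieldType} {V : lmodType C}.

Lemma symt_valZ (a : C) (X : symt V) : symt_val (a *: X) = a *: symt_val X.
Proof. exact: GRing.valZ. Qed.

Lemma symt_valD (X Y : symt V) : symt_val (X + Y) = symt_val X + symt_val Y.
Proof. exact: GRing.valD. Qed.

Lemma symt_val0 : symt_val (0 : symt V) = 0.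
Proof. exact: GRing.val0. Qed.

End SymmetricCoercion.

Section Forms.
Context {R : realType} {V : tvsType R[i]}.
Implicit Types h : {bilinear V -> V -> R[i] | Num.conj \; *%R & *%R}.
Local Notation cont_form := (@cont_pos_herm_form R V).

Lemma cont_form_psd h : cont_form h -> psd h.
Proof. by case=> _ h0 _; exact: psd_form. Qed.

Lemma cont_form_add h1 h2 : cont_form h1 -> cont_form h2 ->
  exists2 h, cont_form h & forall x y, h x y = h1 x y + h2 x y.
Proof.
move=> [h1H h10 h1c] [h2H h20 h2c].
have [|z a x y|h hE] := @exists_bilinear _ V V _ (Num.conj \; *%R) *%R (fun x y => h1 x y + h2 x y).
- by move=> z a x y; rewrite !formPl /=; ring.
- by rewrite !formPr /=; ring.
exists h; last exact: hE.
split=> [x y|v|].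
- by rewrite !hE rmorphD /= -h1H -h2H.
- by rewrite hE addr_ge0.
have -> : (fun p : V * V => h p.1 p.2 : R[i]^o) =
    (fun p : V * V => (h1 p.1 p.2 : R[i]^o) + (h2 p.1 p.2 : R[i]^o)).
  by apply: funext => p; rewrite hE.
by move=> p; apply: cvgD; [exact: h1c|exact: h2c].
Qed.

Lemma cont_form_scale (c : R[i]) h1 : 0 <= c -> cont_form h1 ->
  exists2 h, cont_form h & forall x y, h x y = c * h1 x y.
Proof.
move=> c0 [h1H h10 h1c].
have [|z a x y|h hE] := @exists_bilinear _ V V _ (Num.conj \; *%R) *%R (fun x y => c * h1 x y).
- by move=> z a x y; rewrite formPl /=; ring.
- by rewrite formPr /=; ring.
exists h; last exact: hE.
split=> [x y|v|].
- rewrite !hE rmorphM /= -h1H; congr (_ * _).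
  by apply/esym/CrealP/ger0_real.
- by rewrite hE mulr_ge0.
have -> : (fun p : V * V => h p.1 p.2 : R[i]^o) =
    (fun p : V * V => c *: (h1 p.1 p.2 : R[i]^o)).
  by apply: funext => p; rewrite hE.
by move=> p; apply: cvgZr; exact: h1c.
Qed.

Lemma cont_form_left h e : cont_form h -> continuous (h e : V -> R[i]^o).
Proof.
move=> [_ _ hc] x.
apply: (@continuous_comp _ _ _ (fun y : V => (e, y)) (fun p : V * V => h p.1 p.2 : R[i]^o)).
  by apply: cvg_pair; [exact: cvg_cst|exact: cvg_id].
exact: hc.
Qed.

(** Links the complex valued form with the real valued seminorm; positivity
    is what makes the imaginary part vanish. *)
Lemma tip_tnorm h X : psd h -> tip h X X = ((tnorm h X) ^+ 2)%:C%C.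
Proof.
move=> hp; have := tip_ge0 X hp; rewrite lecE /= => /andP[/eqP im re].
rewrite /tnorm sqr_sqrtr //; case: (tip h X X) im => a b /= ->.
by [].
Qed.

Lemma tnorm_ge0 h X : 0 <= tnorm h X.
Proof. exact: sqrtr_ge0. Qed.

Lemma tipDl h X Y Z : tip h (X + Y) Z = tip h X Z + tip h Y Z.
Proof. by have := tipPl h 1 X Y Z; rewrite scale1r rmorph1 mul1r. Qed.

Lemma tipDr h X Y Z : tip h Z (X + Y) = tip h Z X + tip h Z Y.
Proof. by have := tipPr h 1 X Y Z; rewrite scale1r mul1r. Qed.

Lemma tip0l h Z : tip h 0 Z = 0.
Proof.
by have := tipPl h (-1) 0 0 Z; rewrite scaler0 addr0 rmorphN1 mulN1r addNr.
Qed.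

Lemma tip0r h Z : tip h Z 0 = 0.
Proof.
by have := tipPr h (-1) 0 0 Z; rewrite scaler0 addr0 mulN1r addNr.
Qed.

Lemma tipZ h a X : tip h (a *: X) (a *: X) = `|a| ^+ 2 * tip h X X.
Proof.
have El := tipPl h a X 0 (a *: X); have Er := tipPr h a X 0 X.
rewrite (addr0 (a *: X)) tip0l (addr0 (_ * _)) in El.
rewrite (addr0 (a *: X)) tip0r (addr0 (_ * _)) in Er.
apply: etrans El _; apply: etrans (congr1 (fun z => a^* * z) Er) _.
by rewrite normCKC mulrA.
Qed.

Lemma tnormZ h (a : R) X : psd h -> 0 <= a -> tnorm h (a%:C%C *: X) = a * tnorm h X.
Proof.
move=> hp a0; have aT : 0 <= a * tnorm h X by rewrite mulr_ge0 // tnorm_ge0.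
apply/eqP; rewrite -(eqrXn2 (_ : 0 < 2)%N) ?tnorm_ge0 //; apply/eqP/complexI.
rewrite -tip_tnorm // tipZ ger0_norm ?ler0c // tip_tnorm // exprMn.
by rewrite -rmorphXn -rmorphM.
Qed.

Lemma tnormN h X : tnorm h (- X) = tnorm h X.
Proof. by rewrite /tnorm -scaleN1r tipZ normrN normr1 expr1n mul1r. Qed.

Lemma tnorm_triangle h X Y : psd h -> tnorm h (X + Y) <= tnorm h X + tnorm h Y.
Proof.
move=> hp.
rewrite -(ler_pXn2r (_ : 0 < 2)%N) ?nnegrE ?addr_ge0 ?tnorm_ge0 //.
rewrite -lecR -tip_tnorm //.
have tp := psd_tip hp.
have CS : `|tip h X Y| ^+ 2 <= ((tnorm h X * tnorm h Y) ^+ 2)%:C%C.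
  have E : tip h X X * tip h Y Y = ((tnorm h X * tnorm h Y) ^+ 2)%:C%C.
    by rewrite (tip_tnorm X hp) (tip_tnorm Y hp) -rmorphM -exprMn.
  by rewrite -E; exact: psd_CS.
have XYle : `|tip h X Y| <= (tnorm h X * tnorm h Y)%:C%C.
  have XY0 : 0 <= (tnorm h X * tnorm h Y)%:C%C :> R[i].
    by rewrite ler0c mulr_ge0 ?tnorm_ge0.
  rewrite -(ler_pXn2r (_ : 0 < 2)%N) ?nnegrE ?normr_ge0 ?XY0 //.
  by apply: le_trans CS _; rewrite (rmorphXn (real_complex R)).
rewrite tipDl !tipDr (psd_herm Y X tp) !tip_tnorm //.
set z := tip h X Y in XYle *.
have zz : z + z^* <= 2%:R * (tnorm h X * tnorm h Y)%:C%C.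
  have zr : z + z^* \is Num.real by rewrite CrealE rmorphD /= conjCK addrC.
  apply: le_trans (real_ler_norm zr) _; apply: le_trans (ler_normD _ _) _.
  by rewrite norm_conjC -mulr2n -[leLHS]mulr_natl ler_pM2l ?ltr0n.
have -> : ((tnorm h X + tnorm h Y) ^+ 2)%:C%C = 2%:R * (tnorm h X * tnorm h Y)%:C%C +
    ((tnorm h X ^+ 2)%:C%C + (tnorm h Y ^+ 2)%:C%C) :> R[i].
  move: (tnorm h X) (tnorm h Y) => x y.
  rewrite (rmorphXn (real_complex R)) (rmorphXn (real_complex R) 2 x).
  rewrite (rmorphXn (real_complex R) 2 y) (rmorphD (real_complex R)).
  rewrite (rmorphM (real_complex R) x y).
  by move: (real_complex R x) (real_complex R y) => u v; ring.
have rearr (a c d e : R[i]) : a + c + (d + e) = (c + d) + (a + e) by ring.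
by rewrite rearr lerD2r.
Qed.

Lemma tnorm_le h h' X : psd h -> dom h h' -> tnorm h X <= tnorm h' X.
Proof.
move=> hp hh'; apply: ler_wsqrtr.
by have := tip_le X hp hh'; rewrite lecE => /andP[].
Qed.

End Forms.

Section Topology.
Context {R : realType} {V : tvsType R[i]}.
Implicit Types h : {bilinear V -> V -> R[i] | Num.conj \; *%R & *%R}.
Local Notation cont_form := (@cont_pos_herm_form R V).

Lemma cont_form0 : exists h, cont_form h.
Proof.
have [|z a x y|h hE] := @exists_bilinear _ V V _ (Num.conj \; *%R) *%R (fun _ _ : V => 0 : R[i]).
- by move=> z a x y; rewrite /= mulr0 addr0.
- by rewrite /= mulr0 addr0.
exists h; split=> [x y|v|]; rewrite ?hE ?rmorph0 //.
have -> : (fun p : V * V => h p.1 p.2 : R[i]^o) = (fun=> 0 : R[i]^o).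
  by apply: funext => p; rewrite hE.
by move=> p; exact: cvg_cst.
Qed.

(** The seminorms are directed: a sum of two continuous forms dominates both, so
    finitely many balls containing 0 contain a single centred ball. *)
Lemma nbhs0_tensor (B : set (tensor V)) : nbhs (0 : tensor V) B ->
  exists2 h, cont_form h & exists2 e : R, 0 < e & forall X, tnorm h X < e -> B X.
Proof.
rewrite nbhsE; case=> O [oO O0] OB.
case: oO => D sD DO.
move: O0; rewrite -DO; case=> A DA A0.
have [F sF FA] := sD _ DA.
suff [h hc [e e0 he]] : exists2 h, cont_form h & exists2 e : R, 0 < e &
    forall X, tnorm h X < e -> A X.
  exists h => //; exists e => // X /he AX; apply: OB; rewrite -DO; exists A => //.
pose L : seq (set (tensor V)) := enum_fset F.
have {FA}AF X : A X <-> forall S, S \in L -> S X.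
  by rewrite -FA; split=> [H S SF|H S SF]; apply: H.
have : forall S : set (tensor V), S \in L ->
    exists h Y (e : R), [/\ cont_form h, 0 < e & S = tball h Y e].
  by move=> S /sF /set_mem.
have : forall S : set (tensor V), S \in L -> S 0.
  by move=> S SF; move/AF: A0; apply.
suff H (l : seq (set (tensor V))) : (forall S, S \in l -> S 0) ->
    (forall S, S \in l -> exists h Y (e : R), [/\ cont_form h, 0 < e & S = tball h Y e]) ->
    exists2 h, cont_form h & exists2 e : R, 0 < e &
      forall X, tnorm h X < e -> forall S, S \in l -> S X.
  move=> F0 Fb; have [h hc [e e0 he]] := H _ F0 Fb.
  by exists h => //; exists e => // X /he HX; apply/AF.
elim: l => [|S l IHl] l0 lb.
  by have [h hc] := cont_form0; exists h => //; exists 1.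
have [|S' S'l|h1 hc1 [e1 e10 he1]] := IHl.
- by move=> S' S'l; apply: l0; rewrite inE S'l orbT.
- by apply: lb; rewrite inE S'l orbT.
have [h2 [Y [e2 [hc2 e20 SE]]]] := lb S (mem_head _ _).
have := l0 S (mem_head _ _); rewrite SE /tball /= sub0r tnormN => Ye2.
have [h hc hE] := cont_form_add hc1 hc2.
have h1p := cont_form_psd hc1; have h2p := cont_form_psd hc2.
have h1h : dom h1 h.
  by apply: eq_psd h2p => x y; rewrite hE addrAC subrr add0r.
have h2h : dom h2 h.
  by apply: eq_psd h1p => x y; rewrite hE addrK.
exists h => //; exists (Num.min e1 (e2 - tnorm h2 Y)).
  by rewrite lt_min e10 subr_gt0.
move=> X Xe; have /andP[X1 X2] : (tnorm h X < e1) && (tnorm h X < e2 - tnorm h2 Y).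
  by rewrite -lt_min.
move=> S'.
rewrite in_cons => /orP[/eqP S'S|S'l].
  rewrite S'S; change (tball h2 Y e2 X); rewrite /tball /=.
  apply: le_lt_trans (tnorm_triangle X (- Y) h2p) _.
  by rewrite tnormN -ltrBrDr; apply: le_lt_trans X2; exact: tnorm_le.
apply: (he1 X _ S' S'l); apply: le_lt_trans X1; exact: tnorm_le.
Qed.

Lemma continuous_bounded (omega : {scalar symt V}) :
  continuous (omega : symt V -> R[i]^o) ->
  exists2 h, cont_form h & exists2 M : R[i], 0 <= M &
    forall X, `|omega X| ^+ 2 <= M * tip h (symt_val X) (symt_val X).
Proof.
move=> wc; have : nbhs (0 : symt V) [set X | `|omega X| < 1].
  have /cvgrPdist_lt/(_ 1 ltr01) := wc 0; apply: filterS => X /=.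
  by rewrite linear0 sub0r normrN.
rewrite nbhsE; case=> O [oO O0] OB.
case: oO => A oA AO; have A0 : A 0 by move: O0; rewrite -AO.
have [h hc [e e0 he]] := nbhs0_tensor (open_nbhs_nbhs (conj oA A0)).
have hp := cont_form_psd hc.
have small X : tnorm h (symt_val X) < e -> `|omega X| < 1.
  by move=> Xe; apply: OB; rewrite -AO; exact: he.
exists h => //; exists (e^-1 ^+ 2)%:C%C; first by rewrite ler0c exprn_ge0 ?invr_ge0 ?ltW.
move=> X; set t := tnorm h (symt_val X).
have t0 : 0 <= t by exact: tnorm_ge0.
have [n nE] : exists n : R, `|omega X| = n%:C%C by apply/complex_realP/normr_real.
have n0 : 0 <= n by rewrite -ler0c -nE.
have bound s : t < s -> n * e <= s.
  move=> ts; have s0 : 0 < s by exact: le_lt_trans ts.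
  have es0 : 0 < e / s by rewrite divr_gt0.
  have H1 : tnorm h (symt_val ((e / s)%:C%C *: X)) < e.
    by rewrite symt_valZ (tnormZ _ hp (ltW es0)) -/t mulrAC ltr_pdivrMr // ltr_pM2l.
  have := small _ H1; rewrite linearZ normrM nE.
  have -> : `|(e / s)%:C%C| = (e / s)%:C%C :> R[i].
    by apply: ger0_norm; rewrite ler0c; exact: ltW.
  have -> : (e / s)%:C%C * n%:C%C = (e / s * n)%:C%C :> R[i] by rewrite [RHS]rmorphM.
  by rewrite ltcR mulrAC ltr_pdivrMr // mul1r mulrC => /ltW.
have net : n * e <= t.
  rewrite leNgt; apply/negP => tn.
  have /bound : t < (t + n * e) / 2 by lra.
  lra.
rewrite (tip_tnorm _ hp) -/t nE.
have -> : n%:C%C ^+ 2 = (n ^+ 2)%:C%C :> R[i] by rewrite rmorphXn.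
have -> : (e^-1 ^+ 2)%:C%C * (t ^+ 2)%:C%C = ((e^-1 * t) ^+ 2)%:C%C :> R[i].
  by rewrite exprMn [RHS]rmorphM.
rewrite lecR ler_pXn2r // ?nnegrE ?mulr_ge0 ?invr_ge0 ?(ltW e0) //.
by rewrite mulrC ler_pdivlMr.
Qed.

Lemma sqr_bound_lt (n m t e : R) : 0 < e -> 0 <= m -> 0 <= t ->
  n ^+ 2 <= m * t ^+ 2 -> t * (m + 1) < e -> n < e.
Proof.
move=> e0 m0 t0 nt tm; rewrite ltNge; apply/negP => en.
have tm0 : 0 <= t * (m + 1) by rewrite mulr_ge0 ?addr_ge0.
have : (t * (m + 1)) ^+ 2 < e ^+ 2 by rewrite ltr_pXn2r ?nnegrE ?(ltW e0).
have : e ^+ 2 <= n ^+ 2 by rewrite ler_pXn2r ?nnegrE ?(ltW e0) ?(le_trans (ltW e0) en).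
have : m * t ^+ 2 <= (t * (m + 1)) ^+ 2.
  rewrite exprMn mulrC ler_wpM2l ?exprn_ge0 //.
  have mm : 0 <= m * m by exact: mulr_ge0.
  by rewrite expr2; lra.
lra.
Qed.

Lemma bounded_continuous h (f : tensor V -> R[i]) (M : R[i]) : cont_form h -> 0 <= M ->
  (forall X Y, f (X - Y) = f X - f Y) ->
  (forall X, `|f X| ^+ 2 <= M * tip h X X) ->
  continuous (fun X : symt V => f (symt_val X) : R[i]^o).
Proof.
move=> hc M0 fB fM X0; have hp := cont_form_psd hc.
apply/(@cvgrPdist_lt _ _ _ (nbhs X0) (nbhs_filter X0)) => e' e'0; have [e e0 ->] := gt0_complexP e'0.
have [m mE] : exists m : R, M = m%:C%C by apply/complex_realP/ger0_real.
have m0 : 0 <= m by rewrite -ler0c -mE.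
pose d := e / (m + 1).
have m1 : 0 < m + 1 by rewrite ltr_wpDl.
have d0 : 0 < d by rewrite divr_gt0.
have oB : open (tball h (symt_val X0) d).
  exists [set tball h (symt_val X0) d]; last by rewrite bigcup_set1.
  move=> _ ->; exists [fset (tball h (symt_val X0) d : set (tensor V))]%fset.
    move=> _ /fset1P ->; apply/mem_set.
    by exists h, (symt_val X0), d.
  by rewrite set_fset1 bigcap_set1.
have nB : nbhs X0 [set X : symt V | tball h (symt_val X0) d (symt_val X)].
  apply: open_nbhs_nbhs; split; first by exists (tball h (symt_val X0) d).
  by rewrite /= /tball /= subrr /tnorm tip0l /= sqrtr0.
apply: (@filterS _ (nbhs X0) (nbhs_filter X0) _ _ _ nB) => X /=.
rewrite /tball /= => Xd.
rewrite -normrN opprB -fB.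
have := fM (symt_val X - symt_val X0); rewrite (tip_tnorm _ hp) mE.
set t := tnorm h _ in Xd *; have t0 : 0 <= t by exact: tnorm_ge0.
have [n ->] : exists n : R, `|f (symt_val X - symt_val X0)| = n%:C%C.
  by apply/complex_realP/normr_real.
have -> : n%:C%C ^+ 2 = (n ^+ 2)%:C%C :> R[i] by rewrite rmorphXn.
have -> : m%:C%C * (t ^+ 2)%:C%C = (m * t ^+ 2)%:C%C :> R[i] by rewrite [RHS]rmorphM.
rewrite lecR ltcR => nt.
have tm : t * (m + 1) < e by rewrite -ltr_pdivlMr.
exact: sqr_bound_lt nt tm.
Qed.

End Topology.

(** * Wick functionals are continuous and positive *)

Section Functionals.
Context {R : realType} {V : tvsType R[i]}.
Implicit Types h : {bilinear V -> V -> R[i] | Num.conj \; *%R & *%R}.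
Local Notation cont_form := (@cont_pos_herm_form R V).

Lemma form_normE h v : cont_form h -> h v v = ((form_norm h v) ^+ 2)%:C%C.
Proof.
case=> _ /(_ v) h0 _; move: h0; rewrite lecE /= => /andP[/eqP im re].
rewrite /form_norm sqr_sqrtr //; case: (h v v) im => a b /= ->.
by [].
Qed.

Definition abs_functional (rho : V -> R[i]) (v : V) : R := complex.Re `|rho v|.

Lemma abs_functionalE (rho : V -> R[i]) v : `|rho v| = (abs_functional rho v)%:C%C.
Proof. by apply/esym/RRe_real/normr_real. Qed.

Lemma abs_functional_seminorm (rho : {scalar V}) : seminorm (abs_functional rho).
Proof.
split=> [v w|a v].
  rewrite -lecR rmorphD /= -!abs_functionalE linearD; exact: ler_normD.
by rewrite /abs_functional linearZ normrM abs_functionalE /= mulr0 subr0.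
Qed.

Lemma abs_functional_continuous (rho : {scalar V}) : continuous (rho : V -> R[i]^o) ->
  continuous (abs_functional rho).
Proof.
move=> rc; apply: seminorm_continuous; first exact: abs_functional_seminorm.
have /cvgrPdist_lt/(_ 1 ltr01) := rc 0; apply: filterS => v /=.
rewrite linear0 sub0r normrN abs_functionalE -[1]/(1%:C%C) ltcR; exact: ltW.
Qed.

(** The modulus of rho is a continuous seminorm, so a Hilbert seminorm bounds
    it. *)
Lemma functional_dom (rho : {scalar V}) : hilbert_seminorms_cofinal V ->
  continuous (rho : V -> R[i]^o) -> exists2 h, cont_form h & dom (rank1 rho) h.
Proof.
move=> hV rc.
have [h hc rh] := hV _ (abs_functional_seminorm rho) (abs_functional_continuous rc).
exists h => // s; rewrite gramB subr_ge0 gram_rank1.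
rewrite -(sesquilinear_gram (formPl h) (formPr h) id).
have -> : \sum_(p <- s) p.1 * rho p.2 = rho (\sum_(p <- s) p.1 *: p.2).
  by rewrite linear_sum; apply: eq_bigr => p _; rewrite linearZ.
rewrite (form_normE _ hc) abs_functionalE -(rmorphXn (real_complex R)) lecR.
have a0 v : 0 <= abs_functional rho v by rewrite -ler0c -abs_functionalE.
by rewrite ler_pXn2r ?nnegrE ?sqrtr_ge0.
Qed.

Lemma hilbert_schmidt_rank1_dom (b : {bilinear V -> V -> R[i] | *%R & *%R}) : hilbert_schmidt b ->
  exists2 h, cont_form h &
    dom (rank1 (fun p : V * V => b p.1 p.2)) (fun p q => h p.1 q.1 * h p.2 q.2).
Proof.
move=> [h hc [b0 b1]]; exists h => //; apply: hilbert_schmidt_dom => //.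
  exact: cont_form_psd.
have n0 v : h v v = 0 -> form_norm h v = 0 by rewrite /form_norm => ->; rewrite sqrtr0.
by move=> v w vw; apply: b0; case: vw => /n0; [left|right].
Qed.

Variables (b : {bilinear V -> V -> R[i] | *%R & *%R}).

(** The forms that control b and rho are added, so that a single h dominates
    both. *)
Lemma wick_functional (rho : {scalar V}) : hilbert_seminorms_cofinal V ->
  hilbert_schmidt b -> continuous (rho : V -> R[i]^o) ->
  exists2 omega : {scalar symt V}, continuous (omega : symt V -> R[i]^o) &
    forall X, omega X = wick_fun b rho (symt_val X).
Proof.
move=> hV /hilbert_schmidt_rank1_dom[h1 hc1 bh1] /(functional_dom hV)[h2 hc2 rh2].
have [h hc hE] := cont_form_add hc1 hc2.
have h1p := cont_form_psd hc1; have h2p := cont_form_psd hc2.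
have h1h : dom h1 h by apply: eq_psd h2p => x y; rewrite hE addrAC subrr add0r.
have h2h : dom h2 h by apply: eq_psd h1p => x y; rewrite hE addrK.
have hp := cont_form_psd hc.
have bh : dom (rank1 (fun p : V * V => b p.1 p.2)) (fun p q => h p.1 q.1 * h p.2 q.2).
  apply: dom_trans bh1 _; apply: domM.
  - exact: (psd_comp fst h1p).
  - exact: (psd_comp snd hp).
  - exact: (psd_comp fst h1h).
  - exact: (psd_comp snd h1h).
have [h' hc' h'E] := cont_form_scale (ler0n _ 32) hc.
have bound X : `|wick_fun b rho X| ^+ 2 <= 16%:R * tip h' X X.
  exact: (wick_bounded X hp h'E bh (dom_trans rh2 h2h)).
have [|omega omegaE] := @exists_scalar _ (symt V) (fun X => wick_fun b rho (symt_val X)).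
  by move=> a X Y; rewrite symt_valD symt_valZ wick_funP.
exists omega => //.
have -> : (omega : symt V -> R[i]^o) = (fun X : symt V => wick_fun b rho (symt_val X) : R[i]^o).
  by apply: funext => X; rewrite omegaE.
apply: (bounded_continuous hc' (ler0n _ 16) _ bound) => X Y.
by rewrite [X - Y]addrC -scaleN1r wick_funP mulN1r addrC.
Qed.

Lemma one_symmetric : tens [::] \in @symmetric_tensor R[i] V.
Proof. by apply/symmetricP; exists (tens [::]); rewrite -[[::]]/(nseq 0 0) tsym_nseq. Qed.

Definition sone : symt V := SymT one_symmetric.

Definition real_functional (cj : V -> V) (rho : {scalar V}) : Prop :=
  continuous (rho : V -> R[i]^o) /\ forall x, rho (cj x) = (rho x)^*.

Variable cj : {linear V -> V | Num.conj \; *:%R}.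
Hypotheses (cjK : involutive cj) (cj_continuous : continuous cj).

Lemma conj_functional (sigma : {scalar V}) : continuous (sigma : V -> R[i]^o) ->
  continuous (fun x => (sigma (cj x))^* : R[i]^o).
Proof.
move=> sc x; apply/cvgrPdist_lt => e e0.
have : (fun y => sigma (cj y) : R[i]^o) @ x --> (sigma (cj x) : R[i]^o).
  exact: (continuous_comp (@cj_continuous x) (@sc (cj x))).
move=> /cvgrPdist_lt/(_ e e0); apply: filterS => y.
by rewrite -rmorphB norm_conjC.
Qed.

Lemma real_functional_comb (a : R[i]) (rho1 rho2 : {scalar V}) : a \is Num.real ->
  real_functional cj rho1 -> real_functional cj rho2 ->
  exists2 rho : {scalar V}, real_functional cj rho & forall x, rho x = a * rho1 x + rho2 x.
Proof.
move=> ar [c1 r1] [c2 r2].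
have [|rho rhoE] := @exists_scalar _ V (fun x => a * rho1 x + rho2 x).
  by move=> c x y; rewrite !linearP /=; ring.
exists rho; last exact: rhoE.
split=> [|x]; last first.
  by rewrite !rhoE r1 r2 rmorphD rmorphM /= (CrealP ar).
have -> : (rho : V -> R[i]^o) = (fun x => a *: (rho1 x : R[i]^o) + (rho2 x : R[i]^o)).
  by apply: funext => x; rewrite rhoE.
by move=> x; apply: cvgD; [apply: cvgZr; exact: c1|exact: c2].
Qed.

(** Some continuous form h has h v v nonzero, and sigma = h v is then a continuous functional with sigma v nonzero. It is a complex combination of the
    real functionals sigma + tau and 'i (sigma - tau), where tau x is the conjugate
    of sigma (cj x); one of the two is thus nonzero at v. *)
Lemma real_functional_separating (v : V) : hausdorff_space V -> hilbert_seminorms_cofinal V ->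
  v != 0 -> exists2 rho : {scalar V}, real_functional cj rho & rho v != 0.
Proof.
move=> hH hV v0; have [p [pS pc pv]] := exists_seminorm hH v0.
have [h hc ph] := hV p pS pc.
have n0 : 0 < form_norm h v by exact: lt_le_trans pv (ph v).
have hv : h v v != 0.
  rewrite (form_normE v hc) -[0]/(0%:C%C) (inj_eq (@complexI R)).
  by rewrite expf_neq0 // gt_eqF.
have [|sigma sE] := @exists_scalar _ V (h v); first by move=> a x y; exact: formPr.
have sc : continuous (sigma : V -> R[i]^o).
  have -> : (sigma : V -> R[i]^o) = (h v : V -> R[i]^o) by apply: funext => x; rewrite sE.
  exact: cont_form_left.
have [|tau tE] := @exists_scalar _ V (fun x => (sigma (cj x))^*).
  by move=> a x y; rewrite linearP linearP /= rmorphD rmorphM /= conjCK.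
have tc : continuous (tau : V -> R[i]^o).
  have -> : (tau : V -> R[i]^o) = (fun x => (sigma (cj x))^* : R[i]^o).
    by apply: funext => x; rewrite tE.
  exact: conj_functional.
have comb (a c : R[i]) : a^* = c ->
    exists2 rho : {scalar V}, real_functional cj rho & forall x, rho x = a * sigma x + c * tau x.
  move=> ac; have [|rho rhoE] := @exists_scalar _ V (fun x => a * sigma x + c * tau x).
    by move=> z x y; rewrite !linearP /=; ring.
  exists rho; last exact: rhoE.
  split=> [|x]; last first.
    rewrite !rhoE !tE cjK rmorphD !rmorphM /= conjCK -ac conjCK; ring.
  have -> : (rho : V -> R[i]^o) = (fun x => a *: (sigma x : R[i]^o) + c *: (tau x : R[i]^o)).
    by apply: funext => x; rewrite rhoE.
  by move=> x; apply: cvgD; apply: cvgZr; [exact: sc|exact: tc].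
have [rho1 r1 r1E] := comb 1 1 (rmorph1 _).
have [rho2 r2 r2E] := comb 'i (- 'i) (conjCi _).
have [r1v|r1v] := eqVneq (rho1 v) 0; last by exists rho1.
have [r2v|r2v] := eqVneq (rho2 v) 0; last by exists rho2.
exfalso; move/eqP: hv; apply; rewrite -sE.
have : sigma v *+ 2 = rho1 v - 'i * rho2 v.
  rewrite r1E r2E; have := sqrCi R[i]; rewrite expr2 => ii.
  have alg (i s t : R[i]) : i * i = -1 -> s *+ 2 = 1 * s + 1 * t - i * (i * s + - i * t).
    move=> i2; have -> : 1 * s + 1 * t - i * (i * s + - i * t) = s + t - (i * i) * s + (i * i) * t.
      by ring.
    by rewrite i2; ring.
  exact: alg.
by rewrite r1v r2v mulr0 subr0 => /eqP; rewrite mulrn_eq0 /= => /eqP.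
Qed.

Variable Lambda : {bilinear V -> V -> R[i] | *%R & *%R}.
Hypotheses (b_sym : forall v w, b v w = b w v) (b_herm : hermitian_bilinear cj b)
  (b_hs : hilbert_schmidt b) (b_pos : forall v, 0 <= Lambda (cj v) v + b (cj v) v).

Lemma wick_cont_pos (rho : {scalar V}) : hilbert_seminorms_cofinal V ->
  real_functional cj rho ->
  exists2 omega, cont_pos_functional cj Lambda omega &
    forall X, omega X = wick_fun b rho (symt_val X).
Proof.
move=> hV [rc rr]; have [omega oc oE] := wick_functional hV b_hs rc.
exists omega; last exact: oE.
split=> // X; rewrite oE.
exact: (wick_star_ge0 b_sym b_herm rr b_pos (symt_valP X)).
Qed.

Lemma zero_real_functional : exists rho : {scalar V}, real_functional cj rho.
Proof.
have [|rho rE] := @exists_scalar _ V (fun=> 0 : R[i]).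
  by move=> a x y; rewrite mulr0 addr0.
exists rho; split=> [|x]; last by rewrite !rE rmorph0.
have -> : (rho : V -> R[i]^o) = (fun=> 0 : R[i]^o) by apply: funext => x; rewrite rE.
by move=> x; exact: cvg_cst.
Qed.

Lemma exists_cont_pos : hilbert_seminorms_cofinal V ->
  exists2 omega, cont_pos_functional cj Lambda omega & exists X, omega X != 0.
Proof.
move=> hV; have [rho rr] := zero_real_functional.
have [omega op oE] := wick_cont_pos hV rr; exists omega => //.
exists sone; rewrite oE wick_fun_tens.
have [H _] := wick_nseq_hermite b rho 0.
by rewrite -[[::]]/(nseq 0 0) H oner_eq0.
Qed.

Lemma cont_pos_separating (X : symt V) : hausdorff_space V -> hilbert_seminorms_cofinal V ->
  (forall omega, cont_pos_functional cj Lambda omega -> omega X = 0) -> X = 0.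
Proof.
move=> hH hV oX; have [rho0 rr0] := zero_real_functional.
apply: val_inj; apply: etrans (esym symt_val0).
apply: (@wick_separating _ _ (real_functional cj) real_functional_comb _ b rho0 rr0 _ (symt_valP X)).
  by move=> v v0; exact: real_functional_separating.
move=> rho rr; have [omega op oE] := wick_cont_pos hV rr.
by rewrite -oE; exact: oX.
Qed.

End Functionals.

(** * From positive functionals to Hilbert-Schmidt forms *)

Section Degree2.
Context {C : numClosedFieldType} {V : lmodType C}.
Implicit Types h : {bilinear V -> V -> C | Num.conj \; *%R & *%R}.

Lemma tsym2 (x y : V) :
  tsym (tens [:: x; y]) = 2%:R^-1 *: (tens [:: x; y] + tens [:: y; x]).
Proof.
have tl (z a c : V) : tens [:: a + c; z] = tens [:: a; z] + tens [:: c; z] :> tensor V.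
  by have := @tens_multilinear _ V [::] [:: z] 1 a c; rewrite /= !scale1r.
have tr (z a c : V) : tens [:: z; a + c] = tens [:: z; a] + tens [:: z; c] :> tensor V.
  by have := @tens_multilinear _ V [:: z] [::] 1 a c; rewrite /= !scale1r.
have sq (z : V) : tsym (tens [:: z; z]) = tens [:: z; z] by exact: (tsym_nseq 2 z).
have yx : tsym (tens [:: y; x]) = tsym (tens [:: x; y]).
  by apply: tsym_perm; rewrite -[[:: y; x]]/([:: y] ++ [:: x]) perm_catC.
have tD (X Y : tensor V) : tsym (X + Y) = tsym X + tsym Y.
  by have := tsymP 1 X Y; rewrite !scale1r.
have cancel (A B B' D w : tensor V) :
    (A + w) + (w + D) = (A + B) + (B' + D) -> w *+ 2 = B + B'.
  by rewrite -!addrA => /addrI; rewrite !addrA => /addIr <-; rewrite mulr2n.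
have T : tens [:: x + y; x + y] =
    (tens [:: x; x] + tens [:: x; y]) + (tens [:: y; x] + tens [:: y; y]).
  by rewrite (tl (x + y) x y) (tr x x y) (tr y x y).
have E2 : tsym (tens [:: x; y]) *+ 2 = tens [:: x; y] + tens [:: y; x].
  apply: (cancel (tens [:: x; x]) _ _ (tens [:: y; y])).
  by rewrite -T -(sq (x + y)) T !tD (sq x) (sq y) yx.
move: E2; move: (tsym _) (_ + _) => S S' <-.
by rewrite -[X in _ *: X]scaler_nat scalerA mulVf ?scale1r // pnatr_eq0.
Qed.

(** Powers span the symmetric tensors. *)
Lemma linear_fix_powers (F : tensor V -> tensor V) (X : tensor V) :
  (forall a X Y, F (a *: X + Y) = a *: F X + F Y) ->
  (forall k x, F (tens (nseq k x)) = tens (nseq k x)) ->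
  X \in @symmetric_tensor C V -> F X = X.
Proof.
move=> Fl Fp /symmetric_powers[r ->].
have -> : \sum_(p <- r) p.1 *: powt p.2 =
    \sum_(p <- [seq (p.1, nseq p.2.1 p.2.2) | p <- r]) p.1 *: tens p.2 by rewrite big_map.
rewrite (linfun_sum Fl) !big_map; apply: eq_bigr => p _.
by rewrite Fp.
Qed.

Lemma star1l (Lambda : {bilinear V -> V -> C | *%R & *%R}) X :
  X \in @symmetric_tensor C V -> star Lambda (tens [::]) X = X.
Proof.
apply: (linear_fix_powers (F := star Lambda (tens [::]))) => [a Y Z|k x]; first exact: starPr.
have := star_nseq Lambda k 0 x (ltn0Sn 0); rewrite [nseq 0 _]/= => ->.
by rewrite big_ord_recl big_ord0 addr0 !ffactn0 expr0 fact0 divr1 !mulr1 scale1r subn0 /= tsym_nseq.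
Qed.

Lemma star1r (Lambda : {bilinear V -> V -> C | *%R & *%R}) X :
  X \in @symmetric_tensor C V -> star Lambda X (tens [::]) = X.
Proof.
apply: (linear_fix_powers (F := fun X => star Lambda X (tens [::]))) => [a Y Z|k x]; first exact: starPl.
have := star_nseq Lambda 0 x 0 (ltnSn k); rewrite [nseq 0 _]/= => ->.
rewrite big_ord_recl big1 ?addr0 => [|i _]; last by rewrite ffact0n mulr0 !mul0r scale0r.
by rewrite !ffactn0 expr0 fact0 divr1 !mulr1 scale1r subn0 /= cats0 tsym_nseq.
Qed.

Lemma star_degree1 (Lambda : {bilinear V -> V -> C | *%R & *%R}) x y :
  star Lambda (tens [:: x]) (tens [:: y]) = tsym (tens [:: x; y]) + Lambda x y *: tens [::].
Proof.
have sum2 (U : nmodType) (F : nat -> U) : \sum_(t < 2) F t = F 0%N + F 1%N.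
  by rewrite big_ord_recl big_ord1.
pose c t : C := (1 ^_ t)%:R * (1 ^_ t)%:R / t`!%:R * Lambda x y ^+ t.
have c0 : c 0%N = 1 by rewrite /c !ffactn0 expr0 fact0 divr1 !mulr1.
have c1 : c 1%N = Lambda x y by rewrite /c !ffactn1 expr1 divr1 !mul1r.
apply: etrans (star_nseq Lambda 1 x y (ltnSn 1)) _.
apply: etrans (sum2 _ (fun t => c t *: tsym (tens (nseq (1 - t) x ++ nseq (1 - t) y)))) _.
rewrite c0 c1 scale1r; apply: (congr2 (fun S T => S + Lambda x y *: T)) => //.
exact: (tsym_nseq 0 x).
Qed.

Lemma tip_degree2 h x y z w :
  tip h (tens [:: x; y]) (tens [:: z; w]) = 2%:R * (h x z * h y w).
Proof. by rewrite tip_tens /ip_word /= big_cons big_seq1. Qed.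

End Degree2.

Lemma sum_symmetrized (K : numFieldType) (W : lmodType K) (I : finType)
    (sw : I -> I) (c : I -> K) (S A : I -> W) : involutive sw ->
  (forall p, c (sw p) = c p) -> (forall p, S p = 2%:R^-1 *: (A p + A (sw p))) ->
  \sum_p c p *: S p = \sum_p c p *: A p.
Proof.
move=> swK c_sw SE; set T := RHS.
have TE : \sum_p c p *: A (sw p) = T.
  rewrite /T [RHS](reindex_inj (inv_inj swK)).
  by apply: eq_bigr => p _; rewrite c_sw.
transitivity (2%:R^-1 *: (T + T)).
  rewrite -{2}TE -big_split scaler_sumr; apply: eq_bigr => p _.
  by rewrite SE /= -scalerDr !scalerA mulrC.
by rewrite -[T + T]mulr2n -[X in _ *: X]scaler_nat scalerA mulVf ?scale1r // pnatr_eq0.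
Qed.

Section Necessity.
Context {R : realType} {V : tvsType R[i]}.
Variable cj : {linear V -> V | Num.conj \; *:%R}.
Variable Lambda : {bilinear V -> V -> R[i] | *%R & *%R}.
Implicit Types X Y Z : symt V.

Lemma symt_val_lin a X Y : symt_val (a *: X + Y) = a *: symt_val X + symt_val Y.
Proof. by rewrite symt_valD symt_valZ. Qed.

Lemma symt_eq_lin a X Y Z : symt_val Z = a *: symt_val X + symt_val Y -> Z = a *: X + Y.
Proof. by move=> E; apply: val_inj; apply: etrans E (esym (symt_val_lin a X Y)). Qed.

Lemma sstarPl a X Y Z : sstar Lambda (a *: X + Y) Z = a *: sstar Lambda X Z + sstar Lambda Y Z.
Proof.
apply: symt_eq_lin; have E := symt_val_lin a X Y.
exact: (etrans (congr1 (fun W => star Lambda W (symt_val Z)) E) (starPl Lambda a _ _ _)).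
Qed.

Lemma sstarPr a X Y Z : sstar Lambda Z (a *: X + Y) = a *: sstar Lambda Z X + sstar Lambda Z Y.
Proof.
apply: symt_eq_lin; have E := symt_val_lin a X Y.
exact: (etrans (congr1 (fun W => star Lambda (symt_val Z) W) E) (starPr Lambda a _ _ _)).
Qed.

Lemma sadjP a X Y : sadj cj (a *: X + Y) = a^* *: sadj cj X + sadj cj Y.
Proof.
apply: symt_eq_lin; have E := symt_val_lin a X Y.
exact: (etrans (congr1 (tadj cj) E) (tadjP cj a _ _)).
Qed.

Lemma sadj_sone : sadj cj sone = sone.
Proof. by apply: val_inj; rewrite /= tadj_tens. Qed.

Lemma sstar1l X : sstar Lambda sone X = X.
Proof. by apply: val_inj; exact: (star1l Lambda (symt_valP X)). Qed.

Lemma sstar1r X : sstar Lambda X sone = X.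
Proof. by apply: val_inj; exact: (star1r Lambda (symt_valP X)). Qed.

Lemma tsym_symmetric (X : tensor V) : tsym X \in @symmetric_tensor R[i] V.
Proof. by apply/symmetricP; exists X. Qed.

Definition svec (v : V) : symt V := SymT (tsym_symmetric (tens [:: v])).
Definition svee (v w : V) : symt V := SymT (tsym_symmetric (tens [:: v; w])).

Lemma tsym_tens1 (v : V) : tsym (tens [:: v]) = tens [:: v].
Proof. exact: (tsym_nseq 1 v). Qed.

Lemma svee_Pl a x y z : svee (a *: x + y) z = a *: svee x z + svee y z.
Proof.
apply: symt_eq_lin; have E := @tens_multilinear _ V [::] [:: z] a x y.
exact: (etrans (congr1 (@tsym _ V) E) (tsymP a _ _)).
Qed.

Lemma svee_sym v w : svee v w = svee w v.
Proof.
apply: val_inj; rewrite /=; apply: tsym_perm.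
by rewrite -[[:: v; w]]/([:: v] ++ [:: w]) perm_catC.
Qed.

Lemma svee_Pr a x y z : svee z (a *: x + y) = a *: svee z x + svee z y.
Proof. by rewrite ![svee z _]svee_sym svee_Pl. Qed.

Lemma sadj_svee v w : sadj cj (svee v w) = svee (cj w) (cj v).
Proof.
apply: val_inj; rewrite /= !tsym_tens tadj_sym_word.
by congr sym_word.
Qed.

Lemma sstar_svec v : sstar Lambda (sadj cj (svec v)) (svec v) =
  svee (cj v) v + Lambda (cj v) v *: sone.
Proof.
rewrite addrC; apply: symt_eq_lin; rewrite [symt_val (sstar _ _ _)]/=.
rewrite [symt_val sone]/= [symt_val (svee _ _)]/= !tsym_tens1 tadj_tens.
by rewrite [rev _]/= star_degree1 addrC.
Qed.

Variable omega : {scalar symt V}.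
Hypothesis omega_pos : cont_pos_functional cj Lambda omega.

Let F X Y : R[i] := omega (sstar Lambda (sadj cj X) Y).

Let Fl a X Y Z : F (a *: X + Y) Z = a^* * F X Z + F Y Z.
Proof. by rewrite /F sadjP sstarPl linearP. Qed.

Let Fr a X Y Z : F Z (a *: X + Y) = a * F Z X + F Z Y.
Proof. by rewrite /F sstarPr linearP. Qed.

Lemma psd_functional : psd F.
Proof.
by move=> s; rewrite -(sesquilinear_gram Fl Fr id); case: omega_pos => _; apply.
Qed.

(** Hermitian symmetry of the form (X, Y) |-> omega (X^+ star Y) at Y = 1. *)
Lemma functional_sadj X : omega (sadj cj X) = (omega X)^*.
Proof.
have := psd_herm X sone psd_functional.
by rewrite /F sstar1r sadj_sone sstar1l.
Qed.

(** If 1 were a null vector of that form, it would be orthogonal to every X,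
    and omega would vanish. *)
Lemma functional_one_gt0 : (exists X, omega X != 0) -> 0 < omega sone.
Proof.
move=> [X oX]; rewrite lt0r; have := psd_diag sone psd_functional.
rewrite /F sadj_sone sstar1l => ->; rewrite andbT; apply: contraNneq oX => o0.
have := @psd_diag0 _ _ F sone X psd_functional.
by rewrite /F sadj_sone !sstar1l => /(_ o0) ->.
Qed.

Lemma tip_svee0 (h : {bilinear V -> V -> R[i] | Num.conj \; *%R & *%R}) v w : psd h ->
  h v v = 0 \/ h w w = 0 -> tip h (tsym (tens [:: v; w])) (tsym (tens [:: v; w])) = 0.
Proof.
move=> hp vw; have t0 (X : tensor V) : tip h X X = 0 -> tnorm h X = 0.
  by rewrite /tnorm => ->; rewrite sqrtr0.
have A0 : tnorm h (tens [:: v; w]) = 0.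
  by apply: t0; rewrite tip_degree2; case: vw => ->; rewrite !(mul0r, mulr0).
have B0 : tnorm h (tens [:: w; v]) = 0.
  by apply: t0; rewrite tip_degree2; case: vw => ->; rewrite !(mul0r, mulr0).
have AB0 : tnorm h (tens [:: v; w] + tens [:: w; v]) = 0.
  apply/le_anti; rewrite tnorm_ge0 andbT.
  by apply: le_trans (tnorm_triangle _ _ hp) _; rewrite A0 B0 addr0.
by rewrite tsym2 tipZ (tip_tnorm _ hp) AB0 expr0n mulr0.
Qed.

Lemma sum_tsym2 d (e : 'I_d -> V) (c : 'I_d * 'I_d -> R[i]) :
  (forall i j, c (i, j) = c (j, i)) ->
  \sum_p c p *: tsym (tens [:: e p.1; e p.2]) = \sum_p c p *: tens [:: e p.1; e p.2].
Proof.
move=> c_sym; apply: (@sum_symmetrized _ _ _ (fun p => (p.2, p.1))).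
- by case.
- by case=> i j; exact: c_sym.
- by case=> i j; exact: tsym2.
Qed.

(** The tensors e_i (x) e_j are orthogonal of squared norm 2 l^2, where
    2 = 2! comes from the inner product in degree 2. *)
Lemma tip_orthonormal2 (h : {bilinear V -> V -> R[i] | Num.conj \; *%R & *%R})
    d (e : 'I_d -> V) (c : 'I_d * 'I_d -> R[i]) l :
  (forall i j, h (e i) (e j) = l * (i == j)%:R) ->
  tip h (\sum_p c p *: tens [:: e p.1; e p.2]) (\sum_p c p *: tens [:: e p.1; e p.2]) =
  2%:R * l ^+ 2 * \sum_p `|c p| ^+ 2.
Proof.
move=> eo; have := sesquilinear_gram (tipPl h) (tipPr h)
  (fun p : 'I_d * 'I_d => tens [:: e p.1; e p.2]) [seq (c p, p) | p <- index_enum _].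
rewrite /gram !big_map => ->; rewrite mulr_sumr; apply: eq_bigr => p _.
rewrite big_map (bigD1 p) //= big1 ?addr0 => [|q qp].
  rewrite tip_degree2 !eo !eqxx normCKC [true%:R]/(1 : R[i]); ring.
rewrite tip_degree2 !eo; have [pq1|] := eqVneq p.1 q.1; last by rewrite !(mulr0, mul0r).
have [pq2|] := eqVneq p.2 q.2; last by rewrite !(mulr0, mul0r).
by case/eqP: qp; case: p q pq1 pq2 => [i j] [k m] /= -> ->.
Qed.

(** The form is b(v, w) = omega (v \/ w) / omega 1. For e orthonormal for l h and
    S the sum of the |b(e_i, e_j)|^2, the bound of omega on the sum X of the
    conj(b(e_i, e_j)) e_i \/ e_j reads (omega 1)^2 S^2 <= 2 M l^(-2) S, because
    omega X = omega 1 * S. Hence S <= 1 as soon as l^2 >= 2 M / (omega 1)^2. *)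
Lemma functional_form (cjK : involutive cj) : (exists X, omega X != 0) ->
  exists b : {bilinear V -> V -> R[i] | *%R & *%R},
    [/\ forall v w, b v w = b w v, hermitian_bilinear cj b, hilbert_schmidt b &
        forall v, 0 <= Lambda (cj v) v + b (cj v) v].
Proof.
move=> /functional_one_gt0; set a := omega sone => a0.
have an0 : a != 0 by rewrite gt_eqF.
have [|z k x y|b bE] := @exists_bilinear _ V V _ *%R *%R (fun v w => omega (svee v w) / a).
- by move=> z k x y; rewrite svee_Pl linearP /= mulrDl mulrA.
- by rewrite svee_Pr linearP /= mulrDl mulrA.
have b_sym v w : b v w = b w v by rewrite !bE svee_sym.
exists b; split=> //.
- move=> v w; rewrite !bE rmorphM fmorphV /= -functional_sadj sadj_svee !cjK.
  by have -> : a^* = a by apply/CrealP/gtr0_real.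
- have [h hc [M M0 bound]] := continuous_bounded omega_pos.1.
  have hp := cont_form_psd hc.
  pose mu := M / a ^+ 2; have mu0 : 0 <= mu by rewrite divr_ge0 // exprn_ge0 // (ltW a0).
  (* l >= 1 and l >= 2 mu, so that 2 mu <= l^2. *)
  pose l := 1 + 2%:R * mu; have l1 : 1 <= l by rewrite lerDl mulr_ge0.
  have l0 : 0 < l by exact: lt_le_trans l1.
  have [h1 hc1 h1E] := cont_form_scale (ltW l0) hc.
  exists h1 => //; split=> [v w vw|d e eo].
    have {}vw : h v v = 0 \/ h w w = 0.
      have n0 u : form_norm h1 u = 0 -> h u u = 0.
        move=> nu; have := form_normE u hc1; rewrite nu expr0n h1E => /eqP.
        by rewrite mulf_eq0 (gt_eqF l0) => /eqP.
      by case: vw => /n0; [left|right].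
    have := bound (svee v w); rewrite /= (tip_svee0 hp vw) mulr0 bE => o0.
    suff -> : omega (svee v w) = 0 by rewrite mul0r.
    by apply/eqP; rewrite -normr_eq0 -sqrf_eq0; apply/eqP/le_anti; rewrite o0 exprn_ge0.
  rewrite pair_bigA /=; pose c (p : 'I_d * 'I_d) := (b (e p.1) (e p.2))^*.
  set S := \sum_p _; pose X : symt V := \sum_p c p *: svee (e p.1) (e p.2).
  have oX : omega X = a * S.
    rewrite linear_sum mulr_sumr; apply: eq_bigr => p _.
    by rewrite linearZ /= normCKC /c; rewrite [X in _ = a * (_ * X)]bE; field.
  have S0 : 0 <= S by apply: sumr_ge0 => p _; rewrite exprn_ge0.
  have XE : symt_val X = \sum_p c p *: tens [:: e p.1; e p.2].
    rewrite -(@sum_tsym2 _ e c) => [|i j]; last by rewrite /c b_sym.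
    rewrite /X; elim/big_rec2: _ => [|p T Y _ <-]; first exact: symt_val0.
    exact: symt_val_lin.
  have eo' i j : h (e i) (e j) = l^-1 * (i == j)%:R.
    by rewrite -eo h1E mulKf // gt_eqF.
  have := bound X; rewrite XE (tip_orthonormal2 _ eo') oX normrM (gtr0_norm a0) (ger0_norm S0).
  have -> : \sum_p `|c p| ^+ 2 = S by apply: eq_bigr => p _; rewrite norm_conjC.
  have [->|Sn0] := eqVneq S 0; first by rewrite ler01.
  have S1 : 0 < S by rewrite lt0r Sn0.
  have -> : (a * S) ^+ 2 = a ^+ 2 * S * S by ring.
  have -> : M * (2%:R * l^-1 ^+ 2 * S) = M * (2%:R * l^-1 ^+ 2) * S by ring.
  rewrite ler_pM2r // mulrC -ler_pdivlMr ?exprn_gt0 // => /le_trans; apply.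
  have -> : M * (2%:R * l^-1 ^+ 2) / a ^+ 2 = 2%:R * mu / l ^+ 2.
    by rewrite /mu exprVn; ring.
  rewrite ler_pdivrMr ?exprn_gt0 // mul1r.
  apply: (@le_trans _ _ l); first by rewrite lerDr.
  by rewrite expr2 ler_peMl // ltW.
- move=> v; have := psd_diag (svec v) psd_functional.
  rewrite /F sstar_svec linearD linearZ /= -/a bE => H.
  have -> : Lambda (cj v) v + omega (svee (cj v) v) / a =
      (omega (svee (cj v) v) + Lambda (cj v) v * a) / a.
    by rewrite mulrDl mulfK // addrC.
  by rewrite divr_ge0 // ltW.
Qed.

End Necessity.

Theorem theorem3p31 (R : realType) (V : tvsType R[i])
    (V_hausdorff : hausdorff_space V)
    (V_hilbert : hilbert_seminorms_cofinal V)
    (V_neq0 : exists v : V, v != 0)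
    (cj : {linear V -> V | Num.conj \; *:%R})
    (cjK : involutive cj) (cj_continuous : continuous cj)
    (Lambda : {bilinear V -> V -> R[i] | *%R & *%R})
    (Lambda_continuous :
      continuous (fun p : V * V => Lambda p.1 p.2 : R[i]^o))
    (Lambda_hermitian : hermitian_bilinear cj Lambda) :
  ((exists2 omega, cont_pos_functional cj Lambda omega &
      exists X, omega X != 0) <->
   (exists b : {bilinear V -> V -> R[i] | *%R & *%R},
      [/\ forall v w, b v w = b w v,
          hermitian_bilinear cj b,
          hilbert_schmidt b &
          forall v, 0 <= Lambda (cj v) v + b (cj v) v])) /\
  ((exists2 omega, cont_pos_functional cj Lambda omega &
      exists X, omega X != 0) ->
   forall X : symt V,
     (forall omega, cont_pos_functional cj Lambda omega -> omega X = 0) ->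
     X = 0).
Proof.
have sep : (exists b : {bilinear V -> V -> R[i] | *%R & *%R},
    [/\ forall v w, b v w = b w v, hermitian_bilinear cj b, hilbert_schmidt b &
        forall v, 0 <= Lambda (cj v) v + b (cj v) v]) ->
    (exists2 omega, cont_pos_functional cj Lambda omega & exists X, omega X != 0) /\
    (forall X : symt V,
      (forall omega, cont_pos_functional cj Lambda omega -> omega X = 0) -> X = 0).
  move=> [b [b_sym b_herm b_hs b_pos]]; split.
    exact: (exists_cont_pos b_sym b_herm b_hs b_pos V_hilbert).
  move=> X; exact: (cont_pos_separating cjK cj_continuous b_sym b_herm b_hs b_pos
    V_hausdorff V_hilbert).
have form : (exists2 omega, cont_pos_functional cj Lambda omega & exists X, omega X != 0) ->
    exists b : {bilinear V -> V -> R[i] | *%R & *%R},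
    [/\ forall v w, b v w = b w v, hermitian_bilinear cj b, hilbert_schmidt b &
        forall v, 0 <= Lambda (cj v) v + b (cj v) v].
  by move=> [omega op oX]; exact: (functional_form op cjK oX).
split; first by split=> [/form //|/sep[]].
by move=> /form/sep[].
Qed.
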